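(* Let $2<p<\infty$, $m\in\mathbb{N}$, $m\ge1$, and let $\alpha=\frac{p-2}{p-1}$. Let $\Omega\subset\mathbb{R}^2$ be a bounded simply connected domain. Suppose that there exists a constant $\theta\ge1$ such that every function $f\in L^m_p(\Omega)$ extends to a function $F\in L^m_p(\mathbb{R}^2)$ for which $\|F\|_{L^m_p(\mathbb{R}^2)}\le\theta\,\|f\|_{L^m_p(\Omega)}$. Then for every $\bar x,\bar y\in\Omega$ the inequality $$d_{\alpha,\Omega}(\bar x,\bar y)\le C\,\|\bar x-\bar y\|^{\alpha}$$ holds, where $C=\widetilde C\,\theta^{\frac{3p}{p-1}}$ and $\widetilde C$ is a positive constant depending only on $m$ and $p$.
   Context: A domain is an open connected set. $\|z\|=\max\{|z_1|,|z_2|\}$ is the uniform norm on $\mathbb{R}^2$, and $\operatorname{dist}$ is measured in this norm. For an open set $\Omega\subset\mathbb{R}^2$, $L^m_p(\Omega)$ consists of all $f\in L_{1,loc}(\Omega)$ whose distributional partial derivatives of order $m$ belong to $L_p(\Omega)$, with seminorm $\|f\|_{L^m_p(\Omega)}=\sum_{|\beta|=m}\|D^\beta f\|_{L_p(\Omega)}$. For $\alpha\in[0,1]$ and a rectifiable curve $\gamma\subset\Omega$ put $\operatorname{len}_{\alpha,\Omega}(\gamma)=\int_\gamma\operatorname{dist}(u,\partial\Omega)^{\alpha-1}\,ds(u)$ ($ds$ is arc length), and $d_{\alpha,\Omega}(x,y)=\inf_\gamma\operatorname{len}_{\alpha,\Omega}(\gamma)$, the infimum being over all rectifiable curves $\gamma\subset\Omega$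 joining $x$ to $y$. *)

(* Defs.v *)
From HB Require Import structures.
From mathcomp Require Import all_boot all_order all_algebra.
From mathcomp Require Import all_classical all_reals all_analysis.

Set Implicit Arguments.
Unset Strict Implicit.
Unset Printing Implicit Defensive.

Import Order.TTheory GRing.Theory Num.Theory.
Import numFieldNormedType.Exports.

Local Open Scope classical_set_scope.
Local Open Scope ring_scope.

(* The plane is R * R: the norm of the product of normed modules is the
   uniform norm `|z| = max(|z.1|, |z.2|). *)

Section Plane.
Context {R : realType}.
Implicit Types (Omega A : set (R * R)) (f g phi : R * R -> R) (z u : R * R).

Definition domain Omega := open Omega /\ connected Omega.

Definition path_connected Omega :=
  forall x y, Omega x -> Omega y -> exists gamma : R -> R * R,
    [/\ {within `[0, 1], continuous gamma},
        forall t, t \in `[0, 1] -> Omega (gamma t),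
        gamma 0 = x & gamma 1 = y].

Definition null_homotopic Omega (gamma : R -> R * R) :=
  exists H : R * R -> R * R,
    [/\ {within `[0, 1] `*` `[0, 1], continuous H},
        forall s t, s \in `[0, 1] -> t \in `[0, 1] -> Omega (H (s, t)),
        forall t, t \in `[0, 1] -> H (0, t) = gamma t,
        forall t, t \in `[0, 1] -> H (1, t) = gamma 0 &
        forall s, s \in `[0, 1] -> H (s, 0) = gamma 0 /\ H (s, 1) = gamma 0].

Definition simply_connected Omega :=
  path_connected Omega /\
  forall gamma : R -> R * R,
    {within `[0, 1], continuous gamma} ->
    (forall t, t \in `[0, 1] -> Omega (gamma t)) ->
    gamma 0 = gamma 1 -> null_homotopic Omega gamma.

Definition boundary A : set (R * R) := closure A `\` interior A.

Definition dist z A : R := inf [set `|z - u| | u in A].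

(* A curve is a map gamma restricted to a parameter interval [a, b]. *)

Definition enorm z : R := Num.sqrt (z.1 ^+ 2 + z.2 ^+ 2).

Definition polygon_length (gamma : R -> R * R) (a b : R) (s : seq R) : R :=
  let F := gamma \o nth b (a :: s) in
  \sum_(0 <= i < size s) enorm (F i.+1 - F i).

Definition curve_length (gamma : R -> R * R) (a b : R) : \bar R :=
  ereal_sup [set (polygon_length gamma a b s)%:E | s in itv_partition a b].

Definition rectifiable (gamma : R -> R * R) (a b : R) :=
  {within `[a, b], continuous gamma} /\ (curve_length gamma a b < +oo)%E.

(* The point of the curve at arc length s from its origin; it does not depend
   on the chosen parameter, as gamma is constant between two parameters at the
   same arc length. *)
Definition arc_param (gamma : R -> R * R) (a b s : R) : R * R :=
  gamma (xget a [set t | t \in `[a, b] /\ curve_length gamma a t = s%:E]).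

Definition line_integral (gamma : R -> R * R) (a b : R) (w : R * R -> R)
    : \bar R :=
  (\int[lebesgue_measure]_(s in `[0%R, fine (curve_length gamma a b)])
     (w (arc_param gamma a b s))%:E)%E.

Definition len (alpha : R) Omega (gamma : R -> R * R) (a b : R) : \bar R :=
  line_integral gamma a b (fun u => dist u (boundary Omega) `^ (alpha - 1)).

Definition intrinsic_dist (alpha : R) Omega (x y : R * R) : \bar R :=
  ereal_inf [set l | exists gamma (a b : R),
    [/\ a <= b /\ rectifiable gamma a b,
        forall t, t \in `[a, b] -> Omega (gamma t),
        gamma a = x, gamma b = y & l = len alpha Omega gamma a b]].

Definition lebesgue2 :=
  ((@lebesgue_measure R) \x (@lebesgue_measure R))%E.

(* Measurability is Borel measurability; every Lebesgue measurable function is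
   almost everywhere equal to a Borel one. *)
Definition loc_integrable Omega f :=
  measurable_fun Omega f /\
  forall K : set (R * R), compact K -> K `<=` Omega ->
    (\int[lebesgue2]_(z in K) `|f z|%:E < +oo)%E.

Definition pd1 phi : R * R -> R := fun z => 'D_(1, 0) phi z.
Definition pd2 phi : R * R -> R := fun z => 'D_(0, 1) phi z.

Definition pd (i j : nat) phi : R * R -> R := iter i pd1 (iter j pd2 phi).

(* A word of booleans encodes a mixed partial derivative in any order. *)
Definition smooth phi :=
  forall (w : seq bool) z,
    differentiable (foldr (fun b h => if b then pd1 h else pd2 h) phi w) z.

Definition support phi : set (R * R) := closure [set z | phi z != 0].

Definition test_function Omega phi :=
  [/\ smooth phi, compact (support phi) & support phi `<=` Omega].

Definition is_distr_deriv Omega (i j : nat) f g :=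
  loc_integrable Omega g /\
  forall phi, test_function Omega phi ->
    (\int[lebesgue2]_(z in Omega) (f z * pd i j phi z)%:E =
     ((-1) ^+ (i + j))%:E * \int[lebesgue2]_(z in Omega) (g z * phi z)%:E)%E.

(* A representative of the distributional derivative D^(i, j) f, which is
   unique up to equality almost everywhere on Omega; 0 if there is none. *)
Definition distr_deriv Omega (i j : nat) f : R * R -> R :=
  xget (fun=> 0) [set g | is_distr_deriv Omega i j f g].

Definition Lp_norm Omega (p : R) g : \bar R :=
  'N[lebesgue2]_(p%:E)[EFin \o (g \_ Omega)]%E.

(* The multi-indices of order m are the pairs (i, m - i) with i <= m. *)
Definition sobolev Omega (m : nat) (p : R) f :=
  loc_integrable Omega f /\
  forall i, (i <= m)%N -> exists g,
    is_distr_deriv Omega i (m - i) f g /\ (Lp_norm Omega p g < +oo)%E.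

Definition sobolev_seminorm Omega (m : nat) (p : R) f : \bar R :=
  (\sum_(i < m.+1) Lp_norm Omega p (distr_deriv Omega i (m - i) f))%E.

End Plane.

(* Main.v *)
(** Let [delta = |x - y|], let [rho] be [delta] times a large multiple of
    [theta ^ (p / (p - 2))], let [U] be the part of [Omega] in the ball of radius [rho]
    around [x], and let [d z] be the distance from [z] to the complement of [U].

    As [Omega] is simply connected, a winding number argument gives a chain of points
    [z_i] of [U] from [x] to [y] such that removing the cube of radius [3 d (z_i)] around
    [z_i] from [U] separates [x] from [y], consecutive points are [d / 4]-close and
    non-consecutive ones are not. The polygon through the chain shows that the intrinsic
    distance is at most the sum of the [d (z_i) ^ alpha].

    Given such separating cubes, of radii [r_i], let [E_i] be the component of [y] in [U]
    minus the i-th cube, and sum the functions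
    [c_i (w.1 - z_i.1) ^ (m - 1) (1 - chi_i w) 1_(E_i) w], cut off at distance [rho] from
    [x], where [chi_i] is a cut-off function of the cube. The sum [f] vanishes near [x], is
    a polynomial with derivative [(m - 1)! sum c_i] near [y], and its derivatives of order
    [m] are bounded by [c_i / r_i] on the dilated cubes and by [sum c_i / rho] around [x].
    If [F] extends [f], the local means of the derivative of order [m - 1] of [F] at [x] and
    at [y], taken through mollifiers, differ by at most
    [C delta ^ (1 - 2 / p) ||F||] (telescope over dyadic scales), whence
    [sum c_i <= C theta delta ^ (1 - 2 / p) ||f||].

    With one cube this shows that [x] and [y] are joined in [U]. With [c_i = d (z_i) ^ alpha],
    the packing of the [z_i] bounds the overlap of the cubes and gives
    [sum d (z_i) ^ alpha <= C theta ^ (p / (p - 1)) delta ^ alpha] for the points whose cube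
    is far from [x] or from [y]; for the other points the sum is of geometric type. *)

Require Import Defs.
From mathcomp Require Import all_boot all_order all_algebra.
From mathcomp Require Import all_classical all_reals all_analysis.
From mathcomp Require Import measurable_realfun.
From mathcomp Require Import lra ring zify.

Set Implicit Arguments.
Unset Strict Implicit.
Unset Printing Implicit Defensive.

Import Order.TTheory GRing.Theory Num.Theory.
Import numFieldNormedType.Exports.

Local Open Scope classical_set_scope.
Local Open Scope ring_scope.

(** * Winding numbers on a grid *)

Section Turning.
Context {R : realType}.
Implicit Types (u v w x y z b : R * R) (T : R -> R * R).

(** The exponent alpha is the one for which c = d^alpha equals the energy c^p d^(2 - p) of a barrier
    on a cube of size d. With D = sum c_i the inequality thus reads D^p <= Q D up to constants, and
    one power of D cancels.

    The sum is cut off because separation is only known inside the ball. Working in the ball keeps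
    all radii below 2 rho, whatever the size of Omega; the price is a term D^p rho^(2 - p), and
    theta^(p / (p - 2)) is the factor in rho that lets this term be absorbed. As rho^alpha is a
    multiple of theta^(p / (p - 1)) delta^alpha, the large cubes cost no more than the others.

    The factor (w.1 - z_i.1)^(m - 1) is killed by all derivatives of order m, while its derivative
    of order m - 1 is the same for every i, so the barriers add up at y.

    The topological obstacle is to find a whole chain of single cubes each of which separates x from
    y. Winding numbers enter as integer counts of crossings of a half-axis along finite meshes,
    which reduces the argument to sums over the cells of a grid. *)

Lemma norm2_lt z e : (`|z| < e) = (`|z.1| < e) && (`|z.2| < e).
Proof. by rewrite prod_normE gt_max. Qed.

Lemma norm2_le z e : (`|z| <= e) = (`|z.1| <= e) && (`|z.2| <= e).
Proof. by rewrite prod_normE ge_max. Qed.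

Definition upper v : int := if 0 <= v.2 then 1 else 0.

(* The signed number of crossings of the left half-axis by a short step from v
   to w; turn is an integral cocycle generating the first cohomology of the
   punctured plane. *)
Definition turn v w : int := if v.1 < 0 then upper w - upper v else 0.

(** Local primitive of [turn] around [b]. On the cube of radius |b| / 2 the larger coordinate of [b]
    keeps its sign: if it is the first one, the test [v.1 < 0] is constant; if it is the second one,
    [upper] is constant and no crossing occurs. *)
Definition turn_pot b v : int :=
  if (b.1 < 0) && (`|b.2| <= `|b.1|) then upper v else 0.

Lemma same_sign (a b : R) : `|a - b| < `|b| / 2 -> (a < 0) = (b < 0).
Proof.
have [b0|b0] := ltrP b 0.
  by rewrite (ltr0_norm b0) ltr_norml => /andP[? ?]; apply/idP; lra.
rewrite (ger0_norm b0) ltr_norml => /andP[? ?]; apply/negbTE.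
by rewrite -leNgt; lra.
Qed.

Lemma turn_potE b v w : `|v - b| < `|b| / 2 -> `|w - b| < `|b| / 2 ->
  turn v w = turn_pot b w - turn_pot b v.
Proof.
rewrite !prod_normE /= !gt_max /turn /turn_pot /upper.
have [b21|b21] := leP `|b.2| `|b.1|.
  move=> /andP[/= v1 v2] /andP[/= w1 w2]; rewrite andbT.
  by rewrite (same_sign v1); case: ifP => // _; rewrite subrr.
move=> /andP[/= v1 v2] /andP[/= w1 w2]; rewrite andbF subrr.
by rewrite !leNgt (same_sign v2) (same_sign w2) subrr if_same.
Qed.

(* Both factors of the discrete Green formula run along the boundary of a grid
   of n by m cells. *)
Lemma grid_green (ch cv : nat -> nat -> int) n m :
  \sum_(i < n) \sum_(j < m)
     (ch i j + cv i j.+1 - cv i j - ch i.+1 j) =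
  \sum_(j < m) ch 0 j + \sum_(i < n) cv i m
    - \sum_(i < n) cv i 0 - \sum_(j < m) ch n j.
Proof.
elim: n => [|n IHn]; first by rewrite !big_ord0; lra.
rewrite !big_ord_recr /= {}IHn.
have -> : \sum_(j < m) (ch n j + cv n j.+1 - cv n j - ch n.+1 j) =
   \sum_(j < m) ch n j - \sum_(j < m) ch n.+1 j + (cv n m - cv n 0%N).
  elim: m => [|m IHm]; first by rewrite !big_ord0 !subrr.
  by rewrite !big_ord_recr /= {}IHm; ring.
ring.
Qed.

Lemma subBB y v b : (y - v) - (y - b) = b - v.
Proof. by rewrite opprB addrC addrA subrK. Qed.

(** When a centre moves from [v] to [w] by a short step, this is the change of the winding number
    around it of a path from [x] to [y] that avoids the step; see [winds_shift] and
    [winds_short]. *)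
Definition turn_diff x y v w : int := turn (y - v) (y - w) - turn (x - v) (x - w).

Definition turn_diff_pot x y b v : int :=
  turn_pot (y - b) (y - v) - turn_pot (x - b) (x - v).

Lemma turn_diffE x y b v w (e : R) : `|v - b| < e -> `|w - b| < e ->
  e <= `|x - b| / 2 -> e <= `|y - b| / 2 ->
  turn_diff x y v w = turn_diff_pot x y b w - turn_diff_pot x y b v.
Proof.
move=> vb wb ex ey.
rewrite /turn_diff /turn_diff_pot (@turn_potE (y - b)) ?(@turn_potE (x - b));
  first (by ring); rewrite subBB distrC.
- exact: lt_le_trans vb ex.
- exact: lt_le_trans wb ex.
- exact: lt_le_trans vb ey.
- exact: lt_le_trans wb ey.
Qed.

(** The points [e i j] fill a box around the origin. Edges in direction i keep the second
    coordinate, hence [upper]; of the two other sides only i = n has a negative first coordinate,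
    and there [upper] drops once from 1 to 0. *)
Lemma box_corner_turn x (h : R) N : 0 < h -> (0 < N)%N ->
  let e i j := - (h * (i%:R - N%:R), h * (j%:R - N%:R)) : R * R in
  let ch i j := turn (e i j) (e i j.+1) in
  let cv i j := turn (e i j) (e i.+1 j) in
  let n := N.*2 in
  \sum_(j < n) ch 0 j + \sum_(i < n) cv i n
    - \sum_(i < n) cv i 0 - \sum_(j < n) ch n j = 1.
Proof.
move=> h0 N0 e ch cv n.
have N0R : 0 < N%:R :> R by rewrite ltr0n.
have nE : n%:R = 2 * N%:R :> R by rewrite /n -mul2n natrM.
have -> : \sum_(j < n) ch 0 j = 0.
  apply: big1 => j _; rewrite /ch /turn /= ifF //.
  by apply/negbTE; rewrite -leNgt oppr_ge0; nra.
have cv0 l : \sum_(i < n) cv i l = 0.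
  by apply: big1 => i _; rewrite /cv /turn /upper /= subrr if_same.
rewrite !cv0 addr0 subr0 sub0r.
have -> : \sum_(j < n) ch n j = \sum_(j < n) (upper (e n j.+1) - upper (e n j)).
  apply: eq_bigr => j _; rewrite /ch /turn ifT //= nE.
  by rewrite oppr_lt0; nra.
rewrite -(big_mkord predT (fun j => upper (e n j.+1) - upper (e n j))).
rewrite telescope_sumr // /upper /= nE.
rewrite ifF; last by apply/negbTE; rewrite -ltNge; nra.
rewrite ifT; first by [].
by nra.
Qed.

(* A set P containing x but not y, whose frontier carries an integral primitive
   of turn_diff x y, would allow this cochain to be made trivial outside P, while
   it winds once around x. *)
Lemma no_frontier_primitive (P K : set (R * R)) (f : R * R -> int) x y
    (r h0 e : R) : 0 < h0 -> 0 < e ->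
  (forall z, P z -> `|z - x| < r) ->
  (forall z, `|z - x| < e -> P z) ->
  (forall z, `|z - y| < e -> ~ P z) ->
  (forall v w, K v -> K w -> `|v - w| < h0 -> f w - f v = turn_diff x y v w) ->
  (forall v w, P v -> ~ P w -> `|w - v| <= h0 ->
    exists2 z, K z & `|z - v| <= `|w - v|) -> False.
Proof.
move=> h0_gt0 e_gt0 Pr Px Py Kf cross.
have r_gt0 : 0 < r.
  by apply: le_lt_trans (Pr x _) => //; apply: Px; rewrite subrr normr0.
(* Everything attached to a cell will lie within 3 h of its corner, so two such points are less than
   h0 apart, and a cell with corners both in and off P is at least 14 h away from x and y. *)
pose h : R := Num.min h0 e / 16.
have h_gt0 : 0 < h by rewrite divr_gt0 // lt_min h0_gt0.
have hh0 : h * 16 <= h0 by rewrite /h divfK ?pnatr_eq0 // ge_min lexx.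
have he : h * 16 <= e by rewrite /h divfK ?pnatr_eq0 // ge_min lexx orbT.
have [N N0 rN] : exists2 N, (0 < N)%N & r < h * N%:R.
  exists (Num.bound (r / h)).+1 => //.
  have := archi_boundP (divr_ge0 (ltW r_gt0) (ltW h_gt0)).
  rewrite ltr_pdivrMr // mulrC => /lt_trans -> //.
  by rewrite ltr_pM2l // ltr_nat.
pose g i j : R * R := x + (h * (i%:R - N%:R), h * (j%:R - N%:R)).
have nz_ex v w : exists z, P v -> ~ P w -> `|w - v| <= h0 ->
    K z /\ `|z - v| <= `|w - v|.
  have [Pv|?] := pselect (P v); last by exists 0.
  have [?|Pw] := pselect (P w); first by exists 0.
  have [vw|?] := pselect (`|w - v| <= h0); last by exists 0.
  by have [z ? ?] := cross _ _ Pv Pw vw; exists z.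
pose nz v w := projT1 (cid (nz_ex v w)).
have nzP v w : P v -> ~ P w -> `|w - v| <= h0 ->
    K (nz v w) /\ `|nz v w - v| <= `|w - v|.
  by rewrite /nz; case: cid.
(* The cochain [turn_diff x y], made trivial off P by subtracting its primitive [f], which an edge
   across the frontier reads at the nearby frontier point [nz]. *)
pose c v w : int :=
  if `[< P v >] then
    if `[< P w >] then turn_diff x y v w
    else turn_diff x y v (nz v w) - f (nz v w)
  else if `[< P w >] then - (turn_diff x y w (nz w v) - f (nz w v)) else 0.
pose n := N.*2.
pose ch i j := c (g i j) (g i j.+1).
pose cv i j := c (g i j) (g i.+1 j).
pose ch' i j := turn (x - g i j) (x - g i j.+1).
pose cv' i j := turn (x - g i j) (x - g i.+1 j).
have green := grid_green ch cv n n.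
have green' := grid_green ch' cv' n n.
have xg i j : x - g i j = - (h * (i%:R - N%:R), h * (j%:R - N%:R)).
  by rewrite /g opprD addNKr.
have /= corner := box_corner_turn x h_gt0 N0.
have cE : \sum_(i < n) \sum_(j < n) (ch' i j + cv' i j.+1 - cv' i j - ch' i.+1 j) = 1.
  rewrite green'; rewrite -[RHS]corner.
  by congr (_ + _ - _ - _); apply: eq_bigr => i _; rewrite /ch' /cv' !xg.
have nE : n%:R = 2 * N%:R :> R by rewrite /n -mul2n natrM.
have NP (i j : nat) : (i == 0%N) || (i == n) || (j == 0%N) || (j == n) -> ~ P (g i j).
  move=> ij /Pr; rewrite distrC xg normrN norm2_lt /= !ltr_norml => /andP[].
  by case/orP: ij => [/orP[/orP[]|]|] /eqP ->; rewrite ?nE => /andP[? ?] /andP[? ?]; nra.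
have c0 v w : ~ P v -> ~ P w -> c v w = 0.
  by move=> Pv Pw; rewrite /c; case: asboolP => //; case: asboolP.
have cS : \sum_(i < n) \sum_(j < n) (ch i j + cv i j.+1 - cv i j - ch i.+1 j) = 0.
  rewrite green !big1 ?subrr ?addr0 // => i _; apply: c0; apply: NP;
  by rewrite ?eqxx ?orbT.
(* Cell by cell, the coboundary of [c] is minus that of the turns around x. But the coboundaries of
   [c] sum to 0, as the boundary of the grid is off P, and those of the turns sum to 1. *)
suff : \sum_(i < n) \sum_(j < n) (ch i j + cv i j.+1 - cv i j - ch i.+1 j) =
   - \sum_(i < n) \sum_(j < n) (ch' i j + cv' i j.+1 - cv' i j - ch' i.+1 j).
  by rewrite cS cE.
rewrite -sumrN; apply: eq_bigr => i _; rewrite -sumrN; apply: eq_bigr => j _.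
pose b := g i j.
have near_b k l : (k <= i.+1)%N -> (i <= k)%N -> (l <= j.+1)%N -> (j <= l)%N ->
    `|g k l - b| <= h.
  move=> k1 k2 l1 l2; rewrite /b /g norm2_le /=.
  have -> : x.1 + h * (k%:R - N%:R) - (x.1 + h * (i%:R - N%:R)) = h * (k - i)%:R.
    by rewrite natrB //; ring.
  have -> : x.2 + h * (l%:R - N%:R) - (x.2 + h * (j%:R - N%:R)) = h * (l - j)%:R.
    by rewrite natrB //; ring.
  have key q : (q <= 1)%N -> `|h * q%:R| <= h.
    case: q => [|[|//]] _; first by rewrite mulr0 normr0 ltW.
    by rewrite mulr1 gtr0_norm.
  by rewrite !key // leq_subLR addn1.
have b00 : `|g i j - b| <= h by apply: near_b.
have b10 : `|g i.+1 j - b| <= h by apply: near_b.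
have b01 : `|g i j.+1 - b| <= h by apply: near_b.
have b11 : `|g i.+1 j.+1 - b| <= h by apply: near_b.
rewrite /ch /cv /ch' /cv'.
clear near_b NP cS cE corner xg green green' ch cv ch' cv'; clearbody b.
move: (g i j) (g i.+1 j) (g i j.+1) (g i.+1 j.+1) b00 b10 b01 b11.
move=> g1 g2 g3 g4 b1 b2 b3 b4.
have tri (u v w : R * R) (d1 d2 : R) : `|u - v| <= d1 -> `|w - v| <= d2 -> `|u - w| <= d1 + d2.
  move=> uv wv; rewrite -(subrKA v); apply: le_trans (ler_normD _ _) _.
  by rewrite lerD // distrC.
have tl (u v w : R * R) (d1 d2 : R) : `|u - v| <= d1 -> `|w - v| >= d2 -> `|w - u| >= d2 - d1.
  move=> uv wv; rewrite lerBlDr; apply: le_trans wv _; rewrite -(subrKA u).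
  by apply: le_trans (ler_normD _ _) _; rewrite lerD.
have Zc z v w : h * 4 <= `|z - b| -> `|v - b| <= h -> `|w - b| <= h ->
    turn (z - v) (z - w) = turn_pot (z - b) (z - w) - turn_pot (z - b) (z - v).
  move=> zb vb wb; rewrite (@turn_potE (z - b)) // subBB distrC;
  by [apply: le_lt_trans vb _; clear -h_gt0 zb; lra
     |apply: le_lt_trans wb _; clear -h_gt0 zb; lra].
(* Three kinds of cells. Off P, x is far and its turns are closed; inside P, y is far and only the
   turns around x are left in [c]; at the frontier both points are far and [c] has the primitive
   [pot]. *)
have [allN|someP] := pselect (~ [\/ P g1, P g2, P g3 | P g4]).
  have [N1 N2 N3 N4] : [/\ ~ P g1, ~ P g2, ~ P g3 & ~ P g4].
    split=> ?; apply: allN;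
    by [constructor 1|constructor 2|constructor 3|constructor 4].
  rewrite !c0 //.
  have xb : h * 4 <= `|x - b|.
    rewrite leNgt; apply/negP => xb; apply: N1; apply: Px.
    rewrite -(subrKA b); apply: le_lt_trans (ler_normD _ _) _.
    by rewrite [`|b - x|]distrC; lra.
  by rewrite !(Zc x) //; ring.
have {someP} yb : h * 14 <= `|y - b|.
  rewrite leNgt; apply/negP => yb; apply: someP => someP.
  suff : ~ [\/ P g1, P g2, P g3 | P g4] by [].
  have Q v : `|v - b| <= h -> ~ P v.
    move=> vb; apply: Py; rewrite -(subrKA b); apply: le_lt_trans (ler_normD _ _) _.
    by rewrite [`|b - y|]distrC; lra.
  by case; apply: Q.
have yb4 : h * 4 <= `|y - b| by clear -yb h_gt0; lra.
have [[P1 P2 P3 P4]|someN] := pselect [/\ P g1, P g2, P g3 & P g4].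
  by rewrite /c !asboolT // /turn_diff !(Zc y) //; ring.
have xb : h * 14 <= `|x - b|.
  rewrite leNgt; apply/negP => xb; apply: someN.
  have Q v : `|v - b| <= h -> P v.
    move=> vb; apply: Px; rewrite -(subrKA b); apply: le_lt_trans (ler_normD _ _) _.
    by rewrite [`|b - x|]distrC; lra.
  by split; apply: Q.
have dE v w : `|v - b| <= h * 3 -> `|w - b| <= h * 3 ->
    turn_diff x y v w = turn_diff_pot x y b w - turn_diff_pot x y b v.
  by move=> vb wb; apply: (@turn_diffE _ _ _ _ _ (h * 4)); clear -xb yb vb wb h_gt0; lra.
have xb4 : h * 4 <= `|x - b| by clear -xb h_gt0; lra.
rewrite !(Zc x) //.
(* Between frontier points near the cell, [f] and [turn_diff_pot x y b] have the same increments, so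
   they differ by one constant; its opposite is the value off P that continues the potential across
   the frontier. *)
have [k kE] : exists k, forall z, K z -> `|z - b| <= h * 3 ->
    f z - turn_diff_pot x y b z = k.
  have [[z0 [Kz0 z0b]]|no] := pselect (exists z, K z /\ `|z - b| <= h * 3).
    exists (f z0 - turn_diff_pot x y b z0) => z Kz zb.
    have := Kf _ _ Kz0 Kz; rewrite dE // => /(_ _) E.
    have {E} : f z - f z0 = turn_diff_pot x y b z - turn_diff_pot x y b z0.
      apply: E; apply: le_lt_trans (tri _ _ _ _ _ z0b zb) _.
      by clear -hh0 h_gt0; lra.
    by clear; lia.
  by exists 0 => z Kz zb; exfalso; apply: no; exists z.
pose pot v := if `[< P v >] then turn_diff_pot x y b v else - k.
have potE v w : `|v - b| <= h -> `|w - b| <= h -> c v w = pot w - pot v.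
  have key v1 w1 : `|v1 - b| <= h -> `|w1 - b| <= h -> P v1 -> ~ P w1 ->
      turn_diff x y v1 (nz v1 w1) - f (nz v1 w1) = - k - turn_diff_pot x y b v1.
    move=> vb wb Pv Pw; have wv := tri _ _ _ _ _ wb vb.
    have wv0 : `|w1 - v1| <= h0 by apply: le_trans wv _; clear -hh0 h_gt0; lra.
    have [Kz zb] := nzP _ _ Pv Pw wv0.
    have zb' : `|nz v1 w1 - b| <= h * 3.
      rewrite -(subrKA v1); apply: le_trans (ler_normD _ _) _.
      by clear -zb wv vb; lra.
    rewrite dE //; last lra.
    by rewrite -(kE _ Kz zb'); ring.
  move=> vb wb; rewrite /c /pot.
  case: asboolP => Pv; case: asboolP => Pw.
  - by rewrite dE //; lra.
  - exact: key.
  - by rewrite key //; ring.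
  - by rewrite subrr.
rewrite !potE //; ring.
Qed.

End Turning.

(** * Winding numbers of paths and their behaviour under homotopy *)

Section Winding.
Context {R : realType}.
Implicit Types (x y z : R * R) (T : R -> R * R).

Lemma compact_unif_continuous (V W : normedModType R) (K : set V) (f : V -> W)
    (e : R) : compact K -> continuous f -> 0 < e ->
  exists2 d : R, 0 < d &
    forall v w, K v -> `|v - w| < d -> `|f v - f w| < e.
Proof.
move=> /compact_near_coveringP K_cov f_cont e0.
have := @K_cov R (0^'+) (fun d v => forall w, `|v - w| < d -> `|f v - f w| < e)
  _ _.
case.
  move=> v Kv; have e20 : 0 < e / 2 by rewrite divr_gt0.
  have /cvgrPdist_lt /(_ _ e20) /nbhs_ballP[d /= d0 fd] := f_cont v.
  exists (ball v (d / 2), [set t | 0 < t < d / 2]) => /=.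
    split; first by apply: nbhsx_ballx; rewrite divr_gt0.
    by near=> t; apply/andP; split; near: t;
      [exact: nbhs_right_gt|apply: nbhs_right_lt; rewrite divr_gt0].
  case=> v' t [/= vv' /andP[_ td]] w v'w.
  rewrite -(subrKA (f v)); apply: le_lt_trans (ler_normD _ _) _.
  rewrite [e]splitr ltrD //.
    rewrite distrC; apply: fd; rewrite -ball_normE /ball_ /=.
    by move: vv'; rewrite -ball_normE /ball_ /= => /lt_trans -> //; rewrite ltr_pdivrMr // ltr_pMr // ltr1n.
  apply: fd; rewrite -ball_normE /ball_ /= -(subrKA v').
  apply: le_lt_trans (ler_normD _ _) _; rewrite [d]splitr ltrD //.
    by move: vv'; rewrite -ball_normE.
  exact: lt_trans v'w td.
move=> d /= d0 H.
exists (d / 2); first by rewrite divr_gt0.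
move=> v w Kv vw; apply: (H (d / 2)) => //=; last by rewrite divr_gt0.
by rewrite sub0r normrN gtr0_norm ?divr_gt0 // ltr_pdivrMr // ltr_pMr // ltr1n.
Unshelve. all: by end_near. Qed.

Lemma compact_square : compact (`[0, 1]%classic `*` `[0, 1]%classic : set (R * R)).
Proof. by apply: compact_setX; exact: segment_compact. Qed.

(** Within one step of the mesh the path moves by less than half its distance from the origin, which
    is what [turn_potE] requires. *)
Definition fine_mesh n T := (0 < n)%N /\ forall s t : R,
  0 <= s <= 1 -> 0 <= t <= 1 -> `|s - t| <= n%:R^-1 -> `|T s - T t| < `|T t| / 2.

Definition wsum n T : int :=
  \sum_(k < n) turn (T (k%:R / n%:R)) (T (k.+1%:R / n%:R)).

Lemma frac01 (k n : nat) : (k <= n)%N -> (0 < n)%N -> 0 <= (k%:R / n%:R : R) <= 1.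
Proof.
move=> kn n0; rewrite divr_ge0 ?ler0n //= ler_pdivrMr ?ltr0n // mul1r.
by rewrite ler_nat.
Qed.

Lemma big_ord_mul (F : nat -> int) n k :
  \sum_(i < n * k) F i = \sum_(a < n) \sum_(b < k) F (a * k + b)%N.
Proof.
elim: n => [|n IHn]; first by rewrite mul0n !big_ord0.
rewrite big_ord_recr /= -IHn -!(big_mkord predT F) mulSnr.
rewrite (@big_cat_nat _ _ _ (n * k)) //= ?leq_addr //; congr (_ + _).
rewrite -{1}[(n * k)%N]add0n big_addn addKn big_mkord.
by apply: eq_bigr => i _; rewrite addnC.
Qed.

(** Inside one step of the coarse mesh [turn] has the primitive attached to the initial point, so
    the refined sum telescopes to the coarse one. *)
Lemma wsum_refine n k T : fine_mesh n T -> (0 < k)%N -> wsum (n * k) T = wsum n T.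
Proof.
move=> [n0 H] k0; rewrite /wsum.
rewrite (big_ord_mul (fun i => turn (T (i%:R / (n * k)%:R)) (T (i.+1%:R / (n * k)%:R)))).
apply: eq_bigr => a _.
have nR : n%:R != 0 :> R by rewrite pnatr_eq0 -lt0n.
have kR : k%:R != 0 :> R by rewrite pnatr_eq0 -lt0n.
pose p (b : nat) : R * R := T ((a * k + b)%:R / (n * k)%:R).
have p0 : p 0%N = T (a%:R / n%:R).
  by rewrite /p addn0 !natrM; congr T; field; rewrite nR.
have pk : p k = T (a.+1%:R / n%:R).
  by rewrite /p -mulSnr !natrM; congr T; field; rewrite nR.
have near_p (b : nat) : (b <= k)%N -> `|p b - p 0%N| < `|p 0%N| / 2.
  move=> bk; rewrite p0; apply: H; last first.
  - rewrite natrD !natrM.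
    rewrite (_ : _ - _ = b%:R / k%:R * n%:R^-1); last by field; rewrite nR.
    rewrite ger0_norm ?mulr_ge0 ?invr_ge0 ?ler0n // ler_piMl ?invr_ge0 ?ler0n //.
    by case/andP: (frac01 bk k0).
  - by apply: frac01 => //; rewrite ltnW.
  - apply: frac01; last by rewrite muln_gt0 n0.
    apply: (@leq_trans (a.+1 * k)); first by rewrite mulSnr leq_add2l.
    by rewrite leq_mul2r ltn_ord orbT.
transitivity (\sum_(b < k) (turn_pot (p 0%N) (p b.+1) - turn_pot (p 0%N) (p b))).
  apply: eq_bigr => b _; rewrite -turn_potE; first by rewrite /p addnS.
    by apply: near_p; rewrite ltnW.
  exact: near_p.
rewrite -(big_mkord predT (fun b => turn_pot (p 0%N) (p b.+1) - turn_pot (p 0%N) (p b))).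
rewrite telescope_sumr // -turn_potE ?near_p //; first by rewrite pk p0.
Qed.

(** The value is independent of the mesh by common refinement. For a path that is not closed it
    counts the signed crossings of the left half-axis; under homotopy it is the balance of
    [homotopy_winds] that persists. *)
Definition winds T (v : int) := exists2 n, fine_mesh n T & wsum n T = v.

Lemma winds_uniq T v v' : winds T v -> winds T v' -> v = v'.
Proof.
move=> [n fn <-] [n' fn' <-].
by rewrite -(wsum_refine fn (proj1 fn')) mulnC (wsum_refine fn' (proj1 fn)).
Qed.

Lemma eq_winds T T' v : (forall t, 0 <= t <= 1 -> T t = T' t) ->
  winds T v -> winds T' v.
Proof.
move=> TT' [n [n0 fn] wn]; exists n.
  by split=> // s t s01 t01 st; rewrite -!TT' //; exact: fn.
rewrite -wn; apply: eq_bigr => i _.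
by rewrite !TT' //; apply: frac01 => //; rewrite ltnW.
Qed.

(** [grid_green] on a grid so fine that [H] varies by less than half its norm on each cell: every
    cell term vanishes by [turn_potE], so the four sides balance. The positive minimum of |H| on the
    square provides such a grid. *)
Lemma homotopy_winds (H : R * R -> R * R) : continuous H ->
  (forall s t : R, 0 <= s <= 1 -> 0 <= t <= 1 -> H (s, t) != 0) ->
  exists a b c d : int, [/\ winds (fun t => H (0, t)) a, winds (fun s => H (s, 1)) b,
    winds (fun s => H (s, 0)) c, winds (fun t => H (1, t)) d & a + b = c + d].
Proof.
move=> Hc H0.
have [m m0 Hm] : exists2 m : R, 0 < m & forall s t : R, 0 <= s <= 1 -> 0 <= t <= 1 ->
    m <= `|H (s, t)|.
  have [|||p /set_mem[/= p1 p2] pmin] := @compact_EVT_min _ _ (fun p => `|H p|)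
    (`[0, 1]%classic `*` `[0, 1]%classic).
  - by exists (0, 0); split; rewrite /= in_itv /= lexx ler01.
  - exact: compact_square.
  - by apply: continuous_subspaceT => p; apply: continuous_comp; [exact: Hc|exact: norm_continuous].
  exists `|H p|.
    rewrite normr_gt0; case: p p1 p2 {pmin} => s t /=; rewrite !in_itv /=.
    exact: H0.
  by move=> s t s01 t01; apply: pmin; apply/mem_set; split; rewrite /= in_itv.
have m20 : 0 < m / 2 by rewrite divr_gt0.
have [d d0 Hd] := compact_unif_continuous compact_square Hc m20.
have [n n0 nd] : exists2 n, (0 < n)%N & n%:R^-1 < d.
  exists (Num.bound d^-1).+1 => //.
  rewrite invf_plt ?posrE ?ltr0n //.
  have := archi_boundP (ltW (_ : 0 < d^-1)); rewrite invr_gt0 => /(_ d0) /lt_trans -> //.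
  by rewrite ltr_nat.
have small (s t s' t' : R) : 0 <= s <= 1 -> 0 <= t <= 1 -> 0 <= s' <= 1 -> 0 <= t' <= 1 ->
    `|s - s'| <= n%:R^-1 -> `|t - t'| <= n%:R^-1 ->
    `|H (s, t) - H (s', t')| < `|H (s', t')| / 2.
  move=> s01 t01 s01' t01' ss' tt'.
  apply: (@lt_le_trans _ _ (m / 2)); last by rewrite ler_pM2r ?Hm // invr_gt0.
  apply: Hd; first by split; rewrite /= in_itv.
  by rewrite norm2_lt /= !(le_lt_trans _ nd).
have n0R : 0 <= (n%:R^-1 : R) by rewrite invr_ge0 ler0n.
have z01 : 0 <= (0 : R) <= 1 by rewrite lexx ler01.
have o01 : 0 <= (1 : R) <= 1 by rewrite lexx ler01.
exists (wsum n (fun t => H (0, t))), (wsum n (fun s => H (s, 1))),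
  (wsum n (fun s => H (s, 0))), (wsum n (fun t => H (1, t))).
split; try by exists n => //; split=> // s t s01 t01 st; apply: small; rewrite // subrr normr0.
pose h i j := H (i%:R / n%:R, j%:R / n%:R).
have := grid_green (fun i j => turn (h i j) (h i j.+1)) (fun i j => turn (h i j) (h i.+1 j)) n n.
rewrite big1 => [|i _].
  have e0 : 0%:R / n%:R = 0 :> R by rewrite mul0r.
  have e1 : n%:R / n%:R = 1 :> R by rewrite divff // pnatr_eq0 -lt0n.
  rewrite /h e0 e1 => /esym/eqP; rewrite -addrA -opprD subr_eq0 => /eqP.
  by [].
rewrite big1 // => j _.
have near_h k l : (k <= i.+1)%N -> (i <= k)%N -> (l <= j.+1)%N -> (j <= l)%N ->
    `|h k l - h i j| < `|h i j| / 2.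
  move=> k1 k2 l1 l2.
  have step (a b : nat) : (a <= b.+1)%N -> (b <= a)%N -> `|a%:R / n%:R - b%:R / n%:R| <= n%:R^-1 :> R.
    move=> ab ba; rewrite -mulrBl -natrB // normrM [X in _ * X]ger0_norm // ler_piMl //.
    by rewrite ger0_norm ?ler0n // lern1 leq_subLR addn1.
  apply: small; rewrite ?step //; apply: frac01 => //.
  - exact: leq_trans k1 _.
  - exact: leq_trans l1 _.
  - exact: ltnW.
  - exact: ltnW.
by rewrite !(@turn_potE _ (h i j)) ?near_h //; ring.
Qed.

End Winding.

(** * Chains of separating cubes *)

Section Paths.
Context {R : realType}.
Implicit Types (x y z : R * R) (T : R -> R * R) (U V : set (R * R)).

Lemma dist_ge0 z (A : set (R * R)) : 0 <= dist z A.
Proof.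
have [[u Au]|A0] := pselect (A !=set0).
  by apply: lb_le_inf => [|_ [v _ <-]]; [exists `|z - u|, u|].
rewrite /dist (_ : A = set0) ?image_set0 ?inf0 //.
by apply/seteqP; split => // u Au; apply: A0; exists u.
Qed.

Lemma dist_le z (A : set (R * R)) u : A u -> dist z A <= `|z - u|.
Proof.
move=> Au; apply: ge_inf; last by exists u.
by exists 0 => _ [v _ <-].
Qed.

Lemma dist_ex z (A : set (R * R)) (e : R) : A !=set0 -> 0 < e ->
  exists2 u, A u & `|z - u| < dist z A + e.
Proof.
move=> [u0 Au0] e0.
have [] := @inf_adherent R [set `|z - u| | u in A] e e0.
  by split; [exists `|z - u0|, u0|exists 0 => _ [v _ <-]].
by move=> _ [u Au <-] ?; exists u.
Qed.

Lemma dist_lip z w (A : set (R * R)) : A !=set0 ->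
  dist z A <= dist w A + `|z - w|.
Proof.
move=> A0; apply/ler_addgt0Pr => e e0.
have [u Au ue] := dist_ex w A0 e0.
apply: le_trans (dist_le z Au) _; rewrite -(subrKA w).
by apply: le_trans (ler_normD _ _) _; lra.
Qed.

Lemma dist0 z (A : set (R * R)) : A z -> dist z A = 0.
Proof.
move=> /(dist_le z); rewrite subrr normr0 => d0.
by apply/eqP; rewrite eq_le d0 dist_ge0.
Qed.

Lemma open_dist_gt0 z U : open U -> ~` U !=set0 -> U z -> 0 < dist z (~` U).
Proof.
move=> oU U0 Uz; have /nbhs_ballP[e /= e0 eU] : nbhs z U by apply: open_nbhs_nbhs.
apply: lt_le_trans e0 _; apply: lb_le_inf.
  by case: U0 => u ?; exists `|z - u|, u.
move=> _ [u nUu <-]; rewrite leNgt; apply/negP => zu.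
by apply: nUu; apply: eU; rewrite -ball_normE.
Qed.

Lemma dist_ball z w U : `|z - w| < dist z (~` U) -> U w.
Proof.
by move=> zw; apply: contrapT => nUw; move: zw; rewrite ltNge (@dist_le z (~` U)).
Qed.

Lemma dist_near2 z U : open U -> ~` U !=set0 ->
  exists2 b, ~ U b & `|z - b| <= 2 * dist z (~` U).
Proof.
move=> oU U0; have [Uz|Uz] := pselect (U z); last first.
  by exists z => //; rewrite subrr normr0 mulr_ge0 // dist_ge0.
have d0 := open_dist_gt0 oU U0 Uz.
by have [b ? ?] := dist_ex z U0 d0; exists b => //; lra.
Qed.

(** Paths are maps on the whole line, constant off the unit interval: affine changes of parameter
    then reverse and join them without any subspace topology. *)
Definition path_in V x y T := [/\ continuous T, forall t, V (T t),
  forall t : R, t <= 0 -> T t = x & forall t : R, 1 <= t -> T t = y].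

Definition joined V x y := exists T, path_in V x y T.

Lemma path_in0 V x y T : path_in V x y T -> T 0 = x.
Proof. by case=> _ _ T0 _; apply: T0. Qed.

Lemma path_in1 V x y T : path_in V x y T -> T 1 = y.
Proof. by case=> _ _ _; apply. Qed.

Lemma path_inS U V x y T : U `<=` V -> path_in U x y T -> path_in V x y T.
Proof. by move=> UV [? UT ? ?]; split=> // t; apply: UV. Qed.

Lemma joinedS U V x y : U `<=` V -> joined U x y -> joined V x y.
Proof. by move=> UV [T HT]; exists T; apply: path_inS HT. Qed.

Lemma joined_sym V x y : joined V x y -> joined V y x.
Proof.
move=> [T [Tc VT T0 T1]]; exists (fun t => T (1 - t)); split=> [t|//|t t0|t t1].
- apply: (@continuous_comp R R (R * R)%type (fun t => 1 - t) T); last exact: Tc.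
  by apply: cvgB; [exact: cvg_cst|exact: cvg_id].
- by apply: T1; lra.
- by apply: T0; lra.
Qed.

Lemma joined_trans V x y z : joined V x y -> joined V y z -> joined V x z.
Proof.
move=> [T [Tc VT T0 T1]] [T' [Tc' VT' T0' T1']].
have lin (a b : R) : continuous (fun t : R => a * t + b).
  move=> t; apply: cvgD; last exact: cvg_cst.
  by apply: cvgM; [exact: cvg_cst|exact: cvg_id].
(* At every time one of the two paths rests at y, so their sum minus y is the concatenation. *)
exists (fun t => T (2 * t + 0) + T' (2 * t + (-1)) - y); split=> [t|t|t t0|t t1].
- apply: cvgB; last exact: cvg_cst.
  by apply: cvgD;
    [apply: (@continuous_comp R R _ (fun t => 2 * t + 0) T)
    |apply: (@continuous_comp R R _ (fun t => 2 * t + (-1)) T')];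
    by [exact: lin|exact: Tc|exact: Tc'].
- have [t1|t1] := lerP (2 * t) 1.
    by rewrite [T' _]T0' ?addrK //; lra.
  by rewrite [T _]T1 ?[y + _]addrC ?addrK //; lra.
- by rewrite [T' _]T0' ?addrK ?T0 //; lra.
- by rewrite [T _]T1 ?[y + _]addrC ?addrK ?T1' //; lra.
Qed.

Definition clamp (t : R) : R := Num.max 0 (Num.min t 1).

Lemma clamp01 t : 0 <= clamp t <= 1.
Proof. by rewrite /clamp le_max lexx /= ge_max ler01 ge_min lexx orbT. Qed.

Lemma clamp_id t : 0 <= t <= 1 -> clamp t = t.
Proof. by case/andP=> t0 t1; rewrite /clamp min_l // max_r. Qed.

Lemma clamp_le0 t : t <= 0 -> clamp t = 0.
Proof. by move=> t0; rewrite /clamp max_l // ge_min t0. Qed.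

Lemma clamp_ge1 t : 1 <= t -> clamp t = 1.
Proof. by move=> t1; rewrite /clamp min_r // max_r // ler01. Qed.

Lemma continuous_clamp : continuous clamp.
Proof.
move=> t; rewrite /clamp.
apply: (@continuous_max R R (fun=> 0) (fun t => Num.min t 1)); first exact: cvg_cst.
by apply: (@continuous_min R R id (fun=> 1)); [exact: cvg_id|exact: cvg_cst].
Qed.

Lemma joined_seg V x y : (forall t : R, 0 <= t <= 1 -> V (x + t *: (y - x))) ->
  joined V x y.
Proof.
move=> Vt; exists (fun t => x + clamp t *: (y - x)); split=> [t|t|t t0|t t1].
- by apply: cvgD; [exact: cvg_cst|apply: cvgZr_tmp; exact: continuous_clamp].
- by apply: Vt; exact: clamp01.
- by rewrite clamp_le0 // scale0r addr0.
- by rewrite clamp_ge1 // scale1r addrC subrK.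
Qed.

Lemma joined_refl V x : V x -> joined V x x.
Proof. by move=> Vx; apply: joined_seg => t _; rewrite subrr scaler0 addr0. Qed.

Lemma joined_ball V x (e : R) y : (forall w, `|x - w| < e -> V w) ->
  `|x - y| < e -> joined V x y.
Proof.
move=> Ve xy; apply: joined_seg => t /andP[t0 t1]; apply: Ve.
rewrite opprD addNKr normrN normrZ ger0_norm // distrC.
by apply: le_lt_trans xy; rewrite ler_piMl.
Qed.

Lemma path_in_gap V x y T z (r : R) : path_in V x y T ->
  (forall t, r < `|T t - z|) -> exists2 m, r < m & forall t, m <= `|T t - z|.
Proof.
move=> HT rT; case: (HT) => Tc _ T0 T1.
have [|t t01 tmin] := @EVT_min R (fun t => `|T t - z|) 0 1 ler01.
  apply: continuous_subspaceT => t; apply: cvg_norm.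
  by apply: cvgB; [exact: Tc|exact: cvg_cst].
exists `|T t - z| => // s.
have [s0|s0] := lerP s 0; first by rewrite (T0 s) // -(T0 0) // tmin // in_itv /= lexx ler01.
have [s1|s1] := lerP 1 s; first by rewrite (T1 s) // -(T1 1) // tmin // in_itv /= lexx ler01.
by rewrite tmin // in_itv /= !ltW.
Qed.

Lemma winds_ex T : continuous T -> (forall t, 0 <= t <= 1 -> T t != 0) ->
  exists v, winds T v.
Proof.
move=> Tc T0.
have [] := @homotopy_winds R (fun p => T p.2).
- by move=> p; apply: (@continuous_comp _ R _ snd T); [exact: cvg_snd|exact: Tc].
- by move=> s t _; exact: T0.
by move=> v [_ [_ [_ [? _ _ _ _]]]]; exists v.
Qed.

(** The homotopy moves the centre along the segment: two sides of the square are the path seen from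
    [z] and from [z'], the other two are the end points [x] and [y] seen from the moving centre. *)
Lemma winds_shift V x y T z z' v : path_in V x y T ->
  (forall s t : R, 0 <= s <= 1 -> T t != z + s *: (z' - z)) ->
  winds (fun t => T t - z) v ->
  exists ex ey v', [/\ winds (fun s => x - (z + s *: (z' - z))) ex,
    winds (fun s => y - (z + s *: (z' - z))) ey,
    winds (fun t => T t - z') v' & v' - v = ey - ex].
Proof.
move=> HT avoid wv; case: (HT) => Tc _ T0 T1.
have [] := @homotopy_winds R (fun p => T p.2 - (z + p.1 *: (z' - z))).
- move=> p; apply: cvgB; first by apply: (@continuous_comp _ R _ snd T); [exact: cvg_snd|exact: Tc].
  by apply: cvgD; [exact: cvg_cst|apply: cvgZr_tmp; exact: cvg_fst].
- by move=> s t s01 _ /=; rewrite subr_eq0; apply: avoid.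
move=> a [ey [ex [v' [wa wey wex wv' E]]]].
exists ex, ey, v'.
have av : a = v.
  by apply: winds_uniq wa _; apply: eq_winds wv => t _ /=; rewrite scale0r addr0.
split; last by rewrite -av; lia.
- by apply: eq_winds wex => s _ /=; rewrite (path_in0 HT).
- by apply: eq_winds wey => s _ /=; rewrite (path_in1 HT).
- by apply: eq_winds wv' => t _ /=; rewrite scale1r [z + _]addrC subrK.
Qed.

(** The segment is so short, compared with its distance from x, that the mesh with a single step is
    fine. *)
Lemma winds_short x z z' : `|z' - z| < `|x - z| / 4 ->
  winds (fun s => x - (z + s *: (z' - z))) (turn (x - z) (x - z')).
Proof.
move=> zz'; exists 1%N; last first.
  rewrite /wsum big_ord1 mul0r divr1 scale0r scale1r addr0.
  by congr (turn _ (_ - _)); rewrite addrC subrK.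
split=> // s t /andP[s0 s1] /andP[t0 t1] _.
have -> : x - (z + s *: (z' - z)) - (x - (z + t *: (z' - z))) = (t - s) *: (z' - z).
  rewrite scalerBl; move: (s *: _) (t *: _) => u v.
  by rewrite !opprD !opprK; rewrite addrACA subrr add0r addrACA addNr add0r addrC.
have st : `|t - s| <= 1 by rewrite ler_norml; lra.
rewrite normrZ; apply: (@le_lt_trans _ _ `|z' - z|); first by rewrite ler_piMl.
have : `|x - z| <= `|x - (z + t *: (z' - z))| + `|z' - z|.
  have {1}-> : x - z = x - (z + t *: (z' - z)) + t *: (z' - z).
    by rewrite opprD addrA subrK.
  apply: le_trans (ler_normD _ _) _; rewrite lerD2l normrZ ger0_norm //.
  by rewrite ler_piMl.
by move: zz' (normr_ge0 (z' - z)); lra.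
Qed.

Lemma turn_diff_cocycle x y z v w (e : R) : `|v - z| < e -> `|w - z| < e ->
  e <= `|x - z| / 2 -> e <= `|y - z| / 2 -> 0 < e ->
  turn_diff x y v w = turn_diff x y z w - turn_diff x y z v.
Proof.
move=> vz wz ex ey e0.
have zz : `|z - z| < e by rewrite subrr normr0.
rewrite (turn_diffE vz wz ex ey) (turn_diffE zz wz ex ey) (turn_diffE zz vz ex ey).
ring.
Qed.

(* The chain is made of points z whose cube of radius 3 dist z (~` U) separates x
   from y in U.  If there were none, the number of turns of a path from x to y
   around a point z off the reachable part, for a path that avoids the cube of
   radius 2 dist z (~` U), would contradict no_frontier_primitive. *)
Lemma separating_chain U x y (r : R) : open U -> (forall z, U z -> `|z - x| < r) ->
  joined U x y ->
  (forall b T T', ~ U b -> path_in U x y T -> path_in U x y T' ->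
     exists2 v, winds (fun t => T t - b) v & winds (fun t => T' t - b) v) ->
  let d z := dist z (~` U) in
  exists n (z : nat -> R * R), [/\ z 0%N = x, z n = y,
    forall i, (i <= n)%N -> U (z i) /\
      ~ joined [set w | U w /\ 3 * d (z i) < `|w - z i|] x y &
    forall i, (i < n)%N -> `|z i.+1 - z i| <= d (z i) / 4].
Proof.
move=> oU Ur [T0 HT0] wU d.
have Ux : U x by case: HT0 => _ /(_ 0) + /(_ 0) => /[swap] ->.
have Uy : U y by case: HT0 => _ /(_ 1) + _ /(_ 1) => /[swap] ->.
have r0 : 0 < r by move: (Ur _ Ux); rewrite subrr normr0.
have U0 : ~` U !=set0.
  exists (x + (r, 0)) => /Ur; rewrite [x + _]addrC addrK norm2_lt /=.
  by rewrite gtr0_norm // ltxx.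
have dlip z w : d z <= d w + `|z - w| by exact: dist_lip.
have dpos z : U z -> 0 < d z by exact: open_dist_gt0.
have d_ge0 z : 0 <= d z by exact: dist_ge0.
pose nonsep z := U z /\ joined [set w | U w /\ 3 * d z < `|w - z|] x y.
(* Taking the interior makes [O] open and its complement closed; a point of U off [O] is only a
   limit of non-separating points. *)
pose O z := U z /\ exists2 e, 0 < e & forall w, `|w - z| < e -> ~ nonsep w.
have Oopen z : O z -> exists2 e, 0 < e & forall w, `|w - z| < e -> O w.
  move=> [Uz [e e0 He]]; exists (Num.min (e / 2) (d z)).
    by rewrite lt_min divr_gt0 // dpos.
  move=> w; rewrite lt_min => /andP[we wd]; split.
    by apply: (@dist_ball z); rewrite distrC.
  exists (e / 2); first by rewrite divr_gt0.
  move=> v vw; apply: He; rewrite -(subrKA w); apply: le_lt_trans (ler_normD _ _) _.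
  by rewrite [e]splitr ltrD.
have Oxy z : z = x \/ z = y -> O z.
  move=> zxy; have Uz : U z by case: zxy => ->.
  split=> //; exists (d z / 4); first by rewrite divr_gt0 // dpos.
  move=> w wz [Uw [T HT]].
  have : 3 * d w < `|z - w|.
    case: zxy => ->.
      by rewrite -(path_in0 HT); case: HT => _ /(_ 0)[].
    by rewrite -(path_in1 HT); case: HT => _ /(_ 1)[].
  have := dlip z w; rewrite distrC in wz; move: wz (dpos _ Uz).
  by set a := `|z - w|; lra.
have Ox : O x by apply: Oxy; left.
have Oy : O y by apply: Oxy; right.
pose P z := O z /\ exists n (c : nat -> R * R), [/\ c 0%N = x, c n = z,
   forall i, (i <= n)%N -> O (c i) & forall i, (i < n)%N -> `|c i.+1 - c i| <= d (c i) / 4].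
have Pstep z w : P z -> O w -> `|w - z| <= d z / 4 -> P w.
  move=> [Oz [n [c [c0 cn cO cd]]]] Ow wz; split=> //.
  exists n.+1, (fun k => if (k <= n)%N then c k else w); split.
  - by rewrite leq0n.
  - by rewrite ltnn.
  - by move=> i _; case: ifP => // ?; exact: cO.
  - move=> i; rewrite ltnS => ilen; rewrite ilen.
    case: ifP => [|/negbT]; first exact: cd.
    rewrite -leqNgt => nlei; have -> : i = n by apply/eqP; rewrite eqn_leq ilen.
    by rewrite cn.
have [Py|nPy] := pselect (P y).
  have [_ [n [c [c0 cn cO cd]]]] := Py.
  exists n, c; split=> // i /cO [Uc [e e0 He]]; split=> // J.
  by apply: (He (c i)); rewrite ?subrr ?normr0.
exfalso.
(* [P] is open and closed relative to [O]: for z and w closer than d z / 8, the step is admissible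
   in both directions. *)
have Ploc z : O z -> exists2 e, 0 < e & forall w, `|w - z| < e -> (P w <-> P z).
  move=> Oz; have [e e0 He] := Oopen _ Oz; have dz := dpos _ (proj1 Oz).
  exists (Num.min e (d z / 8)); first by rewrite lt_min e0 divr_gt0.
  move=> w; rewrite lt_min => /andP[we wd]; split=> HP; apply: Pstep HP _ _ => //.
  - by have := dlip z w; rewrite distrC; move: wd; rewrite distrC; set a := `|z - w|; lra.
  - exact: He.
  - by move: wd dz; lra.
have Px : P x by split=> //; exists 0%N, (fun=> x); split=> // i; rewrite leqn0 => /eqP ->.
pose K := [set z | ~ O z /\ `|z - x| <= r + 1].
have TK z : exists T v, ~ O z -> [/\ path_in U x y T,
    forall t, 2 * d z < `|T t - z| & winds (fun t => T t - z) v].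
  have [Oz|nOz] := pselect (O z); first by exists (fun=> 0), 0.
  (* Some non-separating w lies within d z / 8 of z, and its path avoids the cube of radius 3 d w;
     the loss from w to z leaves the radius 2 d z. Off U this radius is 0, and every path of U
     avoids z. *)
  have [T HT Tz] : exists2 T, path_in U x y T & forall t, 2 * d z < `|T t - z|.
    have [Uz|nUz] := pselect (U z); last first.
      exists T0 => // t; rewrite [d z]dist0 // mulr0 normr_gt0 subr_eq0.
      by apply: contra_notN nUz => /eqP <-; case: HT0.
    have [w wz [Uw [T HT]]] : exists2 w, `|w - z| < d z / 8 & nonsep w.
      apply: contrapT => no; apply: nOz; split=> //; exists (d z / 8).
        by rewrite divr_gt0 // dpos.
      by move=> w wz ns; apply: no; exists w.
    exists T; first by apply: path_inS HT => v [].
    move=> t; have [_ /(_ t)[_ Tw] _ _] := HT.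
    have : `|T t - w| <= `|T t - z| + `|w - z|.
      by rewrite -(subrKA z); apply: le_trans (ler_normD _ _) _; rewrite [`|z - w|]distrC.
    have := dlip z w; rewrite distrC; move: wz Tw (dpos _ Uz); set a := `|w - z|; lra.
  have [|t _|v wv] := @winds_ex (fun t => T t - z).
  - by move=> t; apply: cvgB; [case: HT => + _ _ _; exact|exact: cvg_cst].
  - by rewrite -normr_gt0; apply: le_lt_trans (Tz t); rewrite mulr_ge0.
  by exists T, v => _.
pose Tz z := projT1 (cid (TK z)).
have fK z : exists v, ~ O z -> [/\ path_in U x y (Tz z),
    forall t, 2 * d z < `|Tz z t - z| & winds (fun t => Tz z t - z) v].
  by rewrite /Tz; case: cid.
pose f z := projT1 (cid (fK z)).
have fP z : ~ O z -> [/\ path_in U x y (Tz z),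
    forall t, 2 * d z < `|Tz z t - z| & winds (fun t => Tz z t - z) (f z)].
  by rewrite /f; case: cid.
(* As the centre moves from z to w, the path chosen at z gains [turn_diff x y z w]. What remains is
   that the paths chosen at z and at w wind equally around w. *)
have floc z : ~ O z -> exists2 e, 0 < e /\ (e <= `|x - z| / 2 /\ e <= `|y - z| / 2) &
    forall w, ~ O w -> `|w - z| < e -> f w - f z = turn_diff x y z w.
  move=> nOz; have [HT Tgap wz] := fP _ nOz.
  have [mu mu2 Tmu] := path_in_gap HT Tgap.
  have xz0 : 0 < `|x - z| by rewrite normr_gt0 subr_eq0; apply: contra_notN nOz => /eqP <-.
  have yz0 : 0 < `|y - z| by rewrite normr_gt0 subr_eq0; apply: contra_notN nOz => /eqP <-.
  pose e := Num.min ((mu - 2 * d z) / 8) (Num.min (`|x - z| / 4) (`|y - z| / 4)).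
  have e1 : e <= (mu - 2 * d z) / 8 by rewrite /e ge_min lexx.
  have e2 : e <= `|x - z| / 4 by rewrite /e !ge_min lexx orbT.
  have e3 : e <= `|y - z| / 4 by rewrite /e !ge_min lexx !orbT.
  exists e.
    split; first by rewrite !lt_min !divr_gt0 // subr_gt0.
    by split; [move: e2 xz0|move: e3 yz0]; lra.
  move=> w nOw we; have [HT' T'gap ww] := fP _ nOw.
  have avoid1 s t : 0 <= s <= 1 -> Tz z t != z + s *: (w - z).
    move=> /andP[s0 s1]; apply/eqP => E; have := Tmu t; rewrite E [z + _]addrC addrK normrZ ger0_norm //.
    apply/negP; rewrite -ltNge; apply: (@le_lt_trans _ _ `|w - z|); first by rewrite ler_piMl.
    by have := d_ge0 z; move: we e1; lra.
  have [ex [ey [a [wex wey wa aE]]]] := winds_shift HT avoid1 wz.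
  have exE : ex = turn (x - z) (x - w).
    by apply: winds_uniq wex _; apply: winds_short; apply: lt_le_trans we e2.
  have eyE : ey = turn (y - z) (y - w).
    by apply: winds_uniq wey _; apply: winds_short; apply: lt_le_trans we e3.
  suff -> : f w = a by rewrite aE exE eyE.
  (* Both paths avoid the segment from w to a point b off U, because |w - b| is at most 2 d w.
     Around b they wind equally by assumption, and moving the centre back to w changes both numbers
     by the same amount. *)
  have [b nUb wb] := dist_near2 w oU U0.
  have [v wv wv'] := wU _ _ _ nUb HT HT'.
  have seg_w s : 0 <= s <= 1 -> `|w + s *: (b - w) - w| <= 2 * d w.
    move=> /andP[s0 s1]; rewrite [w + _]addrC addrK normrZ ger0_norm // distrC.
    by apply: le_trans wb; rewrite ler_piMl.
  have avoid2 s t : 0 <= s <= 1 -> Tz z t != w + s *: (b - w).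
    move=> s01; apply/eqP => E; have := Tmu t; rewrite E.
    apply/negP; rewrite -ltNge -(subrKA w); apply: le_lt_trans (ler_normD _ _) _.
    have := seg_w _ s01; have := dlip w z; move: we e1 mu2; set A := `|_ + _ - _|.
    by set B := `|_ - _|; lra.
  have avoid3 s t : 0 <= s <= 1 -> Tz w t != w + s *: (b - w).
    move=> s01; apply/eqP => E; have := T'gap t; rewrite E.
    by apply/negP; rewrite -leNgt seg_w.
  have [ex2 [ey2 [a2 [wex2 wey2 wa2 a2E]]]] := winds_shift HT avoid2 wa.
  have [ex3 [ey3 [a3 [wex3 wey3 wa3 a3E]]]] := winds_shift HT' avoid3 ww.
  have Ex := winds_uniq wex2 wex3; have Ey := winds_uniq wey2 wey3.
  have Ev := winds_uniq wa2 wv; have Ev' := winds_uniq wa3 wv'.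
  by clear -a2E a3E Ex Ey Ev Ev'; lia.
(* By compactness of [K] the local statement [floc] holds at a single scale. *)
have [h h0 fh] : exists2 h : R, 0 < h & forall v w, K v -> K w -> `|v - w| < h ->
    f w - f v = turn_diff x y v w.
  have Kc : compact K.
    apply: (@subclosed_compact _ _ (`[x.1 - (r + 1), x.1 + (r + 1)]%classic `*`
                                    `[x.2 - (r + 1), x.2 + (r + 1)]%classic)).
    - rewrite -[K]setCK; apply: open_closedC; rewrite openE => z /= nKz.
      have [Oz|nOz] := pselect (O z).
        have [e e0 He] := Oopen _ Oz; apply/nbhs_ballP; exists e => //= w.
        by rewrite -ball_normE /ball_ /= distrC => /He Ow [].
      have zr : r + 1 < `|z - x| by rewrite ltNge; apply/negP => ?; apply: nKz.
      apply/nbhs_ballP; exists (`|z - x| - (r + 1)); rewrite /= ?subr_gt0 // => w.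
      rewrite -ball_normE /ball_ /= => zw [_ wx].
      suff : `|z - x| <= `|z - w| + `|w - x| by move: zw wx; lra.
      by rewrite -{1}(subrKA w); apply: ler_normD.
    - by apply: compact_setX; exact: segment_compact.
    - move=> z [_]; rewrite norm2_le !ler_norml /= => /andP[/andP[? ?] /andP[? ?]].
      by split; rewrite /= in_itv /=; lra.
  move/compact_near_coveringP in Kc.
  have [] := @Kc R (0^'+) (fun h v => K v -> forall w, K w -> `|v - w| < h ->
      f w - f v = turn_diff x y v w) _ _.
    move=> z [nOz _]; have [e [e0 [ex ey]] He] := floc _ nOz.
    exists (ball z (e / 2), [set t | 0 < t < e / 2]) => /=.
      split; first by apply: nbhsx_ballx; rewrite divr_gt0.
      by near=> t; apply/andP; split; near: t;
        [exact: nbhs_right_gt|apply: nbhs_right_lt; rewrite divr_gt0].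
    case=> v t [/= vz /andP[_ te]] [nOv _] w [nOw _] vw.
    have {}vz : `|v - z| < e / 2 by move: vz; rewrite -ball_normE /ball_ /= distrC.
    have ve : `|v - z| < e by move: vz e0; lra.
    have we : `|w - z| < e.
      rewrite -(subrKA v); apply: le_lt_trans (ler_normD _ _) _.
      by rewrite [`|w - v|]distrC; move: vw te vz; lra.
    rewrite (turn_diff_cocycle ve we ex ey e0) -!He //; ring.
  move=> h /= h0 Hh; exists (h / 2); first by rewrite divr_gt0.
  move=> v w Kv Kw vw; apply: (Hh (h / 2)) => //=; last by rewrite divr_gt0.
  by rewrite sub0r normrN gtr0_norm ?divr_gt0 // ltr_pdivrMr // ltr_pMr // ltr1n.
have [ex ex0 Hex] := Ploc _ Ox.
have [ey ey0 Hey] := Ploc _ Oy.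
apply: (@no_frontier_primitive R P K f x y r (Num.min h 1) (Num.min ex ey)).
- by rewrite lt_min h0 ltr01.
- by rewrite lt_min ex0.
- by move=> z [[Uz _] _]; exact: Ur.
- by move=> z; rewrite lt_min => /andP[/Hex[_]] + _; exact.
- by move=> z; rewrite lt_min => /andP[_ /Hey[+ _]] => /[swap] Pz /(_ Pz).
- by move=> v w Kv Kw; rewrite lt_min => /andP[vw _]; exact: fh.
move=> v w Pv nPw; rewrite le_min => /andP[_ vw1].
pose g (t : R) := v + t *: (w - v).
have gv (t : R) : 0 <= t <= 1 -> `|g t - v| <= `|w - v|.
  move=> /andP[t0 t1]; rewrite /g [v + _]addrC addrK normrZ ger0_norm //.
  by rewrite ler_piMl.
(* A segment from P to its complement leaves O: otherwise the indicator of P along it would be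
   locally constant, hence continuous, and would take the value 1/2. *)
have [t t01 nOt] : exists2 t : R, 0 <= t <= 1 & ~ O (g t).
  apply: contrapT => no.
  have Og t : 0 <= t <= 1 -> O (g t) by move=> t01; apply: contrapT => nO; apply: no; exists t.
  pose phi t : R := if `[< P (g (clamp t)) >] then 1 else 0.
  have gc : continuous (fun t => g (clamp t)).
    by move=> t; apply: cvgD; [exact: cvg_cst|apply: cvgZr_tmp; exact: continuous_clamp].
  have phic : continuous phi.
    move=> t; have [e e0 He] := Ploc _ (Og _ (clamp01 t)).
    have /cvgrPdist_lt /(_ _ e0) gt := gc t.
    apply/cvgrPdist_lt => eps eps0; near=> s.
    have /He Ps : `|g (clamp s) - g (clamp t)| < e by rewrite distrC; near: s.
    rewrite /phi; have -> : `[< P (g (clamp s)) >] = `[< P (g (clamp t)) >].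
      by apply/asboolP/asboolP => /Ps.
    by rewrite subrr normr0.
  have g0 : g (clamp 0) = v by rewrite clamp_le0 // /g scale0r addr0.
  have g1 : g (clamp 1) = w by rewrite clamp_ge1 // /g scale1r addrC subrK.
  have phi0 : phi 0 = 1 by rewrite /phi g0 asboolT.
  have phi1 : phi 1 = 0 by rewrite /phi g1 asboolF.
  have [] := @IVT R phi 0 1 (1 / 2) ler01.
  - exact: continuous_subspaceT.
  - by rewrite phi0 phi1 ge_min le_max; lra.
  by move=> c _; rewrite /phi; case: ifP => _; lra.
exists (g t); last exact: gv.
split=> //; rewrite -(subrKA v); apply: le_trans (ler_normD _ _) _.
have /Ur vx : U v by case: Pv => -[].
by have := gv _ t01; move: vx vw1; lra.
Unshelve. all: by end_near. Qed.

End Paths.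

(** * Winding numbers in simply connected domains and in balls *)

Section SimplyConnected.
Context {R : realType}.
Implicit Types (x y z : R * R) (T : R -> R * R) (U V : set (R * R)).

Lemma within_continuous_comp (X Y Z : topologicalType) (A : set Y)
    (f : X -> Y) (g : Y -> Z) : {within A, continuous g} -> continuous f ->
  (forall a, A (f a)) -> continuous (g \o f).
Proof.
move=> /subspace_continuousP gA fc Af a.
apply: cvg_trans (gA _ (Af a)).
move=> B /= HB; have := fc a _ HB.
move=> H; have : nbhs a (fun u => A (f u) -> B (g (f u))) := H.
by apply: filterS => u; apply.
Qed.

Lemma continuous_pair (X Y Z : topologicalType) (f : X -> Y) (g : X -> Z) :
  continuous f -> continuous g -> continuous (fun p => (f p, g p)).
Proof. by move=> fc gc p; apply: (cvg_pair (fc p) (gc p)). Qed.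

Lemma winds_cst z : winds (fun=> z) 0 \/ z = 0.
Proof.
have [->|z0] := eqVneq z 0; [by right|left; exists 1%N; last first].
  by rewrite /wsum big_ord1 /turn subrr if_same.
by split=> // s t _ _ _; rewrite subrr normr0 divr_gt0 // normr_gt0.
Qed.

(** The two sides of the square on which [K] is constant wind 0 times, so the balance of
    [homotopy_winds] becomes an equality. *)
Lemma homotopy_winds_eq U x y T T' b (K : R * R -> R * R) : ~ U b ->
  continuous K ->
  (forall s t, 0 <= s <= 1 -> 0 <= t <= 1 -> U (K (s, t))) ->
  (forall t, 0 <= t <= 1 -> K (0, t) = T t) ->
  (forall t, 0 <= t <= 1 -> K (1, t) = T' t) ->
  (forall s, 0 <= s <= 1 -> K (s, 0) = x) ->
  (forall s, 0 <= s <= 1 -> K (s, 1) = y) ->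
  exists2 v, winds (fun t => T t - b) v & winds (fun t => T' t - b) v.
Proof.
move=> nUb Kc KU K0 K1 Kx Ky.
have z01 : 0 <= (0 : R) <= 1 by rewrite lexx ler01.
have o01 : 0 <= (1 : R) <= 1 by rewrite lexx ler01.
have [] := @homotopy_winds R (fun p => K p - b).
- by move=> p; apply: cvgB; [exact: Kc|exact: cvg_cst].
- move=> s t s01 t01; rewrite subr_eq0; apply: contra_notN nUb => /eqP <-.
  exact: KU.
move=> v [ey [ex [v' [wv wey wex wv' E]]]].
have zero z e : U z -> winds (fun=> z - b) e -> e = 0.
  move=> Uz we; case: (winds_cst (z - b)) => [|/eqP]; first exact: winds_uniq.
  by rewrite subr_eq0 => /eqP zb; exfalso; apply: nUb; rewrite -zb.
have ey0 : ey = 0.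
  apply: (@zero y); first by rewrite -(Ky _ z01); apply: KU.
  by apply: eq_winds wey => s s01; rewrite Ky.
have ex0 : ex = 0.
  apply: (@zero x); first by rewrite -(Kx _ z01); apply: KU.
  by apply: eq_winds wex => s s01; rewrite Kx.
exists v; first by apply: eq_winds wv => t t01; rewrite K0.
have -> : v = v' by rewrite ey0 ex0 addr0 add0r in E.
by apply: eq_winds wv' => t t01; rewrite K1.
Qed.

Lemma simply_connected_winds (Omega : set (R * R)) x y b T T' :
  simply_connected Omega -> ~ Omega b ->
  path_in Omega x y T -> path_in Omega x y T' ->
  exists2 v, winds (fun t => T t - b) v & winds (fun t => T' t - b) v.
Proof.
move=> [_ null] nb HT HT'.
have [Tc OT T0 T1] := HT; have [Tc' OT' T0' T1'] := HT'.
have lin (a c : R) : continuous (fun t : R => a * t + c).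
  move=> t; apply: cvgD; last exact: cvg_cst.
  by apply: cvgM; [exact: cvg_cst|exact: cvg_id].
(* The loop that follows T and comes back along T', written again as a sum in which one of the two
   paths rests at y. *)
pose gam (t : R) := T (2 * t + 0) + T' (- 2 * t + 2) - y.
have gam1 (t : R) : 2 * t <= 1 -> gam t = T (2 * t).
  by move=> t1; rewrite /gam [T' _]T1' ?addrK ?addr0 //; lra.
have gam2 (t : R) : 1 <= 2 * t -> gam t = T' (2 - 2 * t).
  by move=> t1; rewrite /gam [T _]T1 ?[y + _]addrC ?addrK 1?mulNr 1?[- _ + _]addrC //; lra.
have gamc : continuous gam.
  move=> t; apply: cvgB; last exact: cvg_cst.
  by apply: cvgD;
    [apply: (@continuous_comp R R _ (fun t => 2 * t + 0) T)
    |apply: (@continuous_comp R R _ (fun t => - 2 * t + 2) T')];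
    by [exact: lin|exact: Tc|exact: Tc'].
have gam0 : gam 0 = x by rewrite gam1 ?mulr0 // T0.
have gamE1 : gam 1 = x by rewrite gam2 ?mulr1 ?subrr ?T0' //; lra.
have [||H [Hc OH H0 H1 Hs]] := null gam (continuous_subspaceT gamc) _ _.
- move=> t _; have [t1|t1] := lerP (2 * t) 1; first by rewrite gam1.
  by rewrite gam2 // ltW.
- by rewrite gam0 gamE1.
rewrite gam0 in H1 Hs.
have Hb1 s t : 0 <= s <= 1 -> 0 <= t <= 1 -> Omega (H (s, t)).
  by move=> s01 t01; apply: OH; rewrite in_itv.
have Hb2 t : 0 <= t <= 1 -> H (0, t) = gam t by move=> ?; apply: H0; rewrite in_itv.
have Hb3 t : 0 <= t <= 1 -> H (1, t) = x by move=> ?; apply: H1; rewrite in_itv.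
have Hb4 s : 0 <= s <= 1 -> H (s, 0) = x /\ H (s, 1) = x.
  by move=> ?; apply: Hs; rewrite in_itv.
pose cl (p : R * R) : R * R := (clamp p.1, clamp p.2).
have clc : continuous cl.
  apply: continuous_pair => p; apply: (@continuous_comp _ R R _ clamp);
  by [exact: cvg_fst|exact: cvg_snd|exact: continuous_clamp].
have Hclc : continuous (H \o cl).
  apply: within_continuous_comp Hc clc _ => p.
  by split; rewrite /= in_itv /=; exact: clamp01.
(* The three sides of the square on which H is constant are run through by c. *)
pose c1 (s : R) : R := Num.min (3 * s + 0) (- 3 * s + 3).
pose c2 (s : R) : R := clamp (3 * s + - 1).
have c1c : continuous c1.
  by move=> s; apply: (@continuous_min R R (fun s => 3 * s + 0) (fun s => - 3 * s + 3)); exact: lin.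
have c2c : continuous c2.
  by move=> s; apply: (@continuous_comp R R R (fun s => 3 * s + - 1) clamp); [exact: lin|exact: continuous_clamp].
pose c s := (c1 s, c2 s).
(* The cone over [c] with vertex (0, 1/2), where [gam] is at y. Its rays at s = 0 and s = 1 lie on
   the side of the square that carries [gam], so they yield T and T'; its base is where H is
   constant. *)
pose q (p : R * R) := ((1 - p.2) * c1 p.1, (1 - p.2) * c2 p.1 + p.2 * 2^-1).
have qc : continuous q.
  apply: continuous_pair => p.
    apply: cvgM; first by apply: cvgB; [exact: cvg_cst|exact: cvg_snd].
    by apply: (@continuous_comp _ R R fst c1); [exact: cvg_fst|exact: c1c].
  apply: cvgD; last by apply: cvgM; [exact: cvg_snd|exact: cvg_cst].
  apply: cvgM; first by apply: cvgB; [exact: cvg_cst|exact: cvg_snd].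
  by apply: (@continuous_comp _ R R fst c2); [exact: cvg_fst|exact: c2c].
have qE s t : q (s, t) =
    ((1 - t) * Num.min (3 * s + 0) (- 3 * s + 3), (1 - t) * clamp (3 * s - 1) + t * 2^-1) by [].
have c01 (s : R) : 0 <= s <= 1 -> H (cl (c s)) = x.
  move=> /andP[s0 s1]; rewrite /c /c1 /c2 /cl /=.
  have [s13|s13] := lerP (3 * s) 1.
    by rewrite (clamp_le0 (t := 3 * s + -1)) ?(clamp_le0 (lexx 0)); [case: (Hb4 _ (clamp01 (Num.min (3 * s + 0) (-3 * s + 3))))|lra].
  have [s23|s23] := lerP 2 (3 * s).
    by rewrite (clamp_ge1 (t := 3 * s + -1)) ?(clamp_ge1 (lexx 1)); [case: (Hb4 _ (clamp01 (Num.min (3 * s + 0) (-3 * s + 3))))|lra].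
  by rewrite (clamp_ge1 (t := Num.min _ _)); [exact: Hb3 (clamp01 _)|rewrite le_min; lra].
apply: (@homotopy_winds_eq Omega x y T T' b (fun p => (H \o cl) (q p))) => //.
- by move=> p; apply: (@continuous_comp (R * R)%type (R * R)%type (R * R)%type q (H \o cl)); [exact: qc|exact: Hclc].
- by move=> s t _ _ /=; apply: Hb1; exact: clamp01.
- move=> t t01; have [t0 t1] := andP t01; rewrite /= qE min_l; last lra.
  rewrite [clamp (_ - 1)]clamp_le0; last lra.
  rewrite /cl /= clamp_le0; last lra.
  rewrite clamp_id; last lra.
  by rewrite Hb2 ?gam1; [congr T; field|lra|lra].
- move=> t t01; have [t0 t1] := andP t01; rewrite /= qE min_r; last lra.
  rewrite [clamp (_ - 1)]clamp_ge1; last lra.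
  rewrite /cl /= clamp_le0; last lra.
  rewrite clamp_id; last lra.
  by rewrite Hb2 ?gam2; [congr T'; field|lra|lra].
- by move=> s s01; rewrite /q /= subr0 !mul1r mul0r addr0 c01.
- move=> s s01; rewrite /= qE subrr !mul0r add0r mul1r /cl /= clamp_le0 //.
  rewrite clamp_id; last lra.
  by rewrite Hb2 ?gam1; [apply: T1; lra|lra|lra].
Qed.

(** The ball is convex, so the linear homotopy stays in it and avoids [b]. *)
Lemma ball_winds o (rho : R) x y b T T' : rho <= `|b - o| ->
  path_in [set w | `|w - o| < rho] x y T ->
  path_in [set w | `|w - o| < rho] x y T' ->
  exists2 v, winds (fun t => T t - b) v & winds (fun t => T' t - b) v.
Proof.
move=> bo HT HT'; have [Tc OT T0 T1] := HT; have [Tc' OT' T0' T1'] := HT'.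
pose K (p : R * R) := (1 - p.1) *: T p.2 + p.1 *: T' p.2.
apply: (@homotopy_winds_eq [set w | `|w - o| < rho] x y T T' b K).
- by rewrite /= ltNge bo.
- move=> p; apply: cvgD; apply: cvgZ.
  + by apply: cvgB; [exact: cvg_cst|exact: cvg_fst].
  + by apply: (@continuous_comp _ R _ snd T); [exact: cvg_snd|exact: Tc].
  + exact: cvg_fst.
  + by apply: (@continuous_comp _ R _ snd T'); [exact: cvg_snd|exact: Tc'].
- move=> s t /andP[s0 s1] _; rewrite /K /=.
  have -> : (1 - s) *: T t + s *: T' t - o = (1 - s) *: (T t - o) + s *: (T' t - o).
    rewrite !scalerBr addrACA -opprD -scalerDl subrK scale1r //.
  apply: le_lt_trans (ler_normD _ _) _; rewrite !normrZ !ger0_norm ?subr_ge0 //.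
  have := OT t; have := OT' t; rewrite /= => h1 h2.
  have [->|s0'] := eqVneq s 0; first by rewrite subr0 mul1r mul0r addr0.
  by have : 0 < s by [rewrite lt_neqAle eq_sym s0']; nra.
- by move=> t _; rewrite /K /= subr0 scale1r scale0r addr0.
- by move=> t _; rewrite /K /= subrr scale0r scale1r add0r.
- by move=> s _; rewrite /K /= T0 // T0' // -scalerDl subrK scale1r.
- by move=> s _; rewrite /K /= T1 // T1' // -scalerDl subrK scale1r.
Qed.

(* Among the chains of separating_chain, one of minimal length. *)
Lemma separating_packed_chain (Omega : set (R * R)) x y (rho : R) :
  simply_connected Omega -> open Omega ->
  let U := [set w | Omega w /\ `|w - x| < rho] in
  let d z := dist z (~` U) in
  joined U x y ->
  exists n (z : nat -> R * R), [/\ z 0%N = x, z n = y,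
    forall i, (i <= n)%N -> U (z i) /\
      ~ joined [set w | U w /\ 3 * d (z i) < `|w - z i|] x y,
    forall i, (i < n)%N -> `|z i.+1 - z i| <= d (z i) / 4 &
    forall i j, (i.+1 < j <= n)%N -> d (z i) / 4 < `|z j - z i|].
Proof.
move=> sc oO U d J.
have oU : open U.
  apply: openI oO _; rewrite openE => w /= wx; apply/nbhs_ballP.
  exists (rho - `|w - x|); rewrite /= ?subr_gt0 // => v; rewrite -ball_normE /ball_ /= => wv.
  by rewrite -(subrKA w); apply: le_lt_trans (ler_normD _ _) _; rewrite distrC; lra.
have [n0 [z0 H0]] : exists n (z : nat -> R * R), [/\ z 0%N = x, z n = y,
    forall i, (i <= n)%N -> U (z i) /\
      ~ joined [set w | U w /\ 3 * d (z i) < `|w - z i|] x y &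
    forall i, (i < n)%N -> `|z i.+1 - z i| <= d (z i) / 4].
  apply: (@separating_chain R U x y rho) => //; first by move=> w [].
  (* U may fail to be connected, but a point off U is off Omega or off the ball, and the paths of U
     are paths of both. *)
  move=> b T T' nUb HT HT'.
  have [Ob|nOb] := pselect (Omega b).
    apply: (@ball_winds x rho x y).
    - by rewrite leNgt; apply/negP => ?; apply: nUb.
    - by apply: path_inS HT => ? [].
    - by apply: path_inS HT' => ? [].
  by apply: (simply_connected_winds sc nOb); [apply: path_inS HT => ? []|apply: path_inS HT' => ? []].
pose Q n := `[< exists z : nat -> R * R, [/\ z 0%N = x, z n = y,
    forall i, (i <= n)%N -> U (z i) /\
      ~ joined [set w | U w /\ 3 * d (z i) < `|w - z i|] x y &
    forall i, (i < n)%N -> `|z i.+1 - z i| <= d (z i) / 4] >].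
have exQ : exists n, Q n by exists n0; apply/asboolP; exists z0.
case: (ex_minnP exQ) => n /asboolP[z [zx zy zU zd]] nmin.
exists n, z; split=> // i j /andP[ij jn]; rewrite ltNge; apply/negP => zji.
(* If z_j were within d(z_i) / 4 of z_i, the chain could jump from i to j, against minimality. *)
pose c k := if (k <= i)%N then z k else z (k + (j - i.+1))%N.
have : (n <= n - (j - i.+1))%N.
  apply: nmin; apply/asboolP; exists c; split.
  - by rewrite /c leq0n.
  - by rewrite /c ifF; [rewrite subnK //; lia|apply/negbTE; lia].
  - by move=> k kn; rewrite /c; case: ifP => ki; apply: zU; lia.
  - move=> k kn; rewrite /c; case: (ltngtP k i) => ki.
    + by apply: zd; lia.
    + by rewrite addSn; apply: zd; lia.
    + by rewrite ki (_ : (i.+1 + (j - i.+1))%N = j) //; lia.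
by lia.
Qed.

End SimplyConnected.

(** * The length of a polygon *)

(** The integral of a nonnegative function is a supremum over the simple functions below it, hence
    monotone in the function. *)
Lemma le_integral_ge0 (d : measure_display) (T : measurableType d) (R : realType)
    (mu : {measure set T -> \bar R}) (D : set T) (f1 f2 : T -> \bar R) :
  (forall x, D x -> 0 <= f1 x)%E -> (forall x, D x -> f1 x <= f2 x)%E ->
  (\int[mu]_(x in D) f1 x <= \int[mu]_(x in D) f2 x)%E.
Proof.
move=> f10 f12; have f20 x : D x -> (0 <= f2 x)%E.
  by move=> Dx; apply: le_trans (f10 _ Dx) (f12 _ Dx).
rewrite !ge0_integralE //; apply: le_ereal_sup => _ [h /= hf <-]; exists h => //= x.
apply: le_trans (hf x) _; rewrite /patch; case: ifPn => // /set_mem; exact: f12.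
Qed.

Section Length.
Context {R : realType}.
Implicit Types (x y z : R * R) (g : R -> R * R).

Lemma enorm_ge0 z : 0 <= enorm z.
Proof. exact: sqrtr_ge0. Qed.

Lemma enormZ (a : R) z : enorm (a *: z) = `|a| * enorm z.
Proof.
have -> : enorm (a *: z) = Num.sqrt ((a * z.1) ^+ 2 + (a * z.2) ^+ 2) by [].
rewrite !exprMn -mulrDr.
by rewrite sqrtrM ?sqr_ge0 // sqrtr_sqr.
Qed.

Lemma ler_enormD y z : enorm (y + z) <= enorm y + enorm z.
Proof.
rewrite /enorm /=; set a := y.1; set b := y.2; set c := z.1; set d := z.2.
have s1 : 0 <= a ^+ 2 + b ^+ 2 by rewrite addr_ge0 ?sqr_ge0.
have s2 : 0 <= c ^+ 2 + d ^+ 2 by rewrite addr_ge0 ?sqr_ge0.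
rewrite -(ler_pXn2r (n := 2)) ?nnegrE ?addr_ge0 ?sqrtr_ge0 // sqr_sqrtr ?addr_ge0 ?sqr_ge0 //.
rewrite [leRHS]sqrrD !sqr_sqrtr // -sqrtrM //.
have : a * c + b * d <= Num.sqrt ((a ^+ 2 + b ^+ 2) * (c ^+ 2 + d ^+ 2)).
  apply: le_trans (ler_norm _) _; rewrite -sqrtr_sqr ler_wsqrtr //.
  by have := sqr_ge0 (a * d - b * c); rewrite !expr2; lra.
by rewrite -mulr_natr; lra.
Qed.

Lemma enorm_le z : enorm z <= 2 * `|z|.
Proof.
have [z1 z2] : `|z.1| <= `|z| /\ `|z.2| <= `|z|.
  by have := lexx `|z|; rewrite {1}norm2_le => /andP[].
rewrite /enorm -[X in _ <= X]ger0_norm ?mulr_ge0 // -sqrtr_sqr ler_wsqrtr //.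
rewrite -(real_normK (num_real z.1)) -(real_normK (num_real z.2)).
have := normr_ge0 z.1; have := normr_ge0 z.2.
by move: z1 z2; nra.
Qed.

Lemma norm_le_enorm z : `|z| <= enorm z.
Proof.
rewrite norm2_le /enorm -!sqrtr_sqr !ler_wsqrtr // ?lerDl ?lerDr sqr_ge0 //.
Qed.

Lemma polygon_length_nil g (a b : R) : polygon_length g a b [::] = 0.
Proof. by rewrite /polygon_length big_nil. Qed.

Lemma polygon_length_cons g (a b t : R) s :
  polygon_length g a b (t :: s) = enorm (g t - g a) + polygon_length g t b s.
Proof. by rewrite /polygon_length /= big_nat_recl. Qed.

Lemma polygon_length_cat g (a b c : R) s1 s2 : last a s1 = b ->
  polygon_length g a c (s1 ++ s2) = polygon_length g a b s1 + polygon_length g b c s2.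
Proof.
elim: s1 a => [|t s1 IHs] a /=; first by move=> ->; rewrite polygon_length_nil add0r.
by move=> /IHs E; rewrite !polygon_length_cons E addrA.
Qed.

Lemma polygon_length_lip g (a b : R) s :
  (forall t u, a <= t -> t <= u -> u <= b -> enorm (g u - g t) <= u - t) ->
  itv_partition a b s -> polygon_length g a b s <= b - a.
Proof.
elim: s a => [|t s IHs] a lip.
  by rewrite polygon_length_nil => -[_ /= /eqP ->]; rewrite subrr.
move=> [/= /andP[at_ pth] lst]; rewrite polygon_length_cons.
have tb : t <= b.
  have : itv_partition t b s by [].
  exact: itv_partition_le.
have := lip a t (lexx _) (ltW at_) tb.
have : polygon_length g t b s <= b - t.
  by apply: IHs => // u v tu uv vb; apply: lip => //; apply: le_trans tu; exact: ltW.
lra.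
Qed.

Definition has_length g (a b v : R) :=
  exists2 s, itv_partition a b s & v <= polygon_length g a b s.

Lemma has_length_cat g (a b c v w : R) :
  has_length g a b v -> has_length g b c w -> has_length g a c (v + w).
Proof.
move=> [s1 p1 l1] [s2 p2 l2]; exists (s1 ++ s2).
  exact: itv_partition_cat p1 p2.
by rewrite (@polygon_length_cat g a b c) ?lerD //; case: p1 => _ /eqP.
Qed.

Lemma has_length_seg g (a b : R) : a <= b -> has_length g a b (enorm (g b - g a)).
Proof.
rewrite le_eqVlt => /predU1P[->|ab].
  exists [::]; first by split => //=.
  by rewrite polygon_length_nil subrr /enorm /= expr0n addr0 sqrtr0.
exists [:: b]; first by split => /=; rewrite ?ab.
by rewrite polygon_length_cons polygon_length_nil addr0.
Qed.

(** The Lipschitz bound controls all inscribed polygons from above, [has_length] provides one that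
    attains the bound. Together they make the parameter an arc length, so that [arc_param] returns
    the curve itself. *)
Lemma curve_length_unit g (L : R) :
  (forall t u, 0 <= t -> t <= u -> u <= L -> enorm (g u - g t) <= u - t) ->
  (forall s, 0 <= s <= L -> has_length g 0 s s) ->
  forall s, 0 <= s <= L -> curve_length g 0 s = s%:E.
Proof.
move=> lip len s sL; have [s0 s1] := andP sL; apply/eqP; rewrite eq_le; apply/andP; split.
  apply: ge_ereal_sup => _ [p pp <-]; rewrite lee_fin.
  rewrite -[leRHS]subr0; apply: polygon_length_lip pp => t u t0 tu us.
  by apply: lip => //; apply: le_trans us s1.
have [p pp lp] := len s sL.
by apply: ereal_sup_ge; exists (polygon_length g 0 s p)%:E; [exists p|rewrite lee_fin].
Qed.

Lemma locate (tt : nat -> R) n (s : R) : tt 0%N <= s <= tt n ->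
  n = 0%N \/ exists2 i, (i < n)%N & tt i <= s <= tt i.+1.
Proof.
elim: n => [|n IHn] /andP[s0 sn]; first by left.
right; have [sn'|sn'] := lerP s (tt n); last by exists n => //; rewrite ltW.
have [n0|[i ilt Hi]] := IHn (introT andP (conj s0 sn')); last by exists i => //; exact: ltnW.
by subst n; exists 0%N => //; rewrite s0.
Qed.

Lemma le_integral_steps (w : R -> R) (tt c : nat -> R) n :
  (forall i, (i < n)%N -> tt i <= tt i.+1) -> (forall i, (i < n)%N -> 0 <= c i) ->
  (forall s, 0 <= w s) ->
  (forall i s, (i < n)%N -> tt i <= s <= tt i.+1 -> w s <= c i) ->
  (0 < n)%N ->
  (\int[lebesgue_measure]_(s in `[tt 0%N, tt n]) (w s)%:E <=
     (\sum_(i < n) c i * (tt i.+1 - tt i))%:E)%E.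
Proof.
move=> ttm c0 w0 wc n0.
have mI i : measurable (`[tt i, tt i.+1]%classic : set R) by [].
apply: (@le_trans _ _ (\int[lebesgue_measure]_(s in `[tt 0%N, tt n])
   \sum_(i < n) (c i * \1_(`[tt i, tt i.+1]%classic) s)%:E)%E).
  apply: le_integral_ge0 => s /=; first by rewrite lee_fin.
  rewrite in_itv /= => sn; have [n00|[i ilt Hi]] := locate sn; first by rewrite n00 in n0.
  rewrite sumEFin lee_fin (bigD1 (Ordinal ilt)) //= indicE mem_set; last by rewrite /= in_itv.
  rewrite mulr1; apply: le_trans (wc _ _ ilt Hi) _; rewrite lerDl sumr_ge0 // => j _.
  by rewrite mulr_ge0 // c0.
rewrite ge0_integral_sum //; last first.
- by move=> i s _; rewrite lee_fin mulr_ge0 // c0.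
- by move=> i; apply/measurable_EFinP; apply: measurable_funM => //; exact: measurable_indic.
rewrite -sumEFin; apply: lee_sum => i _.
under eq_integral do rewrite EFinM.
rewrite ge0_integralZl //; last first.
- by rewrite lee_fin c0.
- by apply/measurable_EFinP; exact: measurable_indic.
rewrite integral_indic // EFinM lee_wpmul2l ?lee_fin ?c0 //.
apply: (@le_trans _ _ (lebesgue_measure (`[tt i, tt i.+1]%classic : set R))).
  by apply: le_measure; rewrite ?inE //; exact: measurableI.
rewrite lebesgue_measure_itv /=; case: ifP => _; first by rewrite -EFinB.
by rewrite lee_fin subr_ge0 ttm.
Qed.

(** The i-th edge stays within r_i / 4 of z_i, hence at distance at least r_i / 2 from the boundary,
    and its Euclidean length is at most 2 r_i / 4. It contributes at most (r_i / 2)^(alpha - 1) (r_i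
    / 2). *)
Lemma intrinsic_dist_chain (alpha : R) (Omega : set (R * R)) (z : nat -> R * R)
    (r : nat -> R) n :
  0 < alpha < 1 -> (forall i, (i < n)%N -> 0 < r i) ->
  (forall i w, (i < n)%N -> `|w - z i| < r i -> Omega w) ->
  (forall i, (i < n)%N -> `|z i.+1 - z i| <= r i / 4) -> (0 < n)%N ->
  (intrinsic_dist alpha Omega (z 0%N) (z n) <= (\sum_(i < n) r i `^ alpha)%:E)%E.
Proof.
move=> /andP[alpha0 alpha1] r0 Or zr n_gt0.
pose L i := enorm (z i.+1 - z i).
pose tt i := \sum_(j < i) L j.
have L0 i : 0 <= L i by exact: enorm_ge0.
have ttS i : tt i.+1 = tt i + L i by rewrite /tt big_ord_recr.
have tt0 : tt 0%N = 0 by rewrite /tt big_ord0.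
have ttm i j : (i <= j)%N -> tt i <= tt j.
  by move=> /subnK <-; elim: (j - i)%N => // k IH; rewrite addSn ttS; apply: le_trans IH _; rewrite lerDl.
have tt_ge0 i : 0 <= tt i by rewrite -tt0 ttm.
have L00 i : L i = 0 -> z i.+1 = z i.
  move=> Li0; apply/eqP; rewrite -subr_eq0 -normr_le0; apply: le_trans (norm_le_enorm _) _.
  by rewrite -/(L i) Li0.
(* The fraction of the i-th edge covered at arc length s. On a degenerate edge the division by 0
   gives 0, which does no harm because the two end points coincide. *)
pose c i (s : R) := clamp ((s - tt i) / L i).
have cL i s : c i s * L i = Num.min (Num.max (s - tt i) 0) (L i).
  rewrite /c; have [Li|Li] := eqVneq (L i) 0.
    by rewrite Li mulr0 min_r // le_max lexx orbT.
  have Lp : 0 < L i by rewrite lt_neqAle eq_sym Li L0.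
  have [s0|s0] := lerP (s - tt i) 0.
    by rewrite clamp_le0 ?mul0r ?min_l // pmulr_lle0 ?invr_gt0.
  have [s1|s1] := lerP (s - tt i) (L i).
    by rewrite clamp_id ?divfK // divr_ge0 ?(ltW s0) //= ler_pdivrMr ?mul1r.
  by rewrite clamp_ge1 ?mul1r // ler_pdivlMr // mul1r ltW.
have c01 i s : 0 <= c i s <= 1 by exact: clamp01.
have cm i s u : s <= u -> c i s <= c i u.
  move=> su; rewrite /c /clamp; have q : (s - tt i) / L i <= (u - tt i) / L i.
    by rewrite ler_wpM2r ?invr_ge0 // lerD2r.
  by rewrite ge_max !le_max lexx /=; apply/orP; right; rewrite le_min !ge_min q lexx orbT.
pose G s := z 0%N + \sum_(i < n) c i s *: (z i.+1 - z i).
have csum s k : 0 <= s -> \sum_(i < k) c i s * L i = Num.min s (tt k).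
  move=> s0; elim: k => [|k IHk]; first by rewrite big_ord0 tt0 min_r.
  rewrite big_ord_recr /= IHk cL ttS.
  have [sk|sk] := lerP s (tt k).
    by rewrite max_r ?subr_le0 // min_l // addr0 min_l // ler_wpDr.
  rewrite max_l ?subr_ge0 ?(ltW sk) //.
  by have [h|h] := lerP (s - tt k) (L k); have [h'|h'] := lerP s (tt k + L k); lra.
have Glip t u : 0 <= t -> t <= u -> u <= tt n -> enorm (G u - G t) <= u - t.
  move=> t0 tu un.
  have -> : G u - G t = \sum_(i < n) (c i u - c i t) *: (z i.+1 - z i).
    rewrite /G opprD addrACA subrr add0r -sumrB.
    by apply: eq_bigr => i _; rewrite scalerBl.
  apply: (@le_trans _ _ (\sum_(i < n) (c i u * L i - c i t * L i))); last first.
    by rewrite sumrB !csum ?(le_trans t0 tu) // !min_l // (le_trans tu un).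
  elim/big_rec2: _ => [|i x w _ xw]; first by rewrite /enorm /= expr0n addr0 sqrtr0.
  apply: le_trans (ler_enormD _ _) _; rewrite lerD // enormZ ger0_norm ?mulrBl //.
  by rewrite subr_ge0 cm.
have c1 i s : tt i.+1 <= s -> c i s *: (z i.+1 - z i) = z i.+1 - z i.
  move=> si; have [Li|Li] := eqVneq (L i) 0; first by rewrite L00 // subrr scaler0.
  have Lp : 0 < L i by rewrite lt_neqAle eq_sym Li L0.
  by rewrite /c clamp_ge1 ?scale1r // ler_pdivlMr // mul1r lerBrDl -ttS.
have c0 i s : s <= tt i -> c i s = 0.
  by move=> si; rewrite /c clamp_le0 // mulr_le0_ge0 ?subr_le0 ?invr_ge0.
have GE i s : (i < n)%N -> tt i <= s <= tt i.+1 -> G s = z i + c i s *: (z i.+1 - z i).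
  move=> ilt /andP[si1 si2]; rewrite /G -(big_mkord predT (fun i => c i s *: (z i.+1 - z i))).
  rewrite (@big_cat_nat _ _ _ i) //=; last exact: ltnW.
  rewrite (@big_ltn _ _ _ i) //=.
  have -> : \sum_(0 <= j < i) c j s *: (z j.+1 - z j) = z i - z 0%N.
    rewrite -(telescope_sumr _ (leq0n i)); apply: eq_big_nat => j /andP[_ ji].
    by apply: c1; apply: le_trans si1; exact: ttm.
  have -> : \sum_(i.+1 <= j < n) c j s *: (z j.+1 - z j) = 0.
    rewrite big_nat big1 // => j /andP[ij _].
    by rewrite c0 ?scale0r //; apply: le_trans si2 _; exact: ttm.
  by rewrite addr0 addrA [z 0%N + _]addrC subrK.
have Gtt i : (i < n)%N -> G (tt i) = z i.
  by move=> ilt; rewrite (GE i) ?lexx ?ttm //= c0 // scale0r addr0.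
have Gn : G (tt n) = z n.
  have ilt : (n.-1 < n)%N by rewrite prednK.
  have := GE n.-1 (tt n) ilt; have := c1 n.-1 (tt n).
  rewrite prednK // => -> // ->; first by rewrite addrC subrK.
  by rewrite lexx ttm // leq_pred.
have Gseg i s : (i < n)%N -> tt i <= s <= tt i.+1 -> enorm (G s - G (tt i)) = s - tt i.
  move=> ilt /andP[si1 si2]; rewrite Gtt // (GE i) ?si1 // [z i + _]addrC addrK enormZ.
  rewrite ger0_norm; last by case/andP: (c01 i s).
  by rewrite -/(L i) cL max_l ?subr_ge0 // min_l // lerBlDl -ttS.
have len_tt i : (i < n)%N -> has_length G 0 (tt i) (tt i).
  elim: i => [|i IHi] ilt.
    by rewrite tt0; exists [::] => //; rewrite polygon_length_nil.
  rewrite [X in has_length _ _ _ X](_ : _ = tt i + (tt i.+1 - tt i)); last by ring.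
  apply: has_length_cat (IHi (ltnW ilt)) _.
  have := @has_length_seg G (tt i) (tt i.+1) (ttm _ _ (leqnSn _)).
  by rewrite Gseg ?lexx ?ttm //; exact: ltnW.
have loc s : 0 <= s <= tt n -> exists2 i, (i < n)%N & tt i <= s <= tt i.+1.
  by rewrite -{1}tt0 => /locate[n00|//]; rewrite n00 in n_gt0.
have hlen s : 0 <= s <= tt n -> has_length G 0 s s.
  move=> sn; have [i ilt Hi] := loc s sn.
  rewrite [X in has_length _ _ _ X](_ : _ = tt i + (s - tt i)); last by ring.
  apply: has_length_cat (len_tt _ ilt) _.
  have [si _] := andP Hi.
  by have := @has_length_seg G (tt i) s si; rewrite Gseg.
have cl := curve_length_unit Glip hlen.
have Gin i s : (i < n)%N -> tt i <= s <= tt i.+1 -> `|G s - z i| <= r i / 4.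
  move=> ilt Hi; rewrite (GE i) // [z i + _]addrC addrK normrZ.
  have /andP[ci0 ci1] := c01 i s; rewrite ger0_norm //.
  by apply: le_trans (zr _ ilt); rewrite ler_piMl.
have nn : 0 <= tt n <= tt n by rewrite lexx tt_ge0.
pose wt u := dist u (boundary Omega) `^ (alpha - 1).
have wt0 s : 0 <= wt s by exact: powR_ge0.
have wtG i s : (i < n)%N -> tt i <= s <= tt i.+1 -> wt (G s) <= (r i / 2) `^ (alpha - 1).
  move=> ilt Hi; have Gs := Gin _ _ ilt Hi; have ri := r0 _ ilt.
  (* If the boundary is empty, [dist] is the infimum of the empty set, which is 0, and the power of
     0 with the nonzero exponent alpha - 1 is 0 as well. *)
  rewrite /wt; have [[b Bb]|B0] := pselect (boundary Omega !=set0); last first.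
    rewrite /dist (_ : boundary Omega = set0) ?image_set0 ?inf0; last first.
      by apply/seteqP; split => // b Bb; apply: B0; exists b.
    by rewrite powR0 ?powR_ge0 // subr_eq0 lt_eqF.
  have dl : r i / 2 <= dist (G s) (boundary Omega).
    apply: lb_le_inf; first by exists `|G s - b|, b.
    move=> _ [v [_ Bv] <-]; rewrite leNgt; apply/negP => Gv; apply: Bv.
    rewrite /interior; apply/nbhs_ballP; exists (r i / 4); rewrite /= ?divr_gt0 // => w.
    rewrite -ball_normE /ball_ /= => vw; apply: (Or _ _ ilt).
    have : `|w - z i| <= `|v - w| + `|G s - v| + `|G s - z i|.
      rewrite [`|v - w|]distrC [`|G s - v|]distrC.
      by rewrite -(subrKA (G s) w) -(subrKA v w); apply: le_trans (ler_normD _ _) _; rewrite lerD2r ler_normD.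
    by move: vw Gv Gs; lra.
  rewrite -opprB !powRN lef_pV2 ?posrE ?powR_gt0 ?divr_gt0 //.
    by rewrite ge0_ler_powR ?nnegrE ?dist_ge0 ?subr_ge0 ?divr_ge0 // ltW.
  by apply: lt_le_trans dl; rewrite divr_gt0.
have LE : fine (curve_length G 0 (tt n)) = tt n by rewrite cl.
have arcE s : 0 <= s <= tt n -> arc_param G 0 (tt n) s = G s.
  move=> s01; rewrite /arc_param; set A := [set _ | _].
  have : A (xget 0 A) by apply: (@xgetPex _ 0 A); exists s; split; [rewrite in_itv|exact: cl].
  by move=> []; rewrite in_itv /= => /cl -> [->].
have Sc : continuous (fun s => \sum_(i < n) c i s *: (z i.+1 - z i)).
  apply: continuous_big; first exact: add_continuous.
  move=> i _ u; apply: cvgZr_tmp.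
  apply: (@continuous_comp R R R (fun s => (s - tt i) / L i) clamp); last exact: continuous_clamp.
  by apply: cvgM; [apply: cvgB; [exact: cvg_id|exact: cvg_cst]|exact: cvg_cst].
have Gcont : continuous G by move=> s; apply: cvgD; [exact: cvg_cst|exact: Sc].
apply: (@le_trans _ _ (len alpha Omega G 0 (tt n))).
  apply: ereal_inf_lbound; exists G, 0, (tt n); split=> //.
  - split; first exact: tt_ge0.
    split; first exact: continuous_subspaceT.
    by rewrite cl // ltry.
  - move=> s; rewrite in_itv /= => sn.
    have [i ilt Hi] := loc s sn.
    apply: (Or _ _ ilt); apply: le_lt_trans (Gin _ _ ilt Hi) _.
    by have := r0 _ ilt; lra.
  - by rewrite -tt0 Gtt.
rewrite /len /line_integral LE.
apply: (@le_trans _ _ (\int[lebesgue_measure]_(s in `[0%R, tt n]) (wt (G s))%:E)%E).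
  apply: le_integral_ge0 => s /=; first by rewrite lee_fin powR_ge0.
  by rewrite in_itv /= => sn; rewrite arcE.
rewrite -{1}tt0.
apply: le_trans (@le_integral_steps (wt \o G) tt (fun i => (r i / 2) `^ (alpha - 1)) n _ _ _ _ _) _ => //.
- by move=> i _; exact: ttm.
- by move=> i _; exact: powR_ge0.
- by move=> s; exact: powR_ge0.
rewrite lee_fin; apply: ler_sum => i _.
have ri := r0 _ (ltn_ord i).
have -> : tt i.+1 - tt i = L i by rewrite ttS addrC addKr.
have Lr : L i <= r i / 2.
  by apply: le_trans (enorm_le _) _; have := zr _ (ltn_ord i); lra.
apply: (@le_trans _ _ ((r i / 2) `^ alpha)).
  by rewrite -(@mulr_powRB1 _ _ alpha) ?divr_ge0 ?(ltW ri) // mulrC ler_wpM2r ?powR_ge0.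
by rewrite ge0_ler_powR ?nnegrE ?(ltW alpha0) ?divr_ge0 ?(ltW ri) //; lra.
Qed.
End Length.

(** * Smooth functions of one variable *)

Section SmoothReal.
Context {R : realType}.
Implicit Types (f g : R -> R) (k : nat).

Fixpoint Ck k f : Prop := if k is k'.+1 then
  exists2 f', (forall x : R, is_derive x 1 f (f' x)) & Ck k' f' else True.

Definition smooth1 f := forall k, Ck k f.

Lemma CkW k f : Ck k.+1 f -> Ck k f.
Proof.
elim: k f => // k IH f [f' df cf']; exists f' => //.
by apply: IH.
Qed.

Lemma Ck_cst k (c : R) : Ck k (fun=> c).
Proof.
elim: k c => // k IH c; exists (fun=> 0) => //.
by move=> x; exact: is_derive_cst.
Qed.

Lemma CkD k f g : Ck k f -> Ck k g -> Ck k (fun x => f x + g x).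
Proof.
elim: k f g => // k IH f g [f' df cf'] [g' dg cg'].
exists (fun x => f' x + g' x); last exact: IH.
by move=> x; exact: is_deriveD.
Qed.

Lemma CkM k f g : Ck k f -> Ck k g -> Ck k (fun x => f x * g x).
Proof.
elim: k f g => // k IH f g Hf Hg.
have [f' df cf'] := Hf; have [g' dg cg'] := Hg.
exists (fun x => f x * g' x + g x * f' x).
  by move=> x; exact: is_deriveM.
by apply: CkD; apply: IH => //; exact: CkW.
Qed.

Lemma is_derive1_compose f g (df dg x : R) : is_derive (g x) 1 f df ->
  is_derive x 1 g dg -> is_derive x 1 (fun y => f (g y)) (df * dg).
Proof.
move=> [f_drvbl f_D] [g_drvbl g_D]; apply: DeriveDef; last first.
  by have := derive1_comp g_drvbl f_drvbl; rewrite !derive1E f_D g_D.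
apply/derivable1_diffP; apply: (@differentiable_comp R R R R g f);
exact/derivable1_diffP.
Qed.

Lemma is_derive1_affine f (a b df x : R) : is_derive (a * x + b) 1 f df ->
  is_derive x 1 (fun x => f (a * x + b)) (a * df).
Proof.
move=> Hf; rewrite mulrC; apply: (@is_derive1_compose f (fun x : R => a * x + b)) => //.
have D1 : is_derive x 1 (fun y : R => a * y) (a * 1) by exact: is_deriveZ.
have D2 : is_derive x 1 (fun y : R => a * y + b) (a * 1 + 0) by exact: is_deriveD.
by rewrite mulr1 addr0 in D2.
Qed.

Lemma Ck_affine k f (a b : R) : Ck k f -> Ck k (fun x => f (a * x + b)).
Proof.
elim: k f => // k IH f [f' df cf'].
exists (fun x => a * f' (a * x + b)); first by move=> x; exact: is_derive1_affine.
by apply: CkM; [exact: Ck_cst|exact: IH].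
Qed.

Lemma CkV k f : (forall x, f x != 0) -> Ck k f -> Ck k (fun x => (f x)^-1).
Proof.
move=> f0; elim: k => // k IH Hf; have [f' df cf'] := Hf.
exists (fun x => -1 * (f' x * ((f x)^-1 * (f x)^-1))).
  move=> x; have [dfx Dfx] := df x.
  apply: DeriveDef; first exact: derivableV.
  by rewrite deriveV // Dfx /GRing.scale /= expr2 invfM mulN1r mulNr mulrC.
have cf : Ck k (fun x => (f x)^-1) by apply: IH; exact: CkW.
by apply: CkM; [exact: Ck_cst|apply: CkM => //; exact: CkM].
Qed.

Lemma smooth1_cst (c : R) : smooth1 (fun=> c).
Proof. by move=> k; exact: Ck_cst. Qed.

Lemma smooth1_id : smooth1 (fun x => x).
Proof.
case=> // k; exists (fun=> 1); last exact: Ck_cst.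
by move=> x; exact: is_derive_id.
Qed.

Lemma smooth1D f g : smooth1 f -> smooth1 g -> smooth1 (fun x => f x + g x).
Proof. by move=> Hf Hg k; exact: CkD. Qed.

Lemma smooth1M f g : smooth1 f -> smooth1 g -> smooth1 (fun x => f x * g x).
Proof. by move=> Hf Hg k; exact: CkM. Qed.

Lemma smooth1Z (c : R) f : smooth1 f -> smooth1 (fun x => c * f x).
Proof. by apply: smooth1M; exact: smooth1_cst. Qed.

Lemma smooth1_affine f (a b : R) : smooth1 f -> smooth1 (fun x => f (a * x + b)).
Proof. by move=> Hf k; exact: Ck_affine. Qed.

Lemma smooth1_subM f (c t : R) : smooth1 f -> smooth1 (fun x => f ((x - c) / t)).
Proof.
move=> /(smooth1_affine t^-1 (- (c / t))); congr smooth1.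
by apply/funext => x; rewrite mulrBl mulrC.
Qed.

Lemma smooth1X f n : smooth1 f -> smooth1 (fun x => f x ^+ n).
Proof.
move=> Hf; elim: n => [|n IHn]; first exact: smooth1_cst.
rewrite (_ : (fun _ => _) = (fun x => f x * f x ^+ n)); first exact: smooth1M.
by apply/funext => x; rewrite exprS.
Qed.

Lemma smooth1_ind (P : (R -> R) -> Prop) :
  (forall f, P f -> exists2 f', (forall x : R, is_derive x 1 f (f' x)) & P f') ->
  forall f, P f -> smooth1 f.
Proof. by move=> step f Pf k; elim: k f Pf => // k IH f /step[f' df /IH]; exists f'. Qed.

Lemma smooth1_derivable f (x : R) : smooth1 f -> derivable f x 1.
Proof. by move=> /(_ 1%N)[f' df _]; case: (df x). Qed.

Lemma smooth1_is_derive f (x : R) : smooth1 f -> is_derive x 1 f (derive1 f x).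
Proof.
by move=> Hf; rewrite derive1E; apply: derivableP; exact: smooth1_derivable.
Qed.

Lemma smooth1_derive1 f : smooth1 f -> smooth1 (derive1 f).
Proof.
move=> Hf k; have [f' df cf'] := Hf k.+1.
suff -> : derive1 f = f' by [].
by apply/funext => x; rewrite derive1E; case: (df x).
Qed.

Lemma smooth1_derive1n f n : smooth1 f -> smooth1 (derive1n n f).
Proof. by move=> Hf; elim: n => // n IHn; rewrite derive1nS; exact: smooth1_derive1. Qed.

Lemma smooth1_continuous f : smooth1 f -> continuous f.
Proof.
move=> Hf x; apply: differentiable_continuous; apply/derivable1_diffP.
exact: smooth1_derivable.
Qed.

Lemma derive1_is f f' : (forall x : R, is_derive x 1 f (f' x)) -> derive1 f = f'.
Proof. by move=> df; apply/funext => x; rewrite derive1E; case: (df x). Qed.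

Lemma derive1DE f g : smooth1 f -> smooth1 g ->
  derive1 (fun x => f x + g x) = (fun x => derive1 f x + derive1 g x).
Proof.
by move=> Hf Hg; apply: derive1_is => x; apply: is_deriveD; exact: smooth1_is_derive.
Qed.

Lemma derive1ME f g : smooth1 f -> smooth1 g ->
  derive1 (fun x => f x * g x) = (fun x => f x * derive1 g x + g x * derive1 f x).
Proof.
move=> Hf Hg; apply: derive1_is => x.
by apply: is_deriveM; exact: smooth1_is_derive.
Qed.

Lemma derive1_affineE f (a b : R) : smooth1 f ->
  derive1 (fun x => f (a * x + b)) = (fun x => a * derive1 f (a * x + b)).
Proof.
by move=> Hf; apply: derive1_is => x; apply: is_derive1_affine; exact: smooth1_is_derive.
Qed.

Lemma pow_le_expR n (y : R) : 0 <= y -> y ^+ n <= n`!%:R * expR y.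
Proof.
case: n => [|n] y0.
  by rewrite expr0 fact0 mul1r; apply: le_trans (expR_ge1Dx y); rewrite lerDl.
rewrite -ler_pdivrMl ?ltr0n ?fact_gt0 // mulrC.
by apply: le_trans (expR_ge1Dxn n y0); rewrite lerDr.
Qed.

Lemma poly_exp_bound (p : {poly R}) : exists2 C, 0 <= C &
  forall y : R, 0 <= y -> `|p.[y]| <= C * expR y.
Proof.
exists (\sum_(i < size p) `|p`_i| * i`!%:R) => [|y y0].
  by apply: sumr_ge0 => i _; rewrite mulr_ge0.
rewrite horner_coef mulr_suml; apply: le_trans (ler_norm_sum _ _ _) _.
apply: ler_sum => i _; rewrite normrM -mulrA ler_wpM2l //.
by rewrite ger0_norm ?exprn_ge0 // pow_le_expR.
Qed.

(** The functions p(1/x) exp(-1/x), extended by 0, form a family closed under derivation, whence the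
    smoothness of exp(-1/x). *)
Definition flat (p : {poly R}) (x : R) : R :=
  if 0 < x then p.[x^-1] * expR (- x^-1) else 0.

(** The exponential dominates p(y) y^2 at y = 1/x. The quadratic order in x makes the derivative at
    0 vanish. *)
Lemma flat_bound (p : {poly R}) : exists2 C, 0 <= C & forall x, `|flat p x| <= C * x ^+ 2.
Proof.
have [C C0 HC] := poly_exp_bound (p * 'X^2).
exists C => // x; rewrite /flat; case: ifP => x0; last first.
  by rewrite normr0 mulr_ge0 // sqr_ge0.
have y0 : 0 <= x^-1 by rewrite invr_ge0 ltW.
have := HC _ y0; rewrite hornerM hornerXn normrM [`|_ ^+ 2|]ger0_norm ?sqr_ge0 //.
rewrite exprVn ler_pdivrMr ?exprn_gt0 // => H.
rewrite normrM [`|expR _|]ger0_norm ?expR_ge0 // expRN.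
by rewrite ler_pdivrMr ?expR_gt0 // mulrAC.
Qed.

Lemma is_derive_flat (p : {poly R}) (x : R) :
  is_derive x 1 (flat p) (flat ('X^2 * (p - p^`())%R) x).
Proof.
have [x0|x0|x0] := ltgtP x 0.
- rewrite [X in is_derive _ _ _ X]/flat ltNge (ltW x0) /=.
  apply: (near_eq_is_derive _ (is_derive_cst (0 : R) x 1)) => //.
  near=> y; rewrite /flat ltNge ifF //; apply/negbTE; rewrite negbK ltW //.
  by near: y; exact: lt_nbhsl.
- have xn0 : x != 0 by rewrite gt_eqF.
  have Dinv : is_derive x 1 (fun y : R => y^-1) (- (x^-1 * x^-1)).
    apply: DeriveDef; first exact: derivableV.
    by rewrite deriveV // derive_id /GRing.scale /= mulr1 expr2 invfM.
  have Dp : is_derive x 1 (fun y => p.[y^-1]) (p^`().[x^-1] * - (x^-1 * x^-1)).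
    by apply: (@is_derive1_compose (horner p) (fun y : R => y^-1)).
  have De : is_derive x 1 (fun y => expR (- y^-1)) (expR (- x^-1) * (x^-1 * x^-1)).
    apply: (@is_derive1_compose expR (fun y : R => - y^-1)).
    by rewrite -[X in is_derive _ _ _ X]opprK; exact: is_deriveN.
  have D : is_derive x 1 (fun y : R => p.[y^-1] * expR (- y^-1))
     (p.[x^-1] * (expR (- x^-1) * (x^-1 * x^-1))
      + expR (- x^-1) * (p^`().[x^-1] * - (x^-1 * x^-1))) by exact: is_deriveM.
  have {D} : is_derive x 1 (flat p) (p.[x^-1] * (expR (- x^-1) * (x^-1 * x^-1))
      + expR (- x^-1) * (p^`().[x^-1] * - (x^-1 * x^-1))).
    apply: near_eq_is_derive D.
    by near=> y; rewrite /flat ifT //; near: y; exact: lt_nbhsr.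
  congr is_derive; rewrite /flat x0 hornerM hornerXn hornerD hornerN expr2.
  by ring.
- subst x; rewrite [X in is_derive _ _ _ X]/flat ltxx.
  have [C C0 HC] := flat_bound p.
  have F0 : flat p 0 = 0 by rewrite /flat ltxx.
  have L : h^-1 *: ((flat p \o shift 0) (h *: 1) - flat p 0) @[h --> 0^'] --> (0 : R).
    apply/cvgrPdist_lt => e e0; near=> h.
    rewrite /= F0 subr0 sub0r normrN addr0 {1}/GRing.scale /= normrM normfV.
    have h0 : h != 0 by near: h; exact: nbhs_dnbhs_neq.
    rewrite mulrC ltr_pdivrMr ?normr_gt0 //.
    rewrite {1}/GRing.scale /= mulr1; apply: le_lt_trans (HC _) _.
    rewrite -[h ^+ 2]ger0_norm ?sqr_ge0 // normrX expr2 mulrA ltr_pM2r ?normr_gt0 //.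
    apply: (@le_lt_trans _ _ ((C + 1) * `|h|)); first by rewrite ler_wpM2r // lerDl.
    rewrite mulrC -ltr_pdivlMr ?ltr_wpDl //.
    near: h; apply: dnbhs0_lt; by rewrite divr_gt0 // ltr_wpDl.
  apply: DeriveDef; first by apply/cvg_ex; exists 0.
  exact: cvg_lim L.
Unshelve. all: by end_near. Qed.

Lemma smooth1_flat (p : {poly R}) : smooth1 (flat p).
Proof.
apply: (@smooth1_ind (fun f => exists p : {poly R}, f = flat p)); last by exists p.
move=> _ [q ->]; exists (flat ('X^2 * (q - q^`())%R)); last by eexists.
exact: is_derive_flat.
Qed.

Definition smooth_step (x : R) : R :=
  flat 1 x / (flat 1 x + flat 1 (-1 * x + 1)).

Lemma flat1_gt0 (x : R) : 0 < x -> 0 < flat 1 x.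
Proof. by move=> x0; rewrite /flat x0 hornerC mul1r expR_gt0. Qed.

Lemma flat1_ge0 (x : R) : 0 <= flat 1 x.
Proof.
rewrite /flat; case: ifP => // _; by rewrite hornerC mul1r expR_ge0.
Qed.

Lemma smooth_step_den (x : R) : 0 < flat 1 x + flat 1 (-1 * x + 1).
Proof.
have [x0|x0] := ltrP 0 x; first by rewrite ltr_wpDr ?flat1_ge0 ?flat1_gt0.
by rewrite ltr_wpDl ?flat1_ge0 ?flat1_gt0 //; lra.
Qed.

Lemma smooth1_step : smooth1 smooth_step.
Proof.
apply: smooth1M; first exact: smooth1_flat.
move=> k; apply: CkV => [x|]; first by rewrite gt_eqF ?smooth_step_den.
apply: CkD; first exact: smooth1_flat.
exact/Ck_affine/smooth1_flat.
Qed.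

Lemma smooth_step01 (x : R) : 0 <= smooth_step x <= 1.
Proof.
rewrite divr_ge0 ?flat1_ge0 ?(ltW (smooth_step_den _)) //=.
by rewrite ler_pdivrMr ?smooth_step_den // mul1r lerDl flat1_ge0.
Qed.

Lemma smooth_step_le0 (x : R) : x <= 0 -> smooth_step x = 0.
Proof. by move=> x0; rewrite /smooth_step {1}/flat ltNge x0 mul0r. Qed.

Lemma smooth_step_ge1 (x : R) : 1 <= x -> smooth_step x = 1.
Proof.
move=> x1; have x0 : 0 < x by apply: lt_le_trans x1.
rewrite /smooth_step [flat 1 (_ + _)]/flat ifF; last by apply/negbTE; rewrite -leNgt; lra.
by rewrite addr0 divff // gt_eqF // flat1_gt0.
Qed.

(** The transition runs between 5/4 and 7/4 rather than between 1 and 2: the cut-off of a cube is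
    then locally constant at each point of the closed cube and at each point outside the open double
    cube. *)
Definition plateau (x : R) : R :=
  smooth_step (2 * x + 7 / 2) * smooth_step (-2 * x + 7 / 2).

Lemma smooth1_plateau : smooth1 plateau.
Proof. by apply: smooth1M; exact/smooth1_affine/smooth1_step. Qed.

Lemma plateau1 x : `|x| <= 5 / 4 -> plateau x = 1.
Proof.
rewrite ler_norml => /andP[x0 x1].
by rewrite /plateau !smooth_step_ge1 ?mulr1 //; lra.
Qed.

Lemma plateau0 x : 7 / 4 <= `|x| -> plateau x = 0.
Proof.
rewrite ler_normr => /orP[] x0; rewrite /plateau.
  by rewrite [X in _ * X]smooth_step_le0 ?mulr0 //; lra.
by rewrite smooth_step_le0 ?mul0r //; lra.
Qed.

End SmoothReal.

(** * Integration over the plane *)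

Section PlaneMeasure.
Context {R : realType}.
Implicit Types (z c : R * R) (A K Omega : set (R * R)) (g : R * R -> R).
Local Notation mu2 := (@lebesgue2 R).

Definition cube c (r : R) : set (R * R) := [set z | `|z - c| <= r].

Lemma cubeE c r : cube c r =
  `[c.1 - r, c.1 + r]%classic `*` `[c.2 - r, c.2 + r]%classic.
Proof.
apply/seteqP; split => z; rewrite /cube /= norm2_le /= !ler_norml !in_itv /=.
  by move=> /andP[/andP[? ?] /andP[? ?]]; split; lra.
by move=> [? ?]; lra.
Qed.

Lemma compact_cube c r : compact (cube c r).
Proof. by rewrite cubeE; apply: compact_setX; exact: segment_compact. Qed.

Lemma measurable_cube c r : measurable (cube c r : set (R * R)).
Proof. by rewrite cubeE; apply: measurableX. Qed.

Lemma lebesgue_segment (a b : R) : a <= b -> lebesgue_measure (`[a, b]%classic : set R) = (b - a)%:E.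
Proof.
rewrite lebesgue_measure_itv /= lte_fin le_eqVlt => /predU1P[->|ab].
  by rewrite ltxx subrr.
by rewrite ab EFinB.
Qed.

Lemma mu2_cube c r : 0 <= r -> mu2 (cube c r) = ((2 * r) ^+ 2)%:E.
Proof.
move=> r0; rewrite cubeE /lebesgue2 product_measure1E //.
transitivity ((2 * r)%:E * (2 * r)%:E)%E; last by rewrite -EFinM expr2.
by congr (_ * _)%E; rewrite [LHS]lebesgue_segment; [congr EFin; ring|lra|congr EFin; ring|lra].
Qed.

Lemma open_measurable2 A : open A -> measurable (A : set (R * R)).
Proof.
move=> oA.
pose ctr (q : rat * rat * rat) : R * R := (ratr q.1.1, ratr q.1.2).
pose D q := if `[< cube (ctr q) (ratr q.2) `<=` A >] then cube (ctr q) (ratr q.2) else set0.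
have -> : A = \bigcup_q D q.
  apply/seteqP; split => [z Az|z [q _]]; last first.
    by rewrite /D; case: asboolP => // DA; exact: DA.
  have /nbhs_ballP[e /= e0 eA] : nbhs z A by apply: open_nbhs_nbhs.
  have approx (x d : R) : 0 < d -> exists q : rat, `|ratr q - x| < d.
    move=> d0; have [|q] := @rat_in_itvoo R (x - d) (x + d); first lra.
    by rewrite in_itv /= => /andP[? ?]; exists q; rewrite ltr_norml; lra.
  have e8 : 0 < e / 8 by rewrite divr_gt0.
  (* The radius lies between e / 4 and e / 2: above the error e / 8 of the centre, and small enough
     for the cube to stay in the ball of radius e. *)
  have [q0] := approx (3 * e / 8) _ e8; rewrite ltr_norml => /andP[q0l q0r].
  have [q1 q1e] := approx z.1 _ e8; have [q2 q2e] := approx z.2 _ e8.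
  have zc : `|z - ctr (q1, q2, q0)| < e / 8.
    by rewrite distrC norm2_lt /= q1e q2e.
  exists (q1, q2, q0) => //; rewrite /D; case: asboolP => [_|[]].
    by rewrite /cube /=; move: zc q0l; rewrite /ctr /=; lra.
  move=> w; rewrite /cube /= => wc; apply: eA; rewrite -ball_normE /ball_ /=.
  rewrite -(subrKA (ctr (q1, q2, q0))); apply: le_lt_trans (ler_normD _ _) _.
  by rewrite [`|_ - w|]distrC; move: zc wc; rewrite /ctr /=; lra.
apply: countable_bigcupT_measurable => [|q]; first exact: countableP.
by rewrite /D; case: asboolP => _; [exact: measurable_cube|exact: measurable0].
Qed.

Lemma closed_measurable2 A : closed A -> measurable (A : set (R * R)).
Proof. by move/closed_openC/open_measurable2/measurableC; rewrite setCK. Qed.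

Lemma compact_measurable2 A : compact A -> measurable (A : set (R * R)).
Proof.
move/compact_closed => H; apply: closed_measurable2; apply: H.
exact: norm_hausdorff.
Qed.

Lemma compact_sub_cube K : compact K -> exists2 r, 0 < r & K `<=` cube 0 r.
Proof.
move=> /compact_bounded [M [_ HM]]; exists (`|M| + 1); first by rewrite ltr_wpDl.
move=> z Kz; rewrite /cube /= subr0; apply: (HM (`|M| + 1)) => //.
by apply: le_lt_trans (ler_norm _) _; rewrite ltrDl.
Qed.

Lemma measurable_fun_open_continuous Omega g : open Omega ->
  (forall z, Omega z -> {for z, continuous g}) -> measurable_fun Omega g.
Proof.
move=> oO gc mO; apply: (measurability _ (RGenOpens.measurableE R)) => //.
move=> _ [_ [a [b ->]] <-]; apply: open_measurable2.
rewrite openE => z /= [Oz gz].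
have /gc := Oz; move/(_ _ (open_nbhs_nbhs (conj (interval_open _ _) gz))).
rewrite /interior => H; apply: filterI; first exact: open_nbhs_nbhs.
by apply: H.
Qed.

Lemma loc_integrable_continuous Omega g : open Omega ->
  (forall z, Omega z -> {for z, continuous g}) -> loc_integrable Omega g.
Proof.
move=> oO gc; have mg := measurable_fun_open_continuous oO gc.
split=> // K cK KO; have [r r0 Kr] := compact_sub_cube cK.
have mK := compact_measurable2 cK.
have [[z0 Kz0]|K0] := pselect (K !=set0); last first.
  have -> : K = set0 by apply/seteqP; split => // z Kz; apply: K0; exists z.
  by rewrite integral_set0 ltry.
have [c _ cmax] : exists2 c, c \in K & forall z, z \in K -> `|g z| <= `|g c|.
  apply: (@compact_EVT_max _ _ (fun z => `|g z|)) => //; first by exists z0.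
  apply: continuous_in_subspaceT => z /set_mem /KO /gc gz.
  exact: cvg_norm.
apply: (@le_lt_trans _ _ (\int[mu2]_(z in cube 0%R r) (cst (`|g c|)%:E z))%E).
  apply: (@le_trans _ _ (\int[mu2]_(z in K) (cst (`|g c|)%:E z))%E).
    apply: le_integral_ge0 => z Kz; first by rewrite lee_fin.
    by rewrite lee_fin cmax // mem_set.
  apply: ge0_subset_integral => //; first exact: measurable_cube.
  by move=> z _; rewrite lee_fin.
rewrite integral_cst; last exact: measurable_cube.
by rewrite [X in (_ * X)%E]mu2_cube ?(ltW r0) // -EFinM ltry.
Qed.

Lemma integrable_cube g c r (M : R) : 0 <= r -> measurable_fun setT g ->
  (forall z, `|g z| <= M) -> (forall z, ~ cube c r z -> g z = 0) ->
  mu2.-integrable setT (EFin \o g).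
Proof.
move=> r0 mg gM g0; have M0 : 0 <= M by apply: le_trans (gM 0).
apply/integrableP; split; first exact/measurable_EFinP.
apply: (@le_lt_trans _ _ (\int[mu2]_(z in cube c r) (cst M%:E z))%E).
  rewrite [leRHS]integral_mkcond.
  apply: le_integral_ge0 => z _; first exact: abse_ge0.
  rewrite /patch; case: ifPn => [_|]; first by rewrite /= lee_fin.
  by move=> /negP zc; rewrite /= g0 ?normr0 // => ?; apply: zc; apply: mem_set.
rewrite integral_cst; last exact: measurable_cube.
by rewrite [X in (_ * X)%E]mu2_cube // -EFinM ltry.
Qed.

Lemma integrable_continuous_compact g r : continuous g ->
  (forall z, ~ cube 0 r z -> g z = 0) -> mu2.-integrable setT (EFin \o g).
Proof.
move=> gc g0.
have mg : measurable_fun setT g by apply: measurable_fun_open_continuous => [|z _]; [exact: openT|exact: gc].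
pose r' := Num.max r 0.
have r'0 : 0 <= r' by rewrite /r' le_max lexx orbT.
have g0' z : ~ cube 0 r' z -> g z = 0.
  by move=> nz; apply: g0; rewrite /cube /= => zr; apply: nz; rewrite /cube /= /r' le_max zr.
have [c _ cmax] : exists2 c, c \in cube 0 r' & forall z, z \in cube 0 r' -> `|g z| <= `|g c|.
  apply: (@compact_EVT_max _ _ (fun z => `|g z|)).
  - by exists 0; rewrite /cube /= subrr normr0.
  - exact: compact_cube.
  - by apply: continuous_subspaceT => z; apply: cvg_norm; exact: gc.
apply: (@integrable_cube g 0 r' `|g c|) => // z.
have [zr|/g0' ->] := pselect (cube 0 r' z); last by rewrite normr0.
by apply: cmax; exact: mem_set.
Qed.

End PlaneMeasure.

(** * Partial derivatives of tensor sums *)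

Section PlaneDerivatives.
Context {R : realType}.
Implicit Types (z : R * R) (f g h phi G : R * R -> R) (Omega : set (R * R)).
Local Notation mu2 := (@lebesgue2 R).

(* Tensor sums are stable under products and partial derivatives, which reduces
   smoothness in the plane to one variable. *)
Inductive TS : (R * R -> R) -> Prop :=
| TS_mul a b : smooth1 a -> smooth1 b -> TS (fun z => a z.1 * b z.2)
| TS_add f g : TS f -> TS g -> TS (fun z => f z + g z).

Lemma quotient_line1 f z :
  (fun h : R => h^-1 *: ((f \o shift z) (h *: ((1, 0) : R * R)) - f z)) =
  (fun h : R => h^-1 *: (((fun t => f (t, z.2)) \o shift z.1) (h *: (1 : R)) - f (z.1, z.2))).
Proof.
apply/funext => h /=; case: z => x y /=; congr (_ *: (f _ - _)).
have -> : h *: ((1, 0) : R * R) + (x, y) = (h * 1 + x, h * 0 + y) by [].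
by rewrite mulr0 add0r.
Qed.

Lemma quotient_line2 f z :
  (fun h : R => h^-1 *: ((f \o shift z) (h *: ((0, 1) : R * R)) - f z)) =
  (fun h : R => h^-1 *: (((fun t => f (z.1, t)) \o shift z.2) (h *: (1 : R)) - f (z.1, z.2))).
Proof.
apply/funext => h /=; case: z => x y /=; congr (_ *: (f _ - _)).
have -> : h *: ((0, 1) : R * R) + (x, y) = (h * 0 + x, h * 1 + y) by [].
by rewrite mulr0 add0r.
Qed.

Lemma pd1_line f z : pd1 f z = derive1 (fun t : R => f (t, z.2)) z.1.
Proof. by rewrite /pd1 derive1E /derive quotient_line1. Qed.

Lemma pd2_line f z : pd2 f z = derive1 (fun t : R => f (z.1, t)) z.2.
Proof. by rewrite /pd2 derive1E /derive quotient_line2. Qed.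

Lemma derivable_line1 f z : derivable f z (1, 0) ->
  derivable (fun t : R => f (t, z.2)) z.1 1.
Proof. by rewrite /derivable quotient_line1. Qed.

Lemma derivable_line2 f z : derivable f z (0, 1) ->
  derivable (fun t : R => f (z.1, t)) z.2 1.
Proof. by rewrite /derivable quotient_line2. Qed.

Lemma TS_smooth1_line1 f y : TS f -> smooth1 (fun t => f (t, y)).
Proof.
elim=> [a b Ha Hb|{}f g _ Hf _ Hg] /=; last exact: smooth1D.
by apply: smooth1M => //; exact: smooth1_cst.
Qed.

Lemma TS_smooth1_line2 f x : TS f -> smooth1 (fun t => f (x, t)).
Proof.
elim=> [a b Ha Hb|{}f g _ Hf _ Hg] /=; last exact: smooth1D.
by apply: smooth1M => //; exact: smooth1_cst.
Qed.

Lemma pd1_tensor (a b : R -> R) : smooth1 a ->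
  pd1 (fun z => a z.1 * b z.2) = (fun z => derive1 a z.1 * b z.2).
Proof.
move=> Ha; apply/funext => z; rewrite pd1_line /=.
rewrite (@derive1ME _ a (fun=> b z.2)) //; last exact: smooth1_cst.
by rewrite derive1_cst mulr0 add0r mulrC.
Qed.

Lemma pd2_tensor (a b : R -> R) : smooth1 b ->
  pd2 (fun z => a z.1 * b z.2) = (fun z => a z.1 * derive1 b z.2).
Proof.
move=> Hb; apply/funext => z; rewrite pd2_line /=.
rewrite (@derive1ME _ (fun=> a z.1) b) //; last exact: smooth1_cst.
by rewrite derive1_cst mulr0 addr0.
Qed.

Lemma pd1D f g : TS f -> TS g -> pd1 (fun z => f z + g z) = (fun z => pd1 f z + pd1 g z).
Proof.
move=> Hf Hg; apply/funext => z; rewrite !pd1_line.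
by rewrite (derive1DE (TS_smooth1_line1 z.2 Hf) (TS_smooth1_line1 z.2 Hg)).
Qed.

Lemma pd2D f g : TS f -> TS g -> pd2 (fun z => f z + g z) = (fun z => pd2 f z + pd2 g z).
Proof.
move=> Hf Hg; apply/funext => z; rewrite !pd2_line.
by rewrite (derive1DE (TS_smooth1_line2 z.1 Hf) (TS_smooth1_line2 z.1 Hg)).
Qed.

Lemma TS_pd1 f : TS f -> TS (pd1 f).
Proof.
elim=> [a b Ha Hb|{}f g Hf Hf' Hg Hg'].
  by rewrite pd1_tensor //; apply: TS_mul => //; exact: smooth1_derive1.
by rewrite pd1D //; exact: TS_add.
Qed.

Lemma TS_pd2 f : TS f -> TS (pd2 f).
Proof.
elim=> [a b Ha Hb|{}f g Hf Hf' Hg Hg'].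
  by rewrite pd2_tensor //; apply: TS_mul => //; exact: smooth1_derive1.
by rewrite pd2D //; exact: TS_add.
Qed.

Lemma TS_cst (c : R) : TS (fun=> c).
Proof.
have -> : (fun=> c) = (fun z : R * R => (fun=> c) z.1 * (fun=> 1) z.2) by apply/funext => z; rewrite mulr1.
exact: (TS_mul (smooth1_cst c) (smooth1_cst 1)).
Qed.

Lemma TS_M f g : TS f -> TS g -> TS (fun z => f z * g z).
Proof.
move=> Hf; elim: Hf g => [a b Ha Hb|{}f f' _ IH _ IH'] g Hg.
  elim: Hg => [a' b' Ha' Hb'|{}g g' _ IHg _ IHg'].
    have -> : (fun z : R * R => a z.1 * b z.2 * (a' z.1 * b' z.2)) =
      (fun z => (fun t => a t * a' t) z.1 * (fun t => b t * b' t) z.2).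
      by apply/funext => z; rewrite mulrACA.
    exact: (TS_mul (smooth1M Ha Ha') (smooth1M Hb Hb')).
  have -> : (fun z : R * R => a z.1 * b z.2 * (g z + g' z)) =
     (fun z => a z.1 * b z.2 * g z + a z.1 * b z.2 * g' z).
    by apply/funext => z; rewrite mulrDr.
  exact: TS_add.
have -> : (fun z => (f z + f' z) * g z) = (fun z => f z * g z + f' z * g z).
  by apply/funext => z; rewrite mulrDl.
by apply: TS_add; [exact: IH|exact: IH'].
Qed.

Lemma TS_sum (I : Type) (r : seq I) (P : pred I) (F : I -> R * R -> R) :
  (forall i, P i -> TS (F i)) -> TS (fun z => \sum_(i <- r | P i) F i z).
Proof.
move=> HF; elim: r => [|i r IHr].
  by rewrite (_ : (fun _ => _) = (fun=> 0)); [exact: TS_cst|apply/funext => z; rewrite big_nil].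
have [Pi|Pi] := boolP (P i); last first.
  by rewrite (_ : (fun _ => _) = (fun z => \sum_(i <- r | P i) F i z)) //; apply/funext => z; rewrite big_cons (negbTE Pi).
rewrite (_ : (fun _ => _) = (fun z => F i z + \sum_(i <- r | P i) F i z)); last first.
  by apply/funext => z; rewrite big_cons Pi.
by apply: TS_add => //; exact: HF.
Qed.

Lemma TS_differentiable f z : TS f -> differentiable f z.
Proof.
elim=> [a b Ha Hb|{}f g _ Hf _ Hg]; last exact: differentiableD.
apply: (@differentiableM _ _ (fun z : R * R => a z.1) (fun z : R * R => b z.2)).
  apply: (@differentiable_comp _ _ _ _ fst a).
    by apply: (@linear_differentiable R (R * R)%type R fst) => w; exact: cvg_fst.
  exact/derivable1_diffP/smooth1_derivable.
apply: (@differentiable_comp _ _ _ _ snd b).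
  by apply: (@linear_differentiable R (R * R)%type R snd) => w; exact: cvg_snd.
exact/derivable1_diffP/smooth1_derivable.
Qed.

Lemma TS_smooth f : TS f -> smooth f.
Proof.
move=> Hf w z; apply: TS_differentiable.
by elim: w => [|[] w IHw] //=; [exact: TS_pd1|exact: TS_pd2].
Qed.

Lemma TS_continuous f : TS f -> continuous f.
Proof. by move=> Hf z; apply: differentiable_continuous; exact: TS_differentiable. Qed.

(** The barriers are tensor sums only locally: the indicator of a component is constant near each
    point, not globally. *)
Definition locTS Omega f := forall z, Omega z ->
  exists2 G, TS G & \forall w \near z, f w = G w.

Lemma pd1_near f g z : (\forall w \near z, f w = g w) -> pd1 f z = pd1 g z.
Proof. exact: near_eq_derive. Qed.

Lemma pd2_near f g z : (\forall w \near z, f w = g w) -> pd2 f z = pd2 g z.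
Proof. exact: near_eq_derive. Qed.

Lemma locTS_pd1 Omega f : locTS Omega f -> locTS Omega (pd1 f).
Proof.
move=> Hf z /Hf[G HG fG]; exists (pd1 G); first exact: TS_pd1.
move/near_join: fG; apply: filterS => w; exact: pd1_near.
Qed.

Lemma locTS_pd2 Omega f : locTS Omega f -> locTS Omega (pd2 f).
Proof.
move=> Hf z /Hf[G HG fG]; exists (pd2 G); first exact: TS_pd2.
move/near_join: fG; apply: filterS => w; exact: pd2_near.
Qed.

Lemma locTS_continuous Omega f z : locTS Omega f -> Omega z -> {for z, continuous f}.
Proof.
move=> Hf /Hf[G HG fG]; apply: (cvg_trans (near_eq_cvg _)).
  by move: fG; apply: filterS => w ->.
by rewrite (nbhs_singleton fG); exact: TS_continuous.
Qed.

Lemma locTS_derivable Omega f z v : locTS Omega f -> Omega z -> derivable f z v.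
Proof.
move=> Hf /Hf[G HG fG]; apply: near_eq_derivable (diff_derivable (TS_differentiable z HG)).
by apply: filterS fG.
Qed.

End PlaneDerivatives.

(** * Integration by parts against test functions *)

Section IntegrationByParts.
Context {R : realType}.
Implicit Types (z : R * R) (f g h phi psi : R * R -> R) (Omega : set (R * R)).
Local Notation mu2 := (@lebesgue2 R).

Lemma int_derive1_eq0 (g : R -> R) (r : R) : 0 < r -> (forall x : R, derivable g x 1) ->
  continuous (derive1 g) -> (forall x, r <= `|x| -> g x = 0) ->
  (forall x, r <= `|x| -> derive1 g x = 0) ->
  (\int[lebesgue_measure]_x (derive1 g x)%:E = 0)%E.
Proof.
move=> r0 dg cg g0 dg0.
have gc x : {for x, continuous g}.
  by apply: differentiable_continuous; apply/derivable1_diffP.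
have rr : r <= `|r| by rewrite ler_norm.
have -> : (\int[lebesgue_measure]_x (derive1 g x)%:E =
    \int[lebesgue_measure]_(x in `[(- r)%R, r]) (derive1 g x)%:E)%E.
  rewrite [RHS]integral_mkcond; apply: eq_integral => x _; rewrite /patch.
  case: ifPn => //; rewrite notin_setE /= in_itv /= => /negP xr.
  by rewrite dg0 // leNgt ltr_norml; apply: contra xr => /andP[? ?]; rewrite !ltW.
rewrite (@continuous_FTC2 _ (derive1 g) g).
- by rewrite !g0 ?normrN // -EFinB subrr.
- by rewrite gtrN.
- exact: continuous_subspaceT.
- by split=> [x _ //||]; [exact: (cvg_at_right_filter (gc (- r)))|exact: (cvg_at_left_filter (gc r))].
- by [].
Qed.

Lemma near_notin_support phi z : ~ Defs.support phi z -> \forall w \near z, phi w = 0.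
Proof.
move=> nz; have oS : open (~` Defs.support phi) by apply: closed_openC; exact: closed_closure.
apply: filterS (open_nbhs_nbhs (conj oS nz)) => w nw.
apply: contrapT => phiw; apply: nw; apply: subset_closure => /=; exact/eqP.
Qed.

Lemma notin_support0 phi z : ~ Defs.support phi z -> phi z = 0.
Proof. by move=> nz; exact: (nbhs_singleton (near_notin_support nz)). Qed.

Lemma pd1_cst (c : R) z : pd1 (fun=> c) z = 0.
Proof. exact: derive_cst. Qed.

Lemma pd2_cst (c : R) z : pd2 (fun=> c) z = 0.
Proof. exact: derive_cst. Qed.

Lemma pd1_notin_support phi z : ~ Defs.support phi z -> pd1 phi z = 0.
Proof. by move=> /near_notin_support/pd1_near ->; exact: pd1_cst. Qed.

Lemma pd2_notin_support phi z : ~ Defs.support phi z -> pd2 phi z = 0.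
Proof. by move=> /near_notin_support/pd2_near ->; exact: pd2_cst. Qed.

Lemma test_pd1 Omega phi : test_function Omega phi -> test_function Omega (pd1 phi).
Proof.
move=> [sphi cs sO].
have sub : Defs.support (pd1 phi) `<=` Defs.support phi.
  rewrite [X in _ `<=` X](closure_id _).1; last exact: closed_closure.
  apply: closureS => z /= /eqP z0; apply: contrapT => nz; apply: z0.
  exact: pd1_notin_support.
split; last exact: subset_trans sub sO.
- by move=> w z; have := sphi (rcons w true) z; rewrite -cats1 foldr_cat.
- by apply: subclosed_compact sub => //; exact: closed_closure.
Qed.

Lemma test_pd2 Omega phi : test_function Omega phi -> test_function Omega (pd2 phi).
Proof.
move=> [sphi cs sO].
have sub : Defs.support (pd2 phi) `<=` Defs.support phi.
  rewrite [X in _ `<=` X](closure_id _).1; last exact: closed_closure.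
  apply: closureS => z /= /eqP z0; apply: contrapT => nz; apply: z0.
  exact: pd2_notin_support.
split; last exact: subset_trans sub sO.
- by move=> w z; have := sphi (rcons w false) z; rewrite -cats1 foldr_cat.
- by apply: subclosed_compact sub => //; exact: closed_closure.
Qed.

Lemma test_pd Omega phi i j : test_function Omega phi -> test_function Omega (pd i j phi).
Proof.
move=> H; rewrite /pd; elim: i => [|i IHi] /=; last exact: test_pd1.
by elim: j => [|j IHj] //=; exact: test_pd2.
Qed.

Lemma test_continuous Omega phi : test_function Omega phi -> continuous phi.
Proof. by move=> [sphi _ _] z; apply: differentiable_continuous; exact: (sphi [::]). Qed.

Lemma test_derivable Omega phi z v : test_function Omega phi -> derivable phi z v.
Proof. by move=> [sphi _ _]; apply: diff_derivable; exact: (sphi [::]). Qed.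

Lemma test_sub_cube Omega phi : test_function Omega phi ->
  exists2 r, 0 < r & forall z, ~ cube 0 r z -> ~ Defs.support phi z.
Proof.
move=> [_ /compact_sub_cube[r r0 Kr] _]; exists r => // z nz; apply: contra_not nz.
exact: Kr.
Qed.

Lemma int_pd1_eq0 h (r : R) : 0 < r -> (forall z, derivable h z (1, 0)) ->
  continuous (pd1 h) -> (forall z, ~ cube 0 r z -> h z = 0 /\ pd1 h z = 0) ->
  (\int[mu2]_z (pd1 h z)%:E = 0)%E.
Proof.
move=> r0 dh cp h0.
have ip : mu2.-integrable setT (EFin \o pd1 h).
  by apply: integrable_continuous_compact cp _ => z /h0[].
rewrite -(integral21_prod_meas1 ip) integral0_eq // => y _.
rewrite /fubini_G /=; under eq_integral do rewrite pd1_line /=.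
have out x : r + 1 <= `|x| -> ~ cube 0 r (x, y).
  by move=> xr; rewrite /cube /= subr0 norm2_le /= => /andP[? _]; lra.
apply: (@int_derive1_eq0 (fun t => h (t, y)) (r + 1)).
- by rewrite addr_gt0.
- by move=> x; exact: (derivable_line1 (dh (x, y))).
- move=> x; have -> : derive1 (fun t => h (t, y)) = pd1 h \o (fun t => (t, y)).
    by apply/funext => t /=; rewrite pd1_line.
  apply: continuous_comp; last exact: cp.
  by apply: (@continuous_pair R R R id (fun=> y)) => t; [exact: cvg_id|exact: cvg_cst].
- by move=> x /out/h0[].
- by move=> x /out/h0[_]; rewrite pd1_line.
Qed.

Lemma int_pd2_eq0 h (r : R) : 0 < r -> (forall z, derivable h z (0, 1)) ->
  continuous (pd2 h) -> (forall z, ~ cube 0 r z -> h z = 0 /\ pd2 h z = 0) ->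
  (\int[mu2]_z (pd2 h z)%:E = 0)%E.
Proof.
move=> r0 dh cp h0.
have ip : mu2.-integrable setT (EFin \o pd2 h).
  by apply: integrable_continuous_compact cp _ => z /h0[].
rewrite -(integral12_prod_meas1 ip) integral0_eq // => x _.
rewrite /fubini_F /=; under eq_integral do rewrite pd2_line /=.
have out y : r + 1 <= `|y| -> ~ cube 0 r (x, y).
  by move=> xr; rewrite /cube /= subr0 norm2_le /= => /andP[_ ?]; lra.
apply: (@int_derive1_eq0 (fun t => h (x, t)) (r + 1)).
- by rewrite addr_gt0.
- by move=> y; exact: (derivable_line2 (dh (x, y))).
- move=> y; have -> : derive1 (fun t => h (x, t)) = pd2 h \o (fun t => (x, t)).
    by apply/funext => t /=; rewrite pd2_line.
  apply: continuous_comp; last exact: cp.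
  by apply: (@continuous_pair R R R (fun=> x) id) => t; [exact: cvg_cst|exact: cvg_id].
- by move=> y /out/h0[].
- by move=> y /out/h0[_]; rewrite pd2_line.
Qed.

Lemma continuous_near f g z : (\forall w \near z, f w = g w) ->
  {for z, continuous g} -> {for z, continuous f}.
Proof.
move=> fg gc; apply: (cvg_trans (near_eq_cvg _)).
  by move: fg; apply: filterS => w ->.
by rewrite (nbhs_singleton fg); exact: gc.
Qed.

Lemma mul_test_continuous Omega f phi : locTS Omega f -> test_function Omega phi ->
  continuous (fun z => f z * phi z).
Proof.
move=> Hf tphi z; have [Sz|nSz] := pselect (Defs.support phi z).
  have Oz : Omega z by case: tphi => _ _; apply.
  by apply: cvgM; [exact: locTS_continuous Hf Oz|exact: test_continuous tphi z].
have near0 := near_notin_support nSz.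
apply: (@continuous_near _ (fun=> 0)); last exact: cvg_cst.
by apply: filterS near0 => w ->; rewrite mulr0.
Qed.

Lemma mul_test_integrable Omega f phi : locTS Omega f -> test_function Omega phi ->
  mu2.-integrable setT (fun z => (f z * phi z)%:E).
Proof.
move=> Hf tphi; have [r r0 rS] := test_sub_cube tphi.
apply: (@integrable_continuous_compact _ (fun z => f z * phi z) r).
  exact: mul_test_continuous tphi.
by move=> z /rS/near_notin_support/nbhs_singleton ->; rewrite mulr0.
Qed.

Lemma int_test_mkcond Omega f phi : test_function Omega phi ->
  (\int[mu2]_(z in Omega) (f z * phi z)%:E = \int[mu2]_z (f z * phi z)%:E)%E.
Proof.
move=> [_ _ sO]; rewrite integral_mkcond; apply: eq_integral => z _.
rewrite /patch; case: ifPn => // /negP nO; suff -> : phi z = 0 by rewrite mulr0.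
by apply: notin_support0 => /sO Oz; apply: nO; exact/mem_set.
Qed.

Lemma adde0_eq_oppe (a b : \bar R) : b \is a fin_num -> (a + b = 0 -> a = - b)%E.
Proof.
case: b a => [b| |] [a| |] //= _ [] /eqP; rewrite addr_eq0 => /eqP ->.
by rewrite EFinN.
Qed.

(** The product of [f] and [phi] vanishes near every point off the support of [phi], so it is
    differentiable on the whole plane although [f] is controlled only on Omega; the integral of its
    partial derivative is 0. *)
Lemma by_parts1 Omega f phi : locTS Omega f -> test_function Omega phi ->
  (\int[mu2]_(z in Omega) (f z * pd1 phi z)%:E =
   - \int[mu2]_(z in Omega) (pd1 f z * phi z)%:E)%E.
Proof.
move=> Hf tphi; rewrite !int_test_mkcond //; last exact: test_pd1.
have tphi1 := test_pd1 tphi; have Hf1 := locTS_pd1 Hf.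
have [r r0 rS] := test_sub_cube tphi.
have near0 z : ~ Defs.support phi z -> \forall w \near z, f w * phi w = 0.
  by move=> /near_notin_support; apply: filterS => w ->; rewrite mulr0.
have dE z : pd1 (fun z => f z * phi z) z = f z * pd1 phi z + pd1 f z * phi z.
  have [Sz|nSz] := pselect (Defs.support phi z).
    have Oz : Omega z by case: tphi => _ _; apply.
    rewrite {1}/pd1 (@deriveM _ _ f phi); last 2 first.
    - exact: locTS_derivable Hf Oz.
    - exact: test_derivable tphi.
    by congr (_ + _); rewrite mulrC.
  rewrite (pd1_near (near0 _ nSz)) pd1_cst pd1_notin_support // mulr0 add0r.
  by rewrite (nbhs_singleton (near_notin_support nSz)) mulr0.
have I1 := mul_test_integrable Hf tphi1.
have I2 := mul_test_integrable Hf1 tphi.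
have : (\int[mu2]_z (pd1 (fun z => f z * phi z) z)%:E = 0)%E.
  apply: (@int_pd1_eq0 _ r) => //.
  - move=> z; have [Sz|nSz] := pselect (Defs.support phi z).
      have Oz : Omega z by case: tphi => _ _; apply.
      by apply: (@derivableM _ _ f phi); [exact: locTS_derivable Hf Oz|exact: test_derivable tphi].
    apply: near_eq_derivable (derivable_cst (0 : R) z _).
    by apply: filterS (near0 _ nSz) => w ->.
  - have -> : pd1 (fun z => f z * phi z) = (fun z => f z * pd1 phi z + pd1 f z * phi z).
      by apply/funext.
    move=> z; apply: cvgD; [exact: mul_test_continuous Hf tphi1 z|exact: mul_test_continuous Hf1 tphi z].
  - move=> z /rS nSz; rewrite (nbhs_singleton (near0 _ nSz)); split=> //.
    by rewrite (pd1_near (near0 _ nSz)) pd1_cst.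
under eq_integral do rewrite dE EFinD.
rewrite integralD //= => E.
have fin2 := integrable_fin_num measurableT I2.
exact: adde0_eq_oppe fin2 E.
Qed.

Lemma by_parts2 Omega f phi : locTS Omega f -> test_function Omega phi ->
  (\int[mu2]_(z in Omega) (f z * pd2 phi z)%:E =
   - \int[mu2]_(z in Omega) (pd2 f z * phi z)%:E)%E.
Proof.
move=> Hf tphi; rewrite !int_test_mkcond //; last exact: test_pd2.
have tphi1 := test_pd2 tphi; have Hf1 := locTS_pd2 Hf.
have [r r0 rS] := test_sub_cube tphi.
have near0 z : ~ Defs.support phi z -> \forall w \near z, f w * phi w = 0.
  by move=> /near_notin_support; apply: filterS => w ->; rewrite mulr0.
have dE z : pd2 (fun z => f z * phi z) z = f z * pd2 phi z + pd2 f z * phi z.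
  have [Sz|nSz] := pselect (Defs.support phi z).
    have Oz : Omega z by case: tphi => _ _; apply.
    rewrite {1}/pd2 (@deriveM _ _ f phi); last 2 first.
    - exact: locTS_derivable Hf Oz.
    - exact: test_derivable tphi.
    by congr (_ + _); rewrite mulrC.
  rewrite (pd2_near (near0 _ nSz)) pd2_cst pd2_notin_support // mulr0 add0r.
  by rewrite (nbhs_singleton (near_notin_support nSz)) mulr0.
have I1 := mul_test_integrable Hf tphi1.
have I2 := mul_test_integrable Hf1 tphi.
have : (\int[mu2]_z (pd2 (fun z => f z * phi z) z)%:E = 0)%E.
  apply: (@int_pd2_eq0 _ r) => //.
  - move=> z; have [Sz|nSz] := pselect (Defs.support phi z).
      have Oz : Omega z by case: tphi => _ _; apply.
      by apply: (@derivableM _ _ f phi); [exact: locTS_derivable Hf Oz|exact: test_derivable tphi].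
    apply: near_eq_derivable (derivable_cst (0 : R) z _).
    by apply: filterS (near0 _ nSz) => w ->.
  - have -> : pd2 (fun z => f z * phi z) = (fun z => f z * pd2 phi z + pd2 f z * phi z).
      by apply/funext.
    move=> z; apply: cvgD; [exact: mul_test_continuous Hf tphi1 z|exact: mul_test_continuous Hf1 tphi z].
  - move=> z /rS nSz; rewrite (nbhs_singleton (near0 _ nSz)); split=> //.
    by rewrite (pd2_near (near0 _ nSz)) pd2_cst.
under eq_integral do rewrite dE EFinD.
rewrite integralD //= => E.
have fin2 := integrable_fin_num measurableT I2.
exact: adde0_eq_oppe fin2 E.
Qed.

Lemma by_parts_iter1 Omega f phi i : locTS Omega f -> test_function Omega phi ->
  (\int[mu2]_(z in Omega) (f z * iter i pd1 phi z)%:E =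
   ((-1) ^+ i)%:E * \int[mu2]_(z in Omega) (iter i pd1 f z * phi z)%:E)%E.
Proof.
elim: i f => [|i IHi] f Hf tphi; first by rewrite expr0 mul1e.
have tphii : test_function Omega (iter i pd1 phi) by exact: (test_pd i 0).
rewrite iterS by_parts1 // IHi //; last exact: locTS_pd1.
by rewrite -iterSr exprS EFinM -muleA mulN1e.
Qed.

Lemma by_parts_iter2 Omega f phi i : locTS Omega f -> test_function Omega phi ->
  (\int[mu2]_(z in Omega) (f z * iter i pd2 phi z)%:E =
   ((-1) ^+ i)%:E * \int[mu2]_(z in Omega) (iter i pd2 f z * phi z)%:E)%E.
Proof.
elim: i f => [|i IHi] f Hf tphi; first by rewrite expr0 mul1e.
have tphii : test_function Omega (iter i pd2 phi) by exact: (test_pd 0 i).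
rewrite iterS by_parts2 // IHi //; last exact: locTS_pd2.
by rewrite -iterSr exprS EFinM -muleA mulN1e.
Qed.

(** Integration by parts first moves the outer derivatives of [pd i j], which leaves them innermost
    on [f]. In this reversed order no commutation of partial derivatives is involved. *)
Definition pd21 i j f := iter j pd2 (iter i pd1 f).

Lemma locTS_pd21 Omega f i j : locTS Omega f -> locTS Omega (pd21 i j f).
Proof.
move=> Hf; rewrite /pd21; elim: j => [|j IHj] /=; last exact: locTS_pd2.
by elim: i => [|i IHi] //=; exact: locTS_pd1.
Qed.

Lemma is_distr_deriv_locTS Omega f i j : open Omega -> locTS Omega f ->
  is_distr_deriv Omega i j f (pd21 i j f).
Proof.
move=> oO Hf; split.
  by apply: loc_integrable_continuous => // z; apply: locTS_continuous; exact: locTS_pd21.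
move=> phi tphi; rewrite /pd by_parts_iter1 //; last exact: (test_pd 0 j).
rewrite by_parts_iter2 //; last by have := locTS_pd21 i 0 Hf.
by rewrite muleA -EFinM -exprD.
Qed.

End IntegrationByParts.

(** * Uniqueness of distributional derivatives *)

Section Uniqueness.
Context {R : realType}.
Implicit Types (z c : R * R) (f g h phi W : R * R -> R) (Omega : set (R * R)).
Local Notation mu2 := (@lebesgue2 R).

Lemma TS_test Omega phi c (r : R) : TS phi -> (forall z, ~ cube c r z -> phi z = 0) ->
  cube c r `<=` Omega -> test_function Omega phi.
Proof.
move=> Hphi phi0 cO.
have cc : closed (cube c r) by apply: compact_closed; [exact: norm_hausdorff|exact: compact_cube].
have sub : Defs.support phi `<=` cube c r.
  rewrite [X in _ `<=` X](closure_id _).1 //.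
  apply: closureS => z /= /eqP z0; apply: contrapT => nz; apply: z0; exact: phi0.
split; [exact: TS_smooth| |exact: subset_trans sub cO].
by apply: subclosed_compact sub; [exact: closed_closure|exact: compact_cube].
Qed.

(** It rises on [a, a + 1/N] and falls on [b, b + 1/N], so that it tends pointwise to the indicator
    of the half-open interval ]a, b]; such intervals generate the Borel sets and are stable under
    intersection. *)
Definition itv_bump (a b N x : R) : R :=
  smooth_step (N * x + - (N * a)) * smooth_step (- N * x + (N * b + 1)).

Lemma smooth1_itv_bump a b N : smooth1 (itv_bump a b N).
Proof. by apply: smooth1M; exact/smooth1_affine/smooth1_step. Qed.

Lemma itv_bump01 a b N x : 0 <= itv_bump a b N x <= 1.
Proof.
rewrite /itv_bump; set u := N * x + _; set v := - N * x + _.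
have /andP[? ?] := smooth_step01 u; have /andP[? ?] := smooth_step01 v.
by rewrite mulr_ge0 //= mulr_ile1.
Qed.

Lemma itv_bump0 a b N x : 0 < N -> ~ (a <= x <= b + N^-1) -> itv_bump a b N x = 0.
Proof.
move=> N0; rewrite /itv_bump => nx.
have [xa|xa] := lerP x a.
  by rewrite smooth_step_le0 ?mul0r //; nra.
rewrite [X in _ * X]smooth_step_le0 ?mulr0 //.
have xb : b + N^-1 < x by rewrite ltNge; apply/negP => xb; apply: nx; rewrite xb ltW.
have : N * (b + N^-1) < N * x by rewrite ltr_pM2l.
by rewrite mulrDr divff ?gt_eqF //; lra.
Qed.

Lemma itv_bump_eventually (a b x : R) : exists2 M, 0 < M & forall m, M <= m ->
  itv_bump a b m x = ((a < x) && (x <= b))%:R.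
Proof.
have [xa|ax] := lerP x a.
  exists 1 => // m m1; have m0 : 0 < m by apply: lt_le_trans m1.
  by rewrite /itv_bump smooth_step_le0 ?mul0r //; nra.
have xa0 : 0 < x - a by rewrite subr_gt0.
have [xb|bx] := lerP x b.
  exists (x - a)^-1; first by rewrite invr_gt0.
  move=> m m1; have m0 : 0 < m by apply: lt_le_trans m1; rewrite invr_gt0.
  have : 1 <= m * (x - a) by rewrite -ler_pdivrMr // div1r.
  by move=> H; rewrite /itv_bump !smooth_step_ge1 ?mulr1 //; nra.
have xb0 : 0 < x - b by rewrite subr_gt0.
exists (x - b)^-1; first by rewrite invr_gt0.
move=> m m1; have m0 : 0 < m by apply: lt_le_trans m1; rewrite invr_gt0.
have : 1 <= m * (x - b) by rewrite -ler_pdivrMr // div1r.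
by move=> H; rewrite /itv_bump [X in _ * X]smooth_step_le0 ?mulr0 //; nra.
Qed.

Lemma rect_integral0 W c (r r' a b a' b' : R) : r < r' ->
  measurable_fun setT W -> mu2.-integrable (cube c r') (EFin \o W) ->
  (forall phi, test_function (cube c r') phi -> (\int[mu2]_z (W z * phi z)%:E = 0)%E) ->
  c.1 - r <= a -> b <= c.1 + r -> c.2 - r <= a' -> b' <= c.2 + r ->
  (\int[mu2]_(z in `]a, b]%classic `*` `]a', b']%classic) (W z)%:E = 0)%E.
Proof.
move=> rr' mW iW W0 ha hb ha' hb'.
have d0 : 0 < r' - r by rewrite subr_gt0.
pose K := (r' - r)^-1.
have K0 : 0 < K by rewrite invr_gt0.
(* The shift by 1 / (r' - r) keeps the overhang 1 / N of the bumps inside the cube of radius r'. *)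
pose N (n : nat) : R := n%:R + K.
have N0 n : 0 < N n by rewrite ltr_wpDl.
have NK n : (N n)^-1 <= r' - r.
  by rewrite -[r' - r]invrK lef_pV2 ?posrE // /N lerDr.
pose phi n z := itv_bump a b (N n) z.1 * itv_bump a' b' (N n) z.2.
have phi0 n z : ~ cube c r' z -> phi n z = 0.
  move=> nz; have [xin|xout] := boolP (a <= z.1 <= b + (N n)^-1); last first.
    by rewrite /phi itv_bump0 ?mul0r //; exact/negP.
  have [yin|yout] := boolP (a' <= z.2 <= b' + (N n)^-1); last first.
    by rewrite /phi [X in _ * X]itv_bump0 ?mulr0 //; exact/negP.
  exfalso; apply: nz; rewrite /cube /= norm2_le /= !ler_norml.
  by have := NK n; move: xin yin => /andP[? ?] /andP[? ?]; lra.
have phi01 n z : 0 <= phi n z <= 1.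
  have /andP[? ?] := itv_bump01 a b (N n) z.1.
  have /andP[? ?] := itv_bump01 a' b' (N n) z.2.
  by rewrite /phi mulr_ge0 //= mulr_ile1.
have TSphi n : TS (phi n) by apply: TS_mul; exact: smooth1_itv_bump.
have tphi n : test_function (cube c r') (phi n) by apply: (TS_test (TSphi n) (@phi0 n)).
pose I z : R := ((a < z.1) && (z.1 <= b))%:R * ((a' < z.2) && (z.2 <= b'))%:R.
have IE z : I z = \1_(`]a, b]%classic `*` `]a', b']%classic) z.
  rewrite /I indicE -natrM mulnb; congr (_%:R); congr nat_of_bool.
  apply/idP/idP => [/andP[? ?]|/set_mem[]].
    by apply/mem_set; split; rewrite /= in_itv.
  by rewrite /= !in_itv /= => -> ->.
have mrect : measurable (`]a, b]%classic `*` `]a', b']%classic : set (R * R)) by exact: measurableX.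
have rectQ : `]a, b]%classic `*` `]a', b']%classic `<=` cube c r'.
  move=> z [/=]; rewrite !in_itv /= => /andP[? ?] /andP[? ?].
  by rewrite /cube /= norm2_le /= !ler_norml; lra.
have mQ := measurable_cube c r'.
have mWQ : measurable_fun (cube c r') W by apply: measurable_funS mW.
have mphi n : measurable_fun setT (phi n).
  by apply: measurable_fun_open_continuous => [|z _]; [exact: openT|exact: TS_continuous].
have [] := @dominated_convergence _ _ _ mu2 (cube c r') mQ
  (fun n z => (W z * phi n z)%:E) (fun z => (W z * I z)%:E) (fun z => `|(W z)%:E|%E).
- move=> n; apply/measurable_EFinP; apply: measurable_funM => //.
  exact: measurable_funS (mphi n).
- apply/measurable_EFinP; apply: measurable_funM => //.
  have -> : I = \1_(`]a, b]%classic `*` `]a', b']%classic) by apply/funext.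
  exact: measurable_indic.
- apply: aeW => z _ ; apply: cvg_near_cst.
  have [M1 M10 H1] := itv_bump_eventually a b z.1.
  have [M2 M20 H2] := itv_bump_eventually a' b' z.2.
  near=> n; have nM : Num.max M1 M2 <= n%:R by near: n; exact: nbhs_infty_ger.
  move: nM; rewrite ge_max => /andP[nM1 nM2].
  by rewrite /phi H1 ?H2 // /N ler_wpDr // ltW.
- exact: integrable_abse.
- apply: aeW => z n _; rewrite /= lee_fin normrM ler_piMr //.
  by have /andP[? ?] := phi01 n z; rewrite ger0_norm.
move=> _ _ L.
have E0 n : (\int[mu2]_(z in cube c r') (W z * phi n z)%:E = 0)%E.
  by rewrite int_test_mkcond // W0.
have {L} : (\int[mu2]_(z in cube c r') (W z * I z)%:E = 0)%E.
  apply/esym; apply: cvg_unique L; first exact: ereal_hausdorff.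
  by apply: cvg_near_cst; apply: nearW => n; exact: E0.
rewrite integral_mkcond => <-; rewrite [LHS]integral_mkcond.
apply: eq_integral => z _; rewrite /patch IE indicE.
case: ifPn => [zr|_]; last by rewrite mulr0 if_same.
by rewrite mulr1 ifT //; apply/mem_set/rectQ/set_mem.
Unshelve. all: by end_near. Qed.

Lemma integral_diff0 W (A B Q : set (R * R)) : measurable A -> measurable B ->
  measurable Q -> A `<=` B -> measurable_fun setT W ->
  (\int[mu2]_(z in A `&` Q) (W z)%:E = 0)%E ->
  (\int[mu2]_(z in B `&` Q) (W z)%:E = 0)%E ->
  (\int[mu2]_(z in (B `\` A) `&` Q) (W z)%:E = 0)%E.
Proof.
move=> mA mB mQ AB mW A0.
have -> : B `&` Q = (A `&` Q) `|` ((B `\` A) `&` Q).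
  by rewrite -setIUl setDUK.
rewrite integral_setU //; first by rewrite A0 add0e.
- exact: measurableI.
- by apply: measurableI => //; exact: measurableD.
- by apply/measurable_EFinP; apply: measurable_funS mW.
- apply/disj_setPS => z [[Az _] [[_ nAz] _]]; exact: nAz.
Qed.

Lemma integral_bigcup0 W (F : nat -> set (R * R)) (Q : set (R * R)) :
  (forall n, measurable (F n)) -> trivIset setT F -> measurable Q ->
  mu2.-integrable Q (EFin \o W) ->
  (forall n, \int[mu2]_(z in F n `&` Q) (W z)%:E = 0)%E ->
  (\int[mu2]_(z in (\bigcup_n F n) `&` Q) (W z)%:E = 0)%E.
Proof.
move=> mF tF mQ iW F0; rewrite setI_bigcupl integral_bigcup //.
- by apply: eseries0 => i _ _; exact: F0.
- by apply: trivIset_setIr.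
- by move=> n; exact: (measurableI _ _ (mF n) mQ).
- apply: integrableS iW => //.
    by apply: bigcup_measurable => n _; exact: (measurableI _ _ (mF n) mQ).
  by move=> z [n _ []].
Qed.

(** The sets on which [W] has integral 0 inside [Q] are stable under the operations of a Dynkin
    system and contain the half-open rectangles. The class is enlarged in one factor, then in the
    other, then to the product sigma-algebra; a function whose integrals over all measurable parts
    vanish is 0 almost everywhere. *)
Lemma test_integral0_ae W c (r r' : R) : 0 < r -> r < r' ->
  measurable_fun setT W -> mu2.-integrable (cube c r') (EFin \o W) ->
  (forall phi, test_function (cube c r') phi -> (\int[mu2]_z (W z * phi z)%:E = 0)%E) ->
  ae_eq mu2 (`]c.1 - r, c.1 + r]%classic `*` `]c.2 - r, c.2 + r]%classic)
    (EFin \o W) (cst 0%E).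
Proof.
move=> r0 rr' mW iW W0.
set I1 := `]c.1 - r, _]%classic; set I2 := `]c.2 - r, _]%classic.
set Q := I1 `*` I2.
have mI1 : measurable (I1 : set R) by exact: measurable_itv.
have mI2 : measurable (I2 : set R) by exact: measurable_itv.
have mQ : measurable (Q : set (R * R)) by exact: measurableX.
have QQ : Q `<=` cube c r'.
  move=> z [/=]; rewrite /I1 /I2 /= !in_itv /= => /andP[? ?] /andP[? ?].
  by rewrite /cube /= norm2_le /= !ler_norml; lra.
have iWQ : mu2.-integrable Q (EFin \o W).
  by apply: integrableS iW => //; exact: measurable_cube.
pose P (S : set (R * R)) := (\int[mu2]_(z in S `&` Q) (W z)%:E = 0)%E.
have step0 (a b a' b' : R) : P (`]a, b]%classic `*` `]a', b']%classic).
  rewrite /P /Q -setXI /I1 /I2.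
  have oc (u v u' v' : R) : `]u, v]%classic `&` `]u', v']%classic = `]Num.max u u', Num.min v v']%classic.
    apply/seteqP; split => t /=; rewrite !in_itv /= gt_max le_min.
      by case=> /andP[-> ->] /andP[-> ->].
    by move=> /andP[/andP[-> ->] /andP[-> ->]].
  rewrite !oc; apply: (@rect_integral0 W c r r') => //.
  - by rewrite le_max lexx orbT.
  - by rewrite ge_min lexx orbT.
  - by rewrite le_max lexx orbT.
  - by rewrite ge_min lexx orbT.
have PI S S' : S `&` Q = S' `&` Q -> P S -> P S' by rewrite /P => ->.
have PD A B : measurable A -> measurable B -> A `<=` B -> P A -> P B -> P (B `\` A).
  by move=> mA mB AB; exact: integral_diff0.
have PU (F : nat -> set (R * R)) : (forall n, measurable (F n)) -> trivIset setT F ->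
    (forall n, P (F n)) -> P (\bigcup_n F n).
  by move=> mF tF HF; exact: integral_bigcup0.
have step1 (a' b' : R) (A : set R) : measurable A -> P (A `*` `]a', b']%classic).
  set J := `]a', b']%classic; have mJ : measurable (J : set R) by exact: measurable_itv.
  apply: (@dynkin_induction _ (g_sigma_algebraType (R.-ocitv.-measurable))
    (R.-ocitv.-measurable) (fun A => P (A `*` J)) erefl).
  - by move=> X Y; exact: measurableI.
  - apply: (PI (I1 `*` J)); last exact: step0.
    by apply/seteqP; split => z [[z1 z2] [z3 z4]].
  - by move=> _ [x _ <-]; exact: step0.
  - move=> S mS PS; have -> : (~` S) `*` J = (setT `*` J) `\` (S `*` J).
      apply/seteqP; split => z [].
        by move=> nS Jz; split=> //; case.
      by move=> [_ Jz] nSJ; split=> // Sz; apply: nSJ.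
    apply: PD => //; [exact: measurableX|exact: measurableX|by move=> z []|].
    apply: (PI (I1 `*` J)); last exact: step0.
    by apply/seteqP; split => z [[z1 z2] [z3 z4]].
  - move=> F mF tF HF; have -> : \bigcup_k F k `*` J = \bigcup_k (F k `*` J).
      apply/seteqP; split => [z [[k _ Fz] Jz]|z [k _ [Fz Jz]]]; first by exists k.
      by split=> //; exists k.
    apply: PU => //; first by move=> n; exact: (measurableX (mF n) mJ).
    by apply/trivIsetP => m n _ _ mn; rewrite -setXI (trivIsetP.1 tF) // set0X.
have step2 (A B : set R) : measurable A -> measurable B -> P (A `*` B).
  move=> mA.
  apply: (@dynkin_induction _ (g_sigma_algebraType (R.-ocitv.-measurable))
    (R.-ocitv.-measurable) (fun B => P (A `*` B)) erefl).
  - by move=> X Y; exact: measurableI.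
  - apply: (PI (A `*` I2)); last exact: step1.
    by apply/seteqP; split => z [[z1 z2] [z3 z4]].
  - by move=> _ [x _ <-]; exact: step1.
  - move=> S mS PS; have -> : A `*` (~` S) = (A `*` setT) `\` (A `*` S).
      apply/seteqP; split => z [].
        by move=> Az nS; split=> //; case.
      by move=> [Az _] nSJ; split=> // Sz; apply: nSJ.
    apply: PD => //; [exact: measurableX|exact: measurableX|by move=> z []|].
    apply: (PI (A `*` I2)); last exact: step1.
    by apply/seteqP; split => z [[z1 z2] [z3 z4]].
  - move=> F mF tF HF; have -> : A `*` \bigcup_k F k = \bigcup_k (A `*` F k).
      apply/seteqP; split => [z [Az [k _ Fz]]|z [k _ [Az Fz]]]; first by exists k.
      by split=> //; exists k.
    apply: PU => //; first by move=> n; exact: (measurableX mA (mF n)).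
    by apply/trivIsetP => m n _ _ mn; rewrite -setXI (trivIsetP.1 tF) // setX0.
have step3 (S : set (R * R)) : measurable S -> P S.
  rewrite measurable_prod_measurableType; apply: dynkin_induction.
  - exact: measurable_prod_measurableType.
  - move=> _ _ [A mA [B mB <-]] [A' mA' [B' mB' <-]]; rewrite -setXI.
    by exists (A `&` A'); [exact: measurableI|exists (B `&` B'); [exact: measurableI|]].
  - by rewrite -setXTT; apply: step2.
  - by move=> _ [A mA [B mB <-]]; exact: step2.
  - move=> S' mS' PS'; rewrite -setTD; apply: PD => //.
    by rewrite -setXTT; apply: step2.
  - by move=> F mF tF HF; exact: PU.
apply: integral_ae_eq => //.
move=> E EQ mE; rewrite integral_cst // mul0e.
by have := step3 E mE; rewrite /P setIidl.
Qed.

Lemma test_bounded Omega phi : test_function Omega phi ->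
  exists2 M, 0 <= M & forall z, `|phi z| <= M.
Proof.
move=> tphi; have [r r0 rS] := test_sub_cube tphi.
have [c _ cmax] : exists2 c, c \in cube 0 r & forall z, z \in cube 0 r -> `|phi z| <= `|phi c|.
  apply: (@compact_EVT_max _ _ (fun z => `|phi z|)).
  - by exists 0; rewrite /cube /= subrr normr0 ltW.
  - exact: compact_cube.
  - by apply: continuous_subspaceT => z; apply: cvg_norm; exact: test_continuous tphi z.
exists `|phi c| => // z; have [zr|/rS/notin_support0 ->] := pselect (cube 0 r z).
  by apply: cmax; exact: mem_set.
by rewrite normr0.
Qed.

Lemma mul_test_loc_integrable Omega g phi : open Omega -> loc_integrable Omega g ->
  test_function Omega phi -> mu2.-integrable Omega (fun z => (g z * phi z)%:E).
Proof.
move=> oO [mg ig] tphi; have mO := open_measurable2 oO.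
have [M M0 phiM] := test_bounded tphi.
have mphi : measurable_fun setT phi.
  by apply: measurable_fun_open_continuous => [|z _]; [exact: openT|exact: test_continuous tphi z].
case: tphi => _ cS SO; have mS := compact_measurable2 cS.
have igS : mu2.-integrable (Defs.support phi) (EFin \o g).
  apply/integrableP; split; last exact: ig.
  by apply/measurable_EFinP; exact: measurable_funS mg.
apply/integrableP; split.
  apply/measurable_EFinP; apply: measurable_funM => //; exact: measurable_funS mphi.
apply: (@le_lt_trans _ _ (\int[mu2]_(z in Defs.support phi) `|(M%:E * (g z)%:E)|)%E); last first.
  by have /integrableP[] := @integrableZl _ _ _ mu2 _ mS M _ igS.
rewrite [leLHS]integral_mkcond [leRHS]integral_mkcond.
apply: le_integral_ge0 => z _; rewrite /patch; first by case: ifP.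
case: ifPn => _; last by case: ifP => // _; exact: abse_ge0.
case: ifPn => [_|/negP nS].
  by rewrite /= lee_fin !normrM mulrC ler_wpM2r // (ger0_norm M0).
have -> : phi z = 0 by apply: notin_support0 => Sz; apply: nS; exact: mem_set.
by rewrite mulr0 abse0.
Qed.

Lemma itv_sub_cube c (r : R) : 0 < r ->
  `]c.1 - r, c.1 + r]%classic `*` `]c.2 - r, c.2 + r]%classic `<=` cube c (2 * r).
Proof.
move=> r0 z [/=]; rewrite !in_itv /= => /andP[? ?] /andP[? ?].
by rewrite /cube /= norm2_le /= !ler_norml; lra.
Qed.

(** [distr_deriv] is an arbitrary representative; this is how pointwise bounds on classical
    derivatives reach it. *)
Lemma distr_deriv_ae Omega i j f g h : open Omega ->
  is_distr_deriv Omega i j f g -> is_distr_deriv Omega i j f h ->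
  {ae mu2, forall z, Omega z -> g z = h z}.
Proof.
move=> oO [lg Dg] [lh Dh].
have mO := open_measurable2 oO.
pose W := (g \- h) \_ Omega.
have [[mg ig] [mh ih]] := (lg, lh).
have mW : measurable_fun setT W.
  by apply/(measurable_restrictT _ mO); exact: measurable_funB.
have local c (r : R) : 0 < r -> cube c (2 * r) `<=` Omega ->
  ae_eq mu2 (`]c.1 - r, c.1 + r]%classic `*` `]c.2 - r, c.2 + r]%classic) (EFin \o W) (cst 0%E).
  move=> r0 cO; have rr : r < 2 * r by lra.
  have igc : mu2.-integrable (cube c (2 * r)) (EFin \o g).
    apply/integrableP; split; last by apply: ig => //; exact: compact_cube.
    by apply/measurable_EFinP; exact: measurable_funS mg.
  have ihc : mu2.-integrable (cube c (2 * r)) (EFin \o h).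
    apply/integrableP; split; last by apply: ih => //; exact: compact_cube.
    by apply/measurable_EFinP; exact: measurable_funS mh.
  have WE z : Omega z -> W z = g z - h z.
    by move=> Oz; rewrite /W /patch ifT //; exact/mem_set.
  apply: (test_integral0_ae r0 rr mW).
    apply: (@eq_integrable _ _ _ mu2 _ (measurable_cube _ _) ((EFin \o g) \- (EFin \o h))%E).
      by move=> z /set_mem cz; rewrite /= WE //; exact: cO.
    by apply: integrableB => //; exact: measurable_cube.
  move=> phi [sphi cphi subphi].
  have tphi : test_function Omega phi by split=> //; exact: subset_trans subphi cO.
  have igphi := mul_test_loc_integrable oO lg tphi.
  have ihphi := mul_test_loc_integrable oO lh tphi.
  rewrite -(int_test_mkcond _ tphi).
  transitivity (\int[mu2]_(z in Omega) ((g z * phi z)%:E - (h z * phi z)%:E))%E.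
    apply: eq_integral => z /set_mem Oz; rewrite WE // mulrBl EFinB //.
  transitivity ((\int[mu2]_(z in Omega) (g z * phi z)%:E) - \int[mu2]_(z in Omega) (h z * phi z)%:E)%E.
    exact: integralB_EFin.
  have := Dg _ tphi; rewrite (Dh _ tphi).
  have := @integrable_fin_num _ _ _ mu2 _ mO _ igphi.
  have := @integrable_fin_num _ _ _ mu2 _ mO _ ihphi.
  case: (\int[mu2]_(z in Omega) _)%E => // a _; case: (\int[mu2]_(z in Omega) _)%E => // b _.
  rewrite -!EFinM => -[] /mulfI -> //; last by rewrite signr_eq0.
  by rewrite -EFinB subrr.
(* Countably many cubes with rational centres and radii 1 / (k + 1) cover Omega, so the exceptional
   sets unite to a null set. *)
pose T (q : rat * rat * nat) : set (R * R) :=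
  let c : R * R := (ratr q.1.1, ratr q.1.2) in let r : R := q.2.+1%:R^-1 in
  if `[< cube c (2 * r) `<=` Omega >] then
  [set z | (`]c.1 - r, c.1 + r]%classic `*` `]c.2 - r, c.2 + r]%classic) z /\ g z <> h z] else set0.
pose S (n : nat) := oapp T set0 (unpickle n).
change (mu2.-negligible (~` [set z | Omega z -> g z = h z])).
have nS : mu2.-negligible (\bigcup_n S n).
  apply: negligible_bigcup => n; rewrite /S.
  case: unpickle => [[[q1 q2] k]|] /=; last exact: negligible_set0.
  rewrite /T.
  case: asboolP => [sub|_]; last exact: negligible_set0.
  have := local _ _ _ sub; rewrite invr_gt0 ltr0n => /(_ isT).
  apply: negligibleS => z /= [zin gh] /(_ zin) [] /eqP.
  rewrite /W /patch ifT; first by rewrite subr_eq0 => /eqP.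
  by apply/mem_set/sub/itv_sub_cube; rewrite ?invr_gt0.
apply: negligibleS nS.
move=> z /= /not_implyP [Oz gh].
have [e e0 eO] : exists2 e : R, 0 < e & forall w, `|w - z| < e -> Omega w.
  have /nbhs_ballP[e /= e0 eO] := open_nbhs_nbhs (conj oO Oz).
  by exists e => // w wz; apply: eO; rewrite -ball_normE /ball_ /= distrC.
have [k ke] : exists k : nat, k.+1%:R^-1 < e / 4.
  exists (Num.truncn (e / 4)^-1); rewrite invf_plt ?posrE ?divr_gt0 //.
  by rewrite truncnS_gt.
set r : R := k.+1%:R^-1 in ke; have r0 : 0 < r by rewrite invr_gt0.
have [q1 /[!in_itv]/= /andP[q11 q12]] : exists q : rat, ratr q \in `](z.1 - r : R), (z.1 + r)[.
  by apply: rat_in_itvoo; lra.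
have [q2 /[!in_itv]/= /andP[q21 q22]] : exists q : rat, ratr q \in `](z.2 - r : R), (z.2 + r)[.
  by apply: rat_in_itvoo; lra.
exists (pickle (q1, q2, k)); first exact: I.
rewrite /S pickleK /= /T /= -/r ifT; last first.
  apply/asboolP => w; rewrite /cube /= norm2_le /= !ler_norml => /andP[/andP[? ?] /andP[? ?]].
  by apply: eO; rewrite norm2_lt /= !ltr_norml; apply/andP; split; apply/andP; split; lra.
by split=> //; split; rewrite /= in_itv /=; apply/andP; split; lra.
Qed.

End Uniqueness.

(** * Bounds of norms in L_p and Hoelder's inequality *)

Section LpBounds.
Context {R : realType}.
Implicit Types (z c : R * R) (f g h V H : R * R -> R) (Omega : set (R * R)).
Local Notation mu2 := (@lebesgue2 R).

Lemma Lnorm_le g H (p M : R) : 0 < p -> measurable_fun setT g -> measurable_fun setT H ->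
  {ae mu2, forall z, `|g z| <= H z} ->
  (\int[mu2]_z (H z `^ p)%:E <= M%:E)%E ->
  ('N[mu2]_(p%:E)[EFin \o g] <= (M `^ p^-1)%:E)%E.
Proof.
move=> p0 mg mH gH HM; rewrite unlock -poweR_EFin.
have I0 : (0 <= \int[mu2]_z (H z `^ p)%:E)%E by apply: integral_ge0 => z _; rewrite lee_fin powR_ge0.
apply: gt0_ler_poweR.
- by rewrite invr_ge0 ltW.
- by rewrite in_itv /= leey andbT; apply: integral_ge0 => z _; rewrite lee_fin powR_ge0.
- by rewrite in_itv /= leey andbT; exact: le_trans HM.
apply: le_trans HM; apply: ae_ge0_le_integral => //.
- by move=> z _; rewrite lee_fin powR_ge0.
- apply/measurable_EFinP.
  apply: (@measurableT_comp _ _ _ _ _ _ (fun x : R => x `^ p)); first exact: measurable_powR.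
  by apply: measurableT_comp => //; exact: normr_measurable.
- by move=> z _; rewrite lee_fin powR_ge0.
- apply/measurable_EFinP.
  by apply: (@measurableT_comp _ _ _ _ _ _ (fun x : R => x `^ p)) => //; exact: measurable_powR.
case: gH => N [mN N0 sN]; exists N; split=> // z nz; apply: sN => /= gHz; apply: nz => _ /=.
rewrite lee_fin; apply: ge0_ler_powR => //; rewrite ?nnegrE //; first exact: ltW.
exact: le_trans gHz.
Qed.

Lemma Lp_norm_le Omega g H (p M : R) : open Omega -> 0 < p -> measurable_fun Omega g ->
  measurable_fun setT H -> (forall z, 0 <= H z) -> {ae mu2, forall z, Omega z -> `|g z| <= H z} ->
  (\int[mu2]_z (H z `^ p)%:E <= M%:E)%E ->
  (Lp_norm Omega p g <= (M `^ p^-1)%:E)%E.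
Proof.
move=> oO p0 mg mH H0 gH HM; apply: Lnorm_le mH _ HM => //.
  by apply/(measurable_restrictT _ (open_measurable2 oO)).
case: gH => N [mN N0 sN]; exists N; split=> // z nz; apply: sN => /= gHz; apply: nz => /=.
by rewrite /patch; case: ifPn => [/set_mem/gHz//|_]; rewrite normr0.
Qed.

Lemma measurable_indic_cube c (r A : R) : measurable_fun setT (fun z => A * \1_(cube c r) z).
Proof.
apply: measurable_funM; first exact: measurable_cst.
have mQ := measurable_cube c r; exact: measurable_indic.
Qed.

Lemma integral_powR_cube c (r A q : R) : 0 <= r -> 0 < q -> 0 <= A ->
  (\int[mu2]_z ((A * \1_(cube c r) z) `^ q)%:E = (A `^ q * (2 * r) ^+ 2)%:E)%E.
Proof.
move=> r0 q0 A0; have mQ := measurable_cube c r.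
transitivity (\int[mu2]_(z in cube c r) (cst (A `^ q)%:E z))%E.
  rewrite [RHS]integral_mkcond; apply: eq_integral => z _.
  rewrite /patch indicE; case: ifPn => _; first by rewrite mulr1.
  by rewrite mulr0 powR0 // gt_eqF.
by rewrite integral_cst // [X in (_ * X)%E]mu2_cube.
Qed.

(** Hoelder's inequality with the exponent q conjugate to p; [V] is dominated by A times the
    indicator of a cube of area (2 r)^2. *)
Lemma integral_mul_le g V c (p N A r : R) : 1 < p -> 0 <= r -> 0 <= A ->
  measurable_fun setT g -> measurable_fun setT V ->
  (forall z, `|V z| <= A) -> (forall z, ~ cube c r z -> V z = 0) ->
  (Lp_norm setT p g <= N%:E)%E ->
  (`|\int[mu2]_z (g z * V z)%:E| <= (N * (A * ((2 * r) ^+ 2) `^ (1 - p^-1)))%:E)%E.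
Proof.
move=> p1 r0 A0 mg mV VA V0; rewrite /Lp_norm patch_setT => gN.
have p0 : 0 < p by apply: lt_trans p1.
pose q := (1 - p^-1)^-1.
have qi : 0 < 1 - p^-1 by rewrite subr_gt0 invf_lt1.
have q0 : 0 < q by rewrite invr_gt0.
have mgV : measurable_fun setT (fun z => g z * V z) by exact: measurable_funM.
apply: le_trans (_ : (\int[mu2]_z `|(g z * V z)%:E| <= _)%E).
  by apply: le_abse_integral => //; apply/measurable_EFinP.
have pq : p^-1 + q^-1 = 1 by rewrite /q invrK addrC subrK.
have := @hoelder _ _ _ mu2 g V p q mg mV p0 q0 pq.
rewrite Lnorm1 => /le_trans; apply.
rewrite [X in (_ <= X)%E]EFinM; apply: lee_pmul => //; [exact: Lnorm_ge0|exact: Lnorm_ge0|].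
have -> : A * ((2 * r) ^+ 2) `^ (1 - p^-1) = (A `^ q * (2 * r) ^+ 2) `^ q^-1.
  rewrite powRM ?powR_ge0 ?sqr_ge0 // -powRrM divff ?gt_eqF // powRr1 //.
  by rewrite /q invrK.
apply: (Lnorm_le (H := fun z => A * \1_(cube c r) z)) => //.
- exact: measurable_indic_cube.
- apply: aeW => z; rewrite indicE; case: (boolP (z \in _)) => [_|/negP nz].
    by rewrite mulr1.
  by rewrite V0 ?normr0 ?mulr0 // => zc; apply: nz; exact: mem_set.
by rewrite integral_powR_cube.
Qed.

End LpBounds.

(** * Difference of local means of an extension *)

Section Bumps.
Context {R : realType}.
Implicit Types (z c : R * R) (F g h V : R * R -> R) (Omega : set (R * R)).
Local Notation mu2 := (@lebesgue2 R).

Lemma near_derive1 (f g : R -> R) (x : R) : (\forall y \near x, f y = g y) -> derive1 f x = derive1 g x.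
Proof. by move=> fg; rewrite !derive1E; apply: near_eq_derive; rewrite ?oner_eq0. Qed.

Lemma derive1_near0 (f : R -> R) (r : R) : (forall x, r < `|x| -> f x = 0) ->
  forall x, r < `|x| -> derive1 f x = 0.
Proof.
move=> f0 x rx; rewrite (@near_derive1 f (fun=> 0)) ?derive1_cst //.
have : \forall y \near x, r < `|y|.
  have cn : {for x, continuous (fun y : R => `|y|)} by exact: norm_continuous.
  exact: (cn _ (lt_nbhsr rx)).
by apply: filterS => y /f0.
Qed.

Lemma derive1n_near0 n (f : R -> R) (r : R) : (forall x, r < `|x| -> f x = 0) ->
  forall x, r < `|x| -> derive1n n f x = 0.
Proof.
move=> f0; elim: n => // n IHn; rewrite derive1nS; exact: derive1_near0.
Qed.

Lemma smooth1_compact_bounded n (f : R -> R) (r : R) : 0 <= r -> smooth1 f ->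
  (forall x, r < `|x| -> f x = 0) -> exists2 K, 1 <= K & forall x, `|derive1n n f x| <= K.
Proof.
move=> r0 Hf f0; have cn : continuous (fun x => `|derive1n n f x|).
  by move=> x; apply: cvg_norm; apply: smooth1_continuous; exact: smooth1_derive1n.
have [||c cin cmax] := @EVT_max _ (fun x => `|derive1n n f x|) (- r) r.
- by lra.
- exact: continuous_subspaceT.
exists (Num.max 1 `|derive1n n f c|); first by rewrite le_max lexx.
move=> x; rewrite le_max; have [xr|rx] := lerP `|x| r.
  by rewrite cmax ?orbT // in_itv /= -ler_norml.
by rewrite (derive1n_near0 _ f0) // normr0 ler01.
Qed.

Lemma derive1_step_bounded :
  exists2 K : R, 1 <= K & forall x : R, `|derive1 smooth_step x| <= K.
Proof.
(* The step is not compactly supported, but it agrees with the compactly supported [f] to the left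
   of 2 and is constant to the right of 1. *)
pose f (x : R) := smooth_step x * smooth_step (-1 * x + 3).
have Hf : smooth1 f by apply: smooth1M; [exact: smooth1_step|exact/smooth1_affine/smooth1_step].
have f0 x : 3 < `|x| -> f x = 0.
  rewrite /f ltr_normr => /orP[] x0.
    by rewrite [X in _ * X]smooth_step_le0 ?mulr0 //; lra.
  by rewrite smooth_step_le0 ?mul0r //; lra.
have [//|K K1 HK] := @smooth1_compact_bounded 1 f 3 _ Hf f0.
exists K => // x; have [x2|x2] := ltrP x 2; last first.
  rewrite (@near_derive1 _ (fun=> 1)) ?derive1_cst ?normr0; first by lra.
  have : \forall y \near x, 1 < y by apply: lt_nbhsr; lra.
  by apply: filterS => y y1; rewrite smooth_step_ge1 // ltW.
have -> : derive1 smooth_step x = derive1 f x; last exact: HK.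
apply: near_derive1.
have : \forall y \near x, y < 2 by exact: lt_nbhsl.
apply: filterS => y y2; rewrite /f [X in _ * X]smooth_step_ge1 ?mulr1 //; lra.
Qed.

Lemma derive1_step0 (x : R) : ~~ (0 <= x <= 1) -> derive1 smooth_step x = 0 :> R.
Proof.
rewrite negb_and -!ltNge => /orP[x0|x1].
  rewrite (@near_derive1 _ (fun=> 0)) ?derive1_cst //.
  have : \forall y \near x, y < 0 by exact: lt_nbhsl.
  by apply: filterS => y /ltW/smooth_step_le0.
rewrite (@near_derive1 _ (fun=> 1)) ?derive1_cst //.
have : \forall y \near x, 1 < y by exact: lt_nbhsr.
by apply: filterS => y /ltW/smooth_step_ge1.
Qed.

Definition step_at (c t x : R) : R := smooth_step ((x - c) / t).

Lemma smooth1_step_at (c t : R) : smooth1 (step_at c t).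
Proof. exact/smooth1_subM/smooth1_step. Qed.

Lemma derive1_subM (f : R -> R) (c t : R) : smooth1 f ->
  derive1 (fun x => f ((x - c) / t)) = (fun x => t^-1 * derive1 f ((x - c) / t)).
Proof.
move=> Hf; have E (x : R) : (x - c) / t = t^-1 * x + - (c / t) by rewrite mulrBl mulrC.
rewrite (_ : (fun x => f _) = (fun x => f (t^-1 * x + - (c / t)))); last by apply/funext => x; rewrite E.
by rewrite derive1_affineE //; apply/funext => x; rewrite E.
Qed.

Lemma derive1_step_at0 (c t x : R) : 0 < t -> ~~ (c <= x <= c + t) -> derive1 (step_at c t) x = 0.
Proof.
move=> t0 nx; rewrite derive1_subM ?derive1_step0 ?mulr0 //; last exact: smooth1_step.
by move: nx; rewrite ler_pdivlMr // mul0r ler_pdivrMr // mul1r subr_ge0 lerBlDl.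
Qed.

Lemma derive1_step_at_le (K c t x : R) : (forall x, `|derive1 smooth_step x| <= K) -> 0 < t ->
  `|derive1 (step_at c t) x| <= K / t.
Proof.
move=> HK t0; rewrite derive1_subM; last exact: smooth1_step.
by rewrite normrM gtr0_norm ?invr_gt0 // mulrC ler_pM2r ?invr_gt0.
Qed.

Lemma step_atB_le (c c' t t' x : R) : `|step_at c t x - step_at c' t' x| <= 1.
Proof.
have /andP[? ?] := smooth_step01 ((x - c) / t).
by have /andP[? ?] := smooth_step01 ((x - c') / t'); rewrite ler_norml /step_at; lra.
Qed.

Lemma step_atB0 (c c' t t' x : R) : 0 < t -> 0 < t' -> t' <= t -> `|c - c'| <= t ->
  2 * t < `|x - c| -> step_at c t x - step_at c' t' x = 0.
Proof.
move=> t0 t'0 tt' cc' xc; rewrite /step_at; move: cc'; rewrite ler_norml => /andP[h1 h2].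
have [xc0|xc0] := lerP 0 (x - c).
  rewrite ger0_norm // in xc.
  by rewrite !smooth_step_ge1 ?subrr ?ler_pdivlMr ?mul1r //; lra.
rewrite ltr0_norm // in xc.
by rewrite !smooth_step_le0 ?subrr ?ler_pdivrMr ?mul0r //; lra.
Qed.

(** A mollifier of integral 1 on the square with lower corner [c] and side t. Being a product of
    derivatives of steps, two of them differ by partial derivatives of explicit test functions. *)
Definition bump c (t : R) z : R := derive1 (step_at c.1 t) z.1 * derive1 (step_at c.2 t) z.2.

Lemma TS_bump c t : TS (bump c t).
Proof. by apply: TS_mul; exact/smooth1_derive1/smooth1_step_at. Qed.

Lemma bump0 c t z : 0 < t -> ~ cube c t z -> bump c t z = 0.
Proof.
move=> t0 nz; rewrite /bump; have [z1|z1] := boolP (c.1 <= z.1 <= c.1 + t); last first.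
  by rewrite (derive1_step_at0 t0 z1) mul0r.
have [z2|z2] := boolP (c.2 <= z.2 <= c.2 + t); last by rewrite (derive1_step_at0 t0 z2) mulr0.
exfalso; apply: nz; move: z1 z2 => /andP[? ?] /andP[? ?].
by rewrite /cube /= norm2_le /= !ler_norml; lra.
Qed.

Lemma test_bump Omega c t : 0 < t -> cube c t `<=` Omega -> test_function Omega (bump c t).
Proof. by move=> t0; apply: TS_test; [exact: TS_bump|move=> z; exact: bump0]. Qed.

Lemma derive1ZE (a : R) (f : R -> R) : smooth1 f ->
  derive1 (fun x => a * f x) = (fun x => a * derive1 f x).
Proof.
move=> Hf; rewrite (derive1ME (smooth1_cst a) Hf); apply/funext => x.
by rewrite derive1_cst mulr0 addr0.
Qed.

Lemma integral_derive1_step_at (a c t : R) : 0 < t ->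
  (\int[lebesgue_measure]_x (a * derive1 (step_at c t) x)%:E = a%:E)%E.
Proof.
move=> t0; have Hs := smooth1_step_at c t; have H := smooth1Z a Hs.
have -> : (\int[lebesgue_measure]_x (a * derive1 (step_at c t) x)%:E =
    \int[lebesgue_measure]_(x in `[c, (c + t)%R]) (a * derive1 (step_at c t) x)%:E)%E.
  rewrite [RHS]integral_mkcond; apply: eq_integral => x _; rewrite /patch.
  case: ifPn => //; rewrite notin_setE /= in_itv /= => /negP xr.
  by rewrite derive1_step_at0 // mulr0.
have cS := smooth1_continuous H.
rewrite (@continuous_FTC2 _ (fun x => a * derive1 (step_at c t) x) (fun x => a * step_at c t x)).
- rewrite /step_at subrr mul0r addrAC subrr add0r divff ?gt_eqF //.
  by rewrite smooth_step_ge1 // smooth_step_le0 // mulr1 mulr0 sube0.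
- by rewrite ltrDl.
- by apply: continuous_subspaceT; apply: smooth1_continuous; exact/smooth1Z/smooth1_derive1.
- split=> [x _||]; first exact: smooth1_derivable.
    exact: (cvg_at_right_filter (cS c)).
  exact: (cvg_at_left_filter (cS (c + t))).
- by move=> x _; rewrite derive1ZE.
Qed.

Lemma integrable_bump c t : 0 < t -> mu2.-integrable setT (EFin \o bump c t).
Proof.
move=> t0; have [r r0 rS] := test_sub_cube (test_bump t0 (@subsetT _ (cube c t))).
apply: (@integrable_continuous_compact _ _ r); first by move=> z; exact/TS_continuous/TS_bump.
by move=> z /rS/notin_support0.
Qed.

Lemma integral_bump c t : 0 < t -> (\int[mu2]_z (bump c t z)%:E = 1)%E.
Proof.
move=> t0; have ib := integrable_bump c t0.
rewrite /lebesgue2 -integral12_prod_meas1 //.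
transitivity (\int[lebesgue_measure]_x (1 * derive1 (step_at c.1 t) x)%:E)%E; last exact: integral_derive1_step_at.
apply: eq_integral => x _; rewrite /fubini_F mul1r /bump /=.
exact: integral_derive1_step_at.
Qed.

End Bumps.

(** * Comparison of local means at different points and scales *)

Section Telescoping.
Context {R : realType}.
Implicit Types (z c : R * R) (F f g h V phi psi : R * R -> R) (Omega : set (R * R)).
Local Notation mu2 := (@lebesgue2 R).

Definition pairing F phi : R := fine (\int[mu2]_z (F z * phi z)%:E)%E.

Lemma pairing_integrable F phi : loc_integrable setT F -> test_function setT phi ->
  mu2.-integrable setT (fun z => (F z * phi z)%:E).
Proof. exact: (@mul_test_loc_integrable _ setT F phi openT). Qed.

Lemma pairingE F phi : loc_integrable setT F -> test_function setT phi ->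
  (\int[mu2]_z (F z * phi z)%:E)%E = (pairing F phi)%:E.
Proof.
move=> iF tphi; rewrite /pairing fineK //.
exact: (@integrable_fin_num _ _ _ mu2 _ measurableT _ (pairing_integrable iF tphi)).
Qed.

Lemma pairingD F phi psi : mu2.-integrable setT (fun z => (F z * phi z)%:E) ->
  mu2.-integrable setT (fun z => (F z * psi z)%:E) ->
  mu2.-integrable setT (fun z => (F z * (phi z + psi z))%:E) /\
  pairing F (fun z => phi z + psi z) = pairing F phi + pairing F psi.
Proof.
move=> i1 i2; have E z : ((F z * (phi z + psi z))%:E = (F z * phi z)%:E + (F z * psi z)%:E)%E.
  by rewrite mulrDr EFinD.
split.
  rewrite (_ : (fun z => _) = (fun z => (F z * phi z)%:E + (F z * psi z)%:E)%E); last first.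
    by apply/funext => z; exact: E.
  by apply: (@integrableD _ _ _ mu2).
rewrite /pairing -fineD; last 2 first.
- exact: (@integrable_fin_num _ _ _ mu2 _ measurableT _ i1).
- exact: (@integrable_fin_num _ _ _ mu2 _ measurableT _ i2).
congr fine; transitivity (\int[mu2]_z ((F z * phi z)%:E + (F z * psi z)%:E))%E.
  by apply: eq_integral => z _; exact: E.
by apply: integralD_EFin.
Qed.

Lemma TS_iter_pd1 n f : TS f -> TS (iter n pd1 f).
Proof. by elim: n => //= n IHn Hf; exact/TS_pd1/IHn. Qed.

Lemma iter_pd1D n f g : TS f -> TS g ->
  iter n pd1 (fun z => f z + g z) = (fun z => iter n pd1 f z + iter n pd1 g z).
Proof.
elim: n f g => [//|n IHn] f g Hf Hg.
by rewrite /= IHn // pd1D //; exact: TS_iter_pd1.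
Qed.

(** With a, b and a', b' the factors of the two mollifiers, a b - a' b' = (a - a') b + a' (b - b').
    The first summand is integrated in the first variable, the second in the other; see
    [bump_diffE]. *)
Definition bump_diff1 c c' (t t' : R) z : R :=
  (step_at c.1 t z.1 - step_at c'.1 t' z.1) * derive1 (step_at c.2 t) z.2.

Definition bump_diff2 c c' (t t' : R) z : R :=
  derive1 (step_at c'.1 t') z.1 * (step_at c.2 t z.2 - step_at c'.2 t' z.2).

Lemma smooth1B (f g : R -> R) : smooth1 f -> smooth1 g -> smooth1 (fun x => f x - g x).
Proof.
move=> Hf Hg; rewrite (_ : (fun x => _) = (fun x => f x + -1 * g x)).
  by apply: smooth1D => //; exact: smooth1Z.
by apply/funext => x; rewrite mulN1r.
Qed.

Lemma derive1BE (f g : R -> R) : smooth1 f -> smooth1 g ->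
  derive1 (fun x => f x - g x) = (fun x => derive1 f x - derive1 g x).
Proof.
move=> Hf Hg; rewrite (_ : (fun x => _) = (fun x => f x + -1 * g x)).
  rewrite derive1DE //; last exact: smooth1Z.
  by apply/funext => x; rewrite derive1ZE // mulN1r.
by apply/funext => x; rewrite mulN1r.
Qed.

Lemma TS_bump_diff1 c c' (t t' : R) : TS (bump_diff1 c c' t t').
Proof.
apply: (@TS_mul _ (fun x => step_at c.1 t x - step_at c'.1 t' x)).
  by apply: smooth1B; exact: smooth1_step_at.
exact/smooth1_derive1/smooth1_step_at.
Qed.

Lemma TS_bump_diff2 c c' (t t' : R) : TS (bump_diff2 c c' t t').
Proof.
apply: (@TS_mul _ _ (fun x => step_at c.2 t x - step_at c'.2 t' x)).
  exact/smooth1_derive1/smooth1_step_at.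
by apply: smooth1B; exact: smooth1_step_at.
Qed.

Lemma bump_diffE c c' (t t' : R) :
  bump c t = (fun z => bump c' t' z + (pd1 (bump_diff1 c c' t t') z + pd2 (bump_diff2 c c' t t') z)).
Proof.
have s (a b : R) := smooth1_step_at a b.
apply/funext => z; rewrite /bump_diff1 /bump_diff2.
rewrite (@pd1_tensor _ (fun x => step_at c.1 t x - step_at c'.1 t' x)); last exact: smooth1B.
rewrite (@pd2_tensor _ _ (fun x => step_at c.2 t x - step_at c'.2 t' x)); last exact: smooth1B.
rewrite (derive1BE (s c.1 t) (s c'.1 t')) (derive1BE (s c.2 t) (s c'.2 t')) /bump.
move: (derive1 _ z.1) (derive1 _ z.2) (derive1 _ z.1) (derive1 _ z.2) => a b a' b'.
by rewrite mulrBl mulrBr !addrA subrK addrAC subrr add0r.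
Qed.

Section Bounds.
Variables (K t t' : R) (c c' : R * R).
Hypotheses (HK : forall x : R, `|derive1 smooth_step x| <= K) (K0 : 0 <= K).
Hypotheses (t0 : 0 < t) (tt' : t / 2 <= t') (t't : t' <= t) (cc' : `|c - c'| <= t).

Let t'0 : 0 < t'. Proof. by apply: lt_le_trans tt'; rewrite divr_gt0. Qed.
Let cc1 : `|c.1 - c'.1| <= t. Proof. by move: cc'; rewrite norm2_le => /andP[]. Qed.
Let cc2 : `|c.2 - c'.2| <= t. Proof. by move: cc'; rewrite norm2_le => /andP[]. Qed.
Let Kt : K / t <= 2 * K / t.
Proof. by rewrite ler_pM2r ?invr_gt0 // ler_peMl // ler1n. Qed.
Let Kt' : K / t' <= 2 * K / t.
Proof.
rewrite ler_pdivrMr // mulrAC ler_pdivlMr //; move: K0 tt' => K0' tt2.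
have : K * t <= K * (2 * t') by apply: ler_wpM2l => //; lra.
lra.
Qed.

Lemma bump_diff1_le z : `|bump_diff1 c c' t t' z| <= 2 * K / t.
Proof.
rewrite /bump_diff1 normrM -[leRHS]mul1r; apply: ler_pM => //; first exact: step_atB_le.
exact: le_trans (derive1_step_at_le _ _ HK t0) Kt.
Qed.

Lemma bump_diff2_le z : `|bump_diff2 c c' t t' z| <= 2 * K / t.
Proof.
rewrite /bump_diff2 normrM -[leRHS]mulr1; apply: ler_pM => //; last exact: step_atB_le.
exact: le_trans (derive1_step_at_le _ _ HK t'0) Kt'.
Qed.

Lemma bump_diff1_0 z : ~ cube c (2 * t) z -> bump_diff1 c c' t t' z = 0.
Proof.
move=> nz; rewrite /bump_diff1; have [z1|z1] := ltrP (2 * t) `|z.1 - c.1|.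
  by rewrite step_atB0 // mul0r.
rewrite [X in _ * X]derive1_step_at0 ?mulr0 //; apply/negP => /andP[? ?]; apply: nz.
by rewrite /cube /= norm2_le /= z1 /= ler_norml; have := t0; lra.
Qed.

Lemma bump_diff2_0 z : ~ cube c (2 * t) z -> bump_diff2 c c' t t' z = 0.
Proof.
move=> nz; rewrite /bump_diff2; have [z2|z2] := ltrP (2 * t) `|z.2 - c.2|.
  by rewrite step_atB0 // mulr0.
rewrite derive1_step_at0 ?mul0r //; apply/negP => /andP[? ?]; apply: nz.
rewrite /cube /= norm2_le /= z2 andbT; move: cc1 t't t'0 t0; rewrite !ler_norml; lra.
Qed.

End Bounds.

(** One more derivative is taken off each half of the difference of the mollifiers, so that only the
    derivatives (n + 1, 0) and (n, 1) of [F] appear; both are then estimated by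
    [integral_mul_le]. *)
Lemma bump_step (n : nat) (p N K : R) F g1 g2 c c' (t t' : R) : 1 < p ->
  loc_integrable setT F -> is_distr_deriv setT n.+1 0 F g1 -> is_distr_deriv setT n 1 F g2 ->
  (Lp_norm setT p g1 <= N%:E)%E -> (Lp_norm setT p g2 <= N%:E)%E ->
  (forall x : R, `|derive1 smooth_step x| <= K) -> 0 <= K ->
  0 < t -> t / 2 <= t' -> t' <= t -> `|c - c'| <= t ->
  `|pairing F (iter n pd1 (bump c t)) - pairing F (iter n pd1 (bump c' t'))| <=
  2 * (N * (2 * K / t * ((2 * (2 * t)) ^+ 2) `^ (1 - p^-1))).
Proof.
move=> p1 iF [[mg1 _] D1] [[mg2 _] D2] N1 N2 HK K0 t0 tt' t't cc'.
have t'0 : 0 < t' by apply: lt_le_trans tt'; rewrite divr_gt0.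
have A0 : 0 <= 2 * K / t by rewrite divr_ge0 ?mulr_ge0 // ltW.
have r0 : 0 <= 2 * t by rewrite mulr_ge0 // ltW.
set V1 := bump_diff1 c c' t t'; set V2 := bump_diff2 c c' t t'.
have TS1 : TS V1 by exact: TS_bump_diff1.
have TS2 : TS V2 by exact: TS_bump_diff2.
have V1K z : `|V1 z| <= 2 * K / t by exact: bump_diff1_le.
have V2K z : `|V2 z| <= 2 * K / t by exact: bump_diff2_le.
have V10 z : ~ cube c (2 * t) z -> V1 z = 0 by exact: bump_diff1_0.
have V20 z : ~ cube c (2 * t) z -> V2 z = 0 by exact: bump_diff2_0.
have t1 : test_function setT V1 by exact: (TS_test TS1 V10).
have t2 : test_function setT V2 by exact: (TS_test TS2 V20).
have tb : test_function setT (bump c' t') by exact: test_bump.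
have mTS V : TS V -> measurable_fun setT V.
  by move=> TV; apply: measurable_fun_open_continuous => [|z _]; [exact: openT|exact: TS_continuous].
have E1 := D1 _ t1; have E2 := D2 _ t2.
have b1 : `|pairing F (iter n pd1 (pd1 V1))| <= N * (2 * K / t * ((2 * (2 * t)) ^+ 2) `^ (1 - p^-1)).
  rewrite -lee_fin -abse_EFin -pairingE //; last exact/(test_pd n 0)/test_pd1.
  rewrite (_ : iter n pd1 (pd1 V1) = pd n.+1 0 V1); last by rewrite /pd iterSr.
  rewrite E1 abseM abse_EFin normrX normrN1 expr1n mul1e.
  exact: (integral_mul_le p1 r0 A0 mg1 (mTS _ TS1) V1K V10 N1).
have b2 : `|pairing F (iter n pd1 (pd2 V2))| <= N * (2 * K / t * ((2 * (2 * t)) ^+ 2) `^ (1 - p^-1)).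
  rewrite -lee_fin -abse_EFin -pairingE //; last exact/(test_pd n 0)/test_pd2.
  rewrite (_ : iter n pd1 (pd2 V2) = pd n 1 V2) //.
  rewrite E2 abseM abse_EFin normrX normrN1 expr1n mul1e.
  exact: (integral_mul_le p1 r0 A0 mg2 (mTS _ TS2) V2K V20 N2).
rewrite (bump_diffE c c' t t').
rewrite (@iter_pd1D n (bump c' t') (fun z => pd1 V1 z + pd2 V2 z)); last 2 first.
- exact: TS_bump.
- by apply: TS_add; [exact: TS_pd1|exact: TS_pd2].
rewrite (@iter_pd1D n (pd1 V1) (pd2 V2)); [|exact: TS_pd1|exact: TS_pd2].
have i0 := pairing_integrable iF (test_pd n 0 tb).
have i1 := pairing_integrable iF (test_pd n 0 (test_pd1 t1)).
have i2 := pairing_integrable iF (test_pd n 0 (test_pd2 t2)).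
have [i12 P12] := pairingD i1 i2; have [_ P] := pairingD i0 i12.
rewrite P P12 addrAC subrr add0r; apply: le_trans (ler_normD _ _) _.
by rewrite [leRHS]mulr_natl mulr2n; exact: lerD b1 b2.
Qed.

(** The supremum of the test functions contributes t^(-1) and the area of their cube t^(2 - 2/p). In
    64 = 16 * 4 the factor 4 bounds 4^(1 - 2/p). *)
Lemma bump_step_powR (n : nat) (p N K : R) F g1 g2 c c' (t t' : R) : 2 < p ->
  loc_integrable setT F -> is_distr_deriv setT n.+1 0 F g1 -> is_distr_deriv setT n 1 F g2 ->
  0 <= N -> (Lp_norm setT p g1 <= N%:E)%E -> (Lp_norm setT p g2 <= N%:E)%E ->
  (forall x : R, `|derive1 smooth_step x| <= K) -> 0 <= K ->
  0 < t -> t / 2 <= t' -> t' <= t -> `|c - c'| <= t ->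
  `|pairing F (iter n pd1 (bump c t)) - pairing F (iter n pd1 (bump c' t'))| <=
  64 * K * N * t `^ (1 - 2 / p).
Proof.
move=> p2 iF D1 D2 N0 N1 N2 HK K0 t0 tt' t't cc'.
have p1 : 1 < p by lra.
apply: le_trans (bump_step p1 iF D1 D2 N1 N2 HK K0 t0 tt' t't cc') _.
have pi : 0 < p^-1 by rewrite invr_gt0; lra.
have pi1 : p^-1 < 1 by rewrite invf_lt1; lra.
have t00 := ltW t0; have t40 : 0 <= 4 * t by rewrite mulr_ge0.
rewrite -powR_mulrn ?mulr_ge0 // -powRrM.
have -> : 2%:R * (1 - p^-1) = 1 + (1 - 2 / p) by ring.
have t4 : 2 * (2 * t) = 4 * t by ring.
rewrite t4 powRD; last by apply/implyP => _; rewrite gt_eqF // mulr_gt0.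
rewrite powRr1 // powRM //.
have h4 : (4 : R) `^ (1 - 2 / p) <= 4.
  rewrite -[leRHS]powRr1 //; apply: ler_powR; first by rewrite ler1n.
  by rewrite lerBlDr lerDl mulr_ge0 // ltW.
set T := t `^ _; have T0 : 0 <= T by exact: powR_ge0.
set q := _ `^ _ in h4 *.
have -> : 2 * (N * (2 * K / t * (4 * t * (q * T)))) = 16 * K * N * T * q.
  by field; rewrite gt_eqF.
have -> : 64 * K * N * T = 16 * K * N * T * 4 by ring.
by apply: ler_wpM2l => //; rewrite !mulr_ge0.
Qed.

Lemma half_powR_lt1 (g : R) : 0 < g -> (2^-1 : R) `^ g < 1.
Proof.
move=> g0; have E : 1 `^ g = 1 :> R by rewrite powR1.
rewrite -[ltRHS]E; apply: gt0_ltr_powR => //; rewrite ?nnegrE ?invr_ge0 //.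
by rewrite invf_lt1 // ltr1n.
Qed.

(** A geometric series of ratio 2^(-(1 - 2/p)), which is less than 1 because p > 2. The bound is
    independent of k, so the mollifier may be shrunk at will. *)
Lemma bump_telescope (n : nat) (p N K : R) F g1 g2 c (t : R) k : 2 < p ->
  loc_integrable setT F -> is_distr_deriv setT n.+1 0 F g1 -> is_distr_deriv setT n 1 F g2 ->
  0 <= N -> (Lp_norm setT p g1 <= N%:E)%E -> (Lp_norm setT p g2 <= N%:E)%E ->
  (forall x : R, `|derive1 smooth_step x| <= K) -> 0 <= K -> 0 < t ->
  `|pairing F (iter n pd1 (bump c t)) - pairing F (iter n pd1 (bump c (t / 2 ^+ k)))| <=
  64 * K * N * t `^ (1 - 2 / p) / (1 - 2^-1 `^ (1 - 2 / p)).
Proof.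
move=> p2 iF D1 D2 N0 N1 N2 HK K0.
have g0 : 0 < 1 - 2 / p by rewrite subr_gt0 ltr_pdivrMr ?mul1r //; lra.
have q1 := half_powR_lt1 g0; set q := 2^-1 `^ _ in q1 *.
have q0 : 0 <= q by exact: powR_ge0.
elim: k t => [|k IHk] t t0.
  by rewrite expr0 divr1 subrr normr0 !mulr_ge0 ?powR_ge0 ?invr_ge0 // subr_ge0 ltW.
have t20 : 0 < t / 2 by rewrite divr_gt0.
have -> : t / 2 ^+ k.+1 = t / 2 / 2 ^+ k by rewrite exprS invfM mulrA.
have h1 : `|c - c| <= t by rewrite subrr normr0 ltW.
have h2 : t / 2 <= t by lra.
have H1 := bump_step_powR p2 iF D1 D2 N0 N1 N2 HK K0 t0 (lexx _) h2 h1.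
have H2 := IHk _ t20.
rewrite -(subrKA (pairing F (iter n pd1 (bump c (t / 2))))).
apply: le_trans (ler_normD _ _) _; apply: le_trans (lerD H1 H2) _.
rewrite powRM ?invr_ge0 ?(ltW t0) // -/q.
set T := t `^ _; rewrite le_eqVlt; apply/orP; left; apply/eqP.
by field; rewrite gt_eqF // subr_gt0.
Qed.

Lemma distB_le3 (A B a b u v : R) : `|A - a| <= u -> `|B - b| <= u -> `|A - B| <= v ->
  `|a - b| <= u + u + v.
Proof. by rewrite !ler_norml => *; lra. Qed.

Lemma pairing_bumpB_le (p : R) : 2 < p -> exists2 C, 0 < C &
  forall (n k : nat) (N : R) F g1 g2 x y,
  loc_integrable setT F -> is_distr_deriv setT n.+1 0 F g1 -> is_distr_deriv setT n 1 F g2 ->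
  0 <= N -> (Lp_norm setT p g1 <= N%:E)%E -> (Lp_norm setT p g2 <= N%:E)%E -> x != y ->
  `|pairing F (iter n pd1 (bump x (`|x - y| / 2 ^+ k))) -
    pairing F (iter n pd1 (bump y (`|x - y| / 2 ^+ k)))| <= C * N * `|x - y| `^ (1 - 2 / p).
Proof.
move=> p2; have [K K1 HK] := @derive1_step_bounded R.
have K0 : 0 <= K by apply: le_trans K1.
have g0 : 0 < 1 - 2 / p by rewrite subr_gt0 ltr_pdivrMr ?mul1r //; lra.
have q1 := half_powR_lt1 g0; set q := 2^-1 `^ _ in q1 *.
have q10 : 0 < (1 - q)^-1 by rewrite invr_gt0 subr_gt0.
exists (64 * K * (1 + 2 / (1 - q))).
  by rewrite !mulr_gt0 //; [lra|rewrite addr_gt0 ?mulr_gt0].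
move=> n k N F g1 g2 x y iF D1 D2 N0 N1 N2 xy.
set t := `|x - y|; have t0 : 0 < t by rewrite normr_gt0 subr_eq0.
have h2 : t / 2 <= t by lra.
have H1 := bump_telescope x k p2 iF D1 D2 N0 N1 N2 HK K0 t0.
have H2 := bump_telescope y k p2 iF D1 D2 N0 N1 N2 HK K0 t0.
have H3 := bump_step_powR p2 iF D1 D2 N0 N1 N2 HK K0 t0 h2 (lexx _) (lexx t : `|x - y| <= t).
rewrite -/q in H1 H2; apply: le_trans (distB_le3 H1 H2 H3) _.
set T := t `^ _; rewrite le_eqVlt; apply/orP; left; apply/eqP.
by field; rewrite gt_eqF // subr_gt0.
Qed.

End Telescoping.

(** * Lower bound for the norm of an extension *)

Section LowerBound.
Context {R : realType}.
Implicit Types (z c : R * R) (F P f g h V phi psi : R * R -> R) (Omega : set (R * R)).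
Local Notation mu2 := (@lebesgue2 R).

Lemma pairing_ae (V : set (R * R)) F f phi : loc_integrable setT F -> measurable_fun setT f ->
  test_function V phi -> {ae mu2, forall z, V z -> F z = f z} ->
  (\int[mu2]_z (F z * phi z)%:E = \int[mu2]_z (f z * phi z)%:E)%E.
Proof.
move=> [mF _] mf tphi Ff.
have mphi : measurable_fun setT phi.
  by apply: measurable_fun_open_continuous => [|z _]; [exact: openT|exact: test_continuous tphi z].
apply: ae_eq_integral => //.
- by apply/measurable_EFinP; exact: measurable_funM.
- by apply/measurable_EFinP; exact: measurable_funM.
case: Ff => N [mN N0 sN]; exists N; split=> // z nz; apply: sN => /= Vz; apply: nz => _.
have [Sz|/notin_support0 ->] := pselect (Defs.support phi z); last by rewrite !mulr0.
by rewrite Vz //; case: tphi => _ _; apply.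
Qed.

Lemma TS_locTS Omega P : TS P -> locTS Omega P.
Proof. by move=> TSP z _; exists P => //; apply: (@filterE _ (nbhs z)). Qed.

Lemma cube_sub_near c (S : set (R * R)) : nbhs c S -> exists2 e : R, 0 < e & cube c e `<=` S.
Proof.
move=> /nbhs_ballP[e /= e0 eS]; exists (e / 2); first by rewrite divr_gt0.
move=> z cz; apply: eS; rewrite -ball_normE /ball_ /= distrC.
by apply: le_lt_trans cz _; rewrite ltr_pdivrMr // ltr_pMr // ltr1n.
Qed.

Lemma exists_half_pow (t e : R) : 0 < e -> exists k : nat, t / 2 ^+ k <= e.
Proof.
move=> e0; exists (Num.truncn (t / e)).+1; rewrite ler_pdivrMr ?exprn_gt0 // mulrC -ler_pdivrMr //.
apply: le_trans (ltW (truncnS_gt (t / e))) _.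
by rewrite -natrX ler_nat ltnW // ltn_expl.
Qed.

(** The scale is taken so small that the mollifiers live where [F] agrees almost everywhere with 0
    near x and with [P] near y. The first pairing is then 0, and the second is a up to sign, as the
    mollifier has integral 1. *)
Lemma extension_lower_bound (p : R) : 2 < p -> exists2 C, 0 < C &
  forall (n : nat) (N a : R) Omega f F P g1 g2 x y,
  loc_integrable setT F -> is_distr_deriv setT n.+1 0 F g1 -> is_distr_deriv setT n 1 F g2 ->
  0 <= N -> (Lp_norm setT p g1 <= N%:E)%E -> (Lp_norm setT p g2 <= N%:E)%E ->
  open Omega -> Omega x -> Omega y -> x != y ->
  {ae mu2, forall z, Omega z -> F z = f z} ->
  (\forall z \near x, f z = 0) -> (\forall z \near y, f z = P z) ->
  TS P -> iter n pd1 P = cst a ->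
  `|a| <= C * N * `|x - y| `^ (1 - 2 / p).
Proof.
move=> p2; have [C C0 HC] := pairing_bumpB_le p2; exists C => //.
move=> n N a Omega f F P g1 g2 x y iF D1 D2 N0 N1 N2 oO Ox Oy xy Ff fx fy TSP Pa.
have nx : nbhs x [set z | Omega z /\ f z = 0].
  by apply: filterI fx; exact: open_nbhs_nbhs.
have ny : nbhs y [set z | Omega z /\ f z = P z].
  by apply: filterI fy; exact: open_nbhs_nbhs.
have [ex ex0 Hx] := cube_sub_near nx; have [ey ey0 Hy] := cube_sub_near ny.
have t0 : 0 < `|x - y| by rewrite normr_gt0 subr_eq0.
have e0 : 0 < Num.min ex ey by rewrite lt_min ex0.
have [k] := exists_half_pow `|x - y| e0; rewrite le_min => /andP[kx ky].
have := HC n k N F g1 g2 x y iF D1 D2 N0 N1 N2 xy.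
set t := `|x - y| / 2 ^+ k in kx ky *.
have tt : 0 < t by rewrite divr_gt0 // exprn_gt0.
have subx : cube x t `<=` cube x ex by move=> z; rewrite /cube /= => /le_trans; apply.
have suby : cube y t `<=` cube y ey by move=> z; rewrite /cube /= => /le_trans; apply.
have tx : test_function (cube x ex) (bump x t) by exact: test_bump.
have ty : test_function (cube y ey) (bump y t) by exact: test_bump.
have -> : pairing F (iter n pd1 (bump x t)) = 0.
  rewrite /pairing (pairing_ae iF (f := cst 0) _ (test_pd n 0 tx)).
  - by rewrite integral0_eq // => z _; rewrite mul0r.
  - exact: measurable_cst.
  case: Ff => M [mM M0 sM]; exists M; split=> // z nz; apply: sM => /= Fz; apply: nz => cz.
  by have [Oz fz] := Hx _ cz; rewrite Fz.
have -> : pairing F (iter n pd1 (bump y t)) = (-1) ^+ n * a.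
  have mP : measurable_fun setT P.
    by apply: measurable_fun_open_continuous => [|z _]; [exact: openT|exact: TS_continuous].
  rewrite /pairing (pairing_ae iF mP (test_pd n 0 ty)); last first.
    case: Ff => M [mM M0 sM]; exists M; split=> // z nz; apply: sM => /= Fz; apply: nz => cz.
    by have [Oz fz] := Hy _ cz; rewrite Fz.
  have tyT : test_function setT (bump y t) by exact: test_bump.
  have lP : locTS setT P by exact: TS_locTS.
  rewrite (by_parts_iter1 n lP tyT) Pa.
  under eq_integral do rewrite EFinM.
  rewrite (@integralZl _ _ _ mu2 _ measurableT _ (integrable_bump y tt)).
  by rewrite integral_bump // mule1 -EFinM.
by rewrite sub0r normrN normrM normrX normrN1 expr1n mul1r.
Qed.

End LowerBound.

(** * Barrier functions and their energy *)

Section ScaledBounds.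
Context {R : realType}.
Implicit Types (a b f g : R -> R) (A B s t x c : R) (k n : nat).

(** All derivatives up to order k at the single point [x], each weighted by the power of the length
    scale [s] that makes the bound stable under products. *)
Definition scaled_bound k A s a x := forall j, (j <= k)%N -> `|derive1n j a x| * s ^+ j <= A.

Lemma scaled_bound_ge0 k A s a x : scaled_bound k A s a x -> 0 <= A.
Proof. by move=> /(_ 0%N isT); rewrite expr0 mulr1; apply: le_trans. Qed.

Lemma derive1nSr a n : derive1n n.+1 a = derive1n n (derive1 a).
Proof. by elim: n => // n IHn; rewrite derive1nS IHn. Qed.

Lemma derive1nDE n f g : smooth1 f -> smooth1 g ->
  derive1n n (fun x => f x + g x) = (fun x => derive1n n f x + derive1n n g x).
Proof.
elim: n => // n IHn Hf Hg; rewrite !derive1nS IHn // derive1DE //; exact: smooth1_derive1n.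
Qed.

(** Leibniz's rule by induction on the order: the derivative of a function with bound A has bound A
    / s one order lower, and the two summands double the constant at each step. *)
Lemma scaled_boundM k A B s a b x : 0 < s -> smooth1 a -> smooth1 b ->
  scaled_bound k A s a x -> scaled_bound k B s b x ->
  scaled_bound k (2 ^+ k * A * B) s (fun x => a x * b x) x.
Proof.
move=> s0 Ha Hb HA HB j jk.
have A0 := scaled_bound_ge0 HA; have B0 := scaled_bound_ge0 HB.
apply: (@le_trans _ _ (2 ^+ j * A * B)); last first.
  by rewrite ler_wpM2r // ler_wpM2r // ler_weXn2l // ler1n.
have {}HA : scaled_bound j A s a x by move=> i ij; apply: HA; exact: leq_trans jk.
have {}HB : scaled_bound j B s b x by move=> i ij; apply: HB; exact: leq_trans jk.
elim: j a b A B Ha Hb A0 B0 HA HB {jk} => [|j IHj] a b A B Ha Hb A0 B0 HA HB.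
  rewrite /= expr0 !mulr1 mul1r normrM; apply: ler_pM => //.
    by have := HA 0%N isT; rewrite expr0 mulr1.
  by have := HB 0%N isT; rewrite expr0 mulr1.
have Ha' := smooth1_derive1 Ha; have Hb' := smooth1_derive1 Hb.
rewrite derive1nSr derive1ME // derive1nDE; [|exact: smooth1M|exact: smooth1M].
have H1 : `|derive1n j (fun x => a x * derive1 b x) x| * s ^+ j <= 2 ^+ j * A * (B / s).
  apply: IHj => //; first by rewrite divr_ge0 // ltW.
    by move=> i ij; apply: HA; exact: leqW.
  move=> i ij; rewrite ler_pdivlMr // -mulrA -exprSr -derive1nSr.
  by apply: HB.
have H2 : `|derive1n j (fun x => b x * derive1 a x) x| * s ^+ j <= 2 ^+ j * B * (A / s).
  apply: IHj => //; first by rewrite divr_ge0 // ltW.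
    by move=> i ij; apply: HB; exact: leqW.
  move=> i ij; rewrite ler_pdivlMr // -mulrA -exprSr -derive1nSr.
  by apply: HA.
rewrite exprSr mulrA -ler_pdivlMr //.
have -> : 2 ^+ j.+1 * A * B / s = 2 ^+ j * A * (B / s) + 2 ^+ j * B * (A / s).
  by rewrite exprS; field; rewrite gt_eqF.
apply: le_trans (lerD H1 H2); rewrite -mulrDl ler_wpM2r ?exprn_ge0 ?(ltW s0) //.
exact: ler_normD.
Qed.

Lemma derive1n_subM n f (c t : R) : smooth1 f ->
  derive1n n (fun x => f ((x - c) / t)) = (fun x => t^-1 ^+ n * derive1n n f ((x - c) / t)).
Proof.
move=> Hf; elim: n => [|n IHn]; first by apply/funext => x; rewrite expr0 mul1r.
have Hn := smooth1_derive1n n Hf.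
rewrite derive1nS IHn derive1ZE; last exact: smooth1_subM.
by rewrite derive1_subM //; apply/funext => x; rewrite exprSr mulrA derive1nS.
Qed.

Lemma scaled_bound_subM k K L s t c f x : smooth1 f -> 0 < t -> 0 <= s -> 1 <= L -> s <= L * t ->
  (forall j, (j <= k)%N -> forall x, `|derive1n j f x| <= K) ->
  scaled_bound k (L ^+ k * K) s (fun x => f ((x - c) / t)) x.
Proof.
move=> Hf t0 s0 L1 st HK j jk; rewrite derive1n_subM // normrM normrX gtr0_norm ?invr_gt0 //.
have K0 : 0 <= K by apply: le_trans (HK _ jk x).
rewrite mulrAC -exprMn; apply: ler_pM => //; [| |exact: HK].
  by rewrite exprn_ge0 // mulr_ge0 // invr_ge0 ltW.
apply: (@le_trans _ _ (L ^+ j)); last exact: ler_weXn2l.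
by apply: lerXn2r; rewrite ?nnegrE ?mulr_ge0 ?invr_ge0 ?(ltW t0) //;
  [lra|rewrite mulrC ler_pdivrMr].
Qed.

Lemma derive1_sub_cst c : derive1 (fun x => x - c) = (fun _ : R => 1 : R).
Proof. by apply/funext => y; rewrite derive1E deriveB // derive_id derive_cst subr0. Qed.

Lemma derive1n_cst (c : R) n x : derive1n n.+1 (fun=> c) x = 0.
Proof.
elim: n x => [|n IHn] x; first by rewrite /= derive1_cst.
by rewrite derive1nS (_ : derive1n n.+1 _ = (fun _ : R => 0 : R)) ?derive1_cst //; exact/funext.
Qed.

Lemma scaled_bound_sub k A s c x : 0 < s -> s <= A -> `|x - c| <= A ->
  scaled_bound k A s (fun x => x - c) x.
Proof.
move=> s0 sA xA [|[|j]] _; first by rewrite /= expr0 mulr1.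
  by rewrite expr1 derive1nSr derive1_sub_cst /= normr1 mul1r.
by rewrite derive1nSr derive1_sub_cst derive1n_cst normr0 mul0r (le_trans (ltW s0)).
Qed.

Lemma smooth1_sub_cst c : smooth1 (fun x => x - c).
Proof. by apply: smooth1D; [exact: smooth1_id|exact: smooth1_cst]. Qed.

Lemma scaled_bound_pow k A s c n x : 0 < s -> s <= A -> `|x - c| <= A ->
  scaled_bound k ((2 ^+ k * A) ^+ n) s (fun x => (x - c) ^+ n) x.
Proof.
move=> s0 sA xA; elim: n => [|n IHn].
  move=> [|j] _; first by rewrite /= !expr0 normr1 mulr1.
  rewrite (_ : (fun x => _) = (fun _ : R => 1 : R)); last by apply/funext => y; rewrite expr0.
  by rewrite derive1n_cst normr0 mul0r exprn_ge0 // mulr_ge0 // (le_trans (ltW s0)).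
rewrite exprS (_ : (fun x => _) = (fun x => (x - c) * (x - c) ^+ n)); last first.
  by apply/funext => y; rewrite exprS.
apply: scaled_boundM => //; [exact: smooth1_sub_cst|exact/smooth1X/smooth1_sub_cst|].
exact: scaled_bound_sub.
Qed.

Lemma plateau_bounded k : exists2 K, 1 <= K & forall j, (j <= k)%N ->
  forall x : R, `|derive1n j plateau x| <= K.
Proof.
have p0 (x : R) : 7 / 4 < `|x| -> plateau x = 0 by move=> /ltW; exact: plateau0.
have r0 : 0 <= 7 / 4 :> R by lra.
elim: k => [|k [K K1 HK]].
  have [K K1 HK] := smooth1_compact_bounded 0 r0 (@smooth1_plateau R) p0.
  by exists K => // j; rewrite leqn0 => /eqP ->.
have [K' K'1 HK'] := smooth1_compact_bounded k.+1 r0 (@smooth1_plateau R) p0.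
exists (Num.max K K'); first by rewrite le_max K1.
move=> j; rewrite leq_eqVlt => /orP[/eqP ->|jk] x; first by rewrite le_max HK' orbT.
by rewrite le_max HK.
Qed.

End ScaledBounds.

Section Cutoffs.
Context {R : realType}.
Implicit Types (z c o w : R * R) (f g : R * R -> R) (s t r rho : R).

Definition cutoff c t w : R := plateau ((w.1 - c.1) / t) * plateau ((w.2 - c.2) / t).

Lemma cutoff1 c t w : 0 < t -> `|w - c| <= 5 / 4 * t -> cutoff c t w = 1.
Proof.
move=> t0; rewrite norm2_le /= => /andP[h1 h2].
by rewrite /cutoff !plateau1 ?mulr1 // normrM normfV (gtr0_norm t0) ler_pdivrMr.
Qed.

Lemma cutoff0 c t w : 0 < t -> 7 / 4 * t <= `|w - c| -> cutoff c t w = 0.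
Proof.
move=> t0 h; have : (7 / 4 * t <= `|w.1 - c.1|) || (7 / 4 * t <= `|w.2 - c.2|).
  rewrite leNgt [X in _ || X]leNgt -negb_and; apply/negP => nh.
  by move: h; rewrite leNgt norm2_lt nh.
by move=> /orP[] h'; rewrite /cutoff; [rewrite plateau0 ?mul0r //|rewrite [X in _ * X]plateau0 ?mulr0 //];
  rewrite normrM normfV (gtr0_norm t0) ler_pdivlMr.
Qed.

Lemma iter_pd1_tensor i (a b : R -> R) : smooth1 a ->
  iter i pd1 (fun z => a z.1 * b z.2) = (fun z => derive1n i a z.1 * b z.2).
Proof.
move=> Ha; elim: i => [//|i IHi].
by rewrite iterS IHi pd1_tensor; [rewrite derive1nS|exact: smooth1_derive1n].
Qed.

Lemma iter_pd2_tensor j (a b : R -> R) : smooth1 b ->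
  iter j pd2 (fun z => a z.1 * b z.2) = (fun z => a z.1 * derive1n j b z.2).
Proof.
move=> Hb; elim: j => [//|j IHj].
by rewrite iterS IHj pd2_tensor; [rewrite derive1nS|exact: smooth1_derive1n].
Qed.

Lemma pd21_tensor i j (a b : R -> R) : smooth1 a -> smooth1 b ->
  pd21 i j (fun z => a z.1 * b z.2) = (fun z => derive1n i a z.1 * derive1n j b z.2).
Proof. by move=> Ha Hb; rewrite /pd21 iter_pd1_tensor // iter_pd2_tensor. Qed.

Lemma pd21_tensor_le k i j A B s (a b : R -> R) w : smooth1 a -> smooth1 b -> 0 < s ->
  (i <= k)%N -> (j <= k)%N -> scaled_bound k A s a w.1 -> scaled_bound k B s b w.2 ->
  `|pd21 i j (fun z => a z.1 * b z.2) w| <= A * B / s ^+ (i + j).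
Proof.
move=> Ha Hb s0 ik jk HA HB; rewrite pd21_tensor // normrM exprD ler_pdivlMr ?mulr_gt0 ?exprn_gt0 //.
by rewrite mulrACA; apply: ler_pM; rewrite ?mulr_ge0 ?exprn_ge0 ?(ltW s0) ?HA ?HB.
Qed.

(* [w.1 - z.1] to the power n has vanishing derivatives of order n + 1, so these terms carry
   derivatives of order n + 1 only where a cut-off function varies. *)
Definition far_term n o rho z w : R := cutoff o (rho / 2) w * (w.1 - z.1) ^+ n.

Definition near_term n o rho z r w : R := far_term n o rho z w * cutoff z r w.

Lemma far_termE n o rho z : far_term n o rho z =
  (fun w => (fun x => plateau ((x - o.1) / (rho / 2)) * (x - z.1) ^+ n) w.1 *
            (fun x => plateau ((x - o.2) / (rho / 2))) w.2).
Proof. by apply/funext => w; rewrite /far_term /cutoff mulrAC. Qed.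

Lemma near_termE n o rho z r : near_term n o rho z r =
  (fun w => (fun x => plateau ((x - o.1) / (rho / 2)) * (x - z.1) ^+ n * plateau ((x - z.1) / r)) w.1 *
            (fun x => plateau ((x - o.2) / (rho / 2)) * plateau ((x - z.2) / r)) w.2).
Proof. by apply/funext => w; rewrite /near_term far_termE /cutoff mulrACA. Qed.

Let smooth_far (c t d : R) n : smooth1 (fun x : R => plateau ((x - c) / t) * (x - d) ^+ n).
Proof. by apply: smooth1M; [exact/smooth1_subM/smooth1_plateau|exact/smooth1X/smooth1_sub_cst]. Qed.

Lemma TS_far_term n o rho z : TS (far_term n o rho z).
Proof.
by rewrite far_termE; exact: (TS_mul (smooth_far _ _ _ _) (smooth1_subM _ _ (@smooth1_plateau R))).
Qed.

Lemma TS_near_term n o rho z r : TS (near_term n o rho z r).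
Proof.
have sP (c t : R) := smooth1_subM c t (@smooth1_plateau R).
by rewrite near_termE; exact: (TS_mul (smooth1M (smooth_far _ _ _ _) (sP _ _)) (smooth1M (sP _ _) (sP _ _))).
Qed.

(** At scale s, which is rho for the far term and r for the near term, the power contributes s^n and
    the n + 1 derivatives s^(-n - 1), which leaves 1 / s. The number 6 compares r with the scale of
    the outer cut-off: r <= 3 rho = 6 (rho / 2). *)
Lemma cutoff_terms_le n : exists2 C, 0 < C & forall i j o rho z r w, (i + j = n.+1)%N ->
  0 < r -> r <= 3 * rho -> `|z - o| <= rho -> `|w - o| <= rho ->
  `|pd21 i j (far_term n o rho z) w| <= C / rho /\
  (`|w - z| <= 2 * r -> `|pd21 i j (near_term n o rho z r) w| <= C / r).
Proof.
have [K K1 HK] := @plateau_bounded R n.+1.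
have K0 : 0 < K by apply: lt_le_trans K1.
have six1 : 1 <= 6 :> R by rewrite ler1n.
have two1 : 1 <= 2 :> R by rewrite ler1n.
set k := n.+1 in HK.
have H1 (c t s L x : R) : 0 < t -> 0 <= s -> 1 <= L -> s <= L * t ->
    scaled_bound k (L ^+ k * K) s (fun x => plateau ((x - c) / t)) x.
  by move=> t0 s0 L1 st; apply: (scaled_bound_subM c x (@smooth1_plateau R) t0 s0 L1 st HK).
pose C1 := (2 ^+ k * (2 ^+ k * K) * (2 ^+ k * 2) ^+ n) * (2 ^+ k * K).
pose C2 := (2 ^+ k * (2 ^+ k * (6 ^+ k * K) * (2 ^+ k * 2) ^+ n) * (1 ^+ k * K)) *
  (2 ^+ k * (6 ^+ k * K) * (1 ^+ k * K)).
have C10 : 0 < C1 by rewrite /C1 !mulr_gt0 ?exprn_gt0 // !mulr_gt0 ?exprn_gt0.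
have C20 : 0 < C2 by rewrite /C2 !mulr_gt0 ?exprn_gt0 // !mulr_gt0 ?exprn_gt0.
exists (C1 + C2); first exact: addr_gt0.
move=> i j o rho z r w ij r0 r3 zo wo.
have rho0 : 0 < rho by lra.
have t0 : 0 < rho / 2 by rewrite divr_gt0.
have ik : (i <= k)%N by rewrite /k -ij leq_addr.
have jk : (j <= k)%N by rewrite /k -ij leq_addl.
have sP (c t : R) := smooth1_subM c t (@smooth1_plateau R).
have scale (C s : R) : 0 < s -> C * (s ^+ n) / s ^+ n.+1 = C / s.
  by move=> s0; rewrite exprSr invfM mulrA mulfK // gt_eqF // exprn_gt0.
have wz1 : `|w.1 - z.1| <= 2 * rho.
  move: zo wo; rewrite !norm2_le => /andP[+ _] /andP[+ _]; rewrite !ler_norml /=; lra.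
split.
  apply: (@le_trans _ _ (C1 / rho)); last by rewrite ler_pM2r ?invr_gt0 // lerDl ltW.
  rewrite far_termE.
  have HA : scaled_bound k (2 ^+ k * (2 ^+ k * K) * (2 ^+ k * (2 * rho)) ^+ n) rho
      (fun x => plateau ((x - o.1) / (rho / 2)) * (x - z.1) ^+ n) w.1.
    apply: scaled_boundM => //; [exact/smooth1X/smooth1_sub_cst|apply: H1 => //; lra|].
    by apply: scaled_bound_pow => //; lra.
  have HB : scaled_bound k (2 ^+ k * K) rho (fun x => plateau ((x - o.2) / (rho / 2))) w.2.
    by apply: H1 => //; lra.
  apply: le_trans (pd21_tensor_le (smooth_far _ _ _ _) (sP _ _) rho0 ik jk HA HB) _.
  rewrite ij -(scale C1 _ rho0) /C1 [2 ^+ k * (2 * rho)]mulrA [(2 ^+ k * 2 * rho) ^+ n]exprMn.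
  by rewrite le_eqVlt; apply/orP; left; apply/eqP; congr (_ / _); ring.
move=> wz.
apply: (@le_trans _ _ (C2 / r)); last by rewrite ler_pM2r ?invr_gt0 // lerDr ltW.
rewrite near_termE.
have HA : scaled_bound k (2 ^+ k * (2 ^+ k * (6 ^+ k * K) * (2 ^+ k * (2 * r)) ^+ n) * (1 ^+ k * K)) r
    (fun x => plateau ((x - o.1) / (rho / 2)) * (x - z.1) ^+ n * plateau ((x - z.1) / r)) w.1.
  apply: scaled_boundM => //; last by apply: H1 => //; lra.
  apply: scaled_boundM => //; [exact/smooth1X/smooth1_sub_cst|apply: H1 => //; lra|].
  apply: scaled_bound_pow => //; first lra.
  by move: wz; rewrite norm2_le => /andP[].
have HB : scaled_bound k (2 ^+ k * (6 ^+ k * K) * (1 ^+ k * K)) r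
    (fun x => plateau ((x - o.2) / (rho / 2)) * plateau ((x - z.2) / r)) w.2.
  by apply: scaled_boundM => //; apply: H1 => //; lra.
apply: le_trans (pd21_tensor_le (smooth1M (smooth_far _ _ _ _) (sP _ _)) (smooth1M (sP _ _) (sP _ _)) r0 ik jk HA HB) _.
rewrite ij -(scale C2 _ r0) /C2 [2 ^+ k * (2 * r)]mulrA [(2 ^+ k * 2 * r) ^+ n]exprMn.
by rewrite le_eqVlt; apply/orP; left; apply/eqP; congr (_ / _); ring.
Qed.

End Cutoffs.

(** * Barrier functions of separating cubes *)

Section Barriers.
Context {R : realType}.
Implicit Types (z o w x y v : R * R) (f g G : R * R -> R) (r rho : R) (U V Omega : set (R * R)).

Lemma near_pd21 i j f g w : (\forall v \near w, f v = g v) ->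
  \forall v \near w, pd21 i j f v = pd21 i j g v.
Proof.
move=> fg; have fg1 : \forall v \near w, iter i pd1 f v = iter i pd1 g v.
  elim: i => //= i IHi; move/near_join: IHi; apply: filterS => v; exact: pd1_near.
rewrite /pd21; elim: j => //= j IHj; move/near_join: IHj; apply: filterS => v; exact: pd2_near.
Qed.

Lemma pd21_near i j f g w : (\forall v \near w, f v = g v) -> pd21 i j f w = pd21 i j g w.
Proof. by move=> /(near_pd21 i j)/nbhs_singleton. Qed.

Lemma pd21_cst0 i j w : pd21 i j (fun=> 0) w = 0 :> R.
Proof.
rewrite (_ : (fun=> 0) = (fun z : R * R => (cst 0 : R -> R) z.1 * (cst 0 : R -> R) z.2)); last first.
  by apply/funext => z /=; rewrite mulr0.
rewrite (@pd21_tensor _ i j (cst 0) (cst 0)); [|exact: smooth1_cst|exact: smooth1_cst].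
by case: i => [|i]; [rewrite mul0r|rewrite derive1n_cst mul0r].
Qed.

Lemma pd21D i j f g : TS f -> TS g ->
  pd21 i j (fun w => f w + g w) = (fun w => pd21 i j f w + pd21 i j g w).
Proof.
move=> Hf Hg; rewrite /pd21 iter_pd1D //.
have := TS_iter_pd1 i Hf; have := TS_iter_pd1 i Hg.
move: (iter i pd1 f) (iter i pd1 g) => {Hf Hg} {}f {}g Hg Hf.
have TS2 k h : TS h -> TS (iter k pd2 h) by elim: k => //= k IHk Hh; exact/TS_pd2/IHk.
by elim: j => //= j IHj; rewrite IHj pd2D //; exact: TS2.
Qed.

Lemma pd21Z i j (a : R) f : TS f -> pd21 i j (fun w => a * f w) = (fun w => a * pd21 i j f w).
Proof.
elim=> [b c Hb Hc|{}f g Hf IHf Hg IHg].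
  have -> : (fun z : R * R => a * (b z.1 * c z.2)) = (fun z => (fun t => a * b t) z.1 * c z.2).
    by apply/funext => z; rewrite mulrA.
  rewrite (pd21_tensor i j (smooth1Z a Hb) Hc) (pd21_tensor i j Hb Hc).
  apply/funext => z; rewrite mulrA; congr (_ * _).
  elim: i (z.1) => //= i IHi t; rewrite (_ : derive1n i _ = (fun t => a * derive1n i b t)).
    by rewrite derive1ZE //; exact: smooth1_derive1n.
  exact/funext.
have -> : (fun z => a * (f z + g z)) = (fun z => a * f z + a * g z).
  by apply/funext => z; rewrite mulrDr.
have TSZ h : TS h -> TS (fun z => a * h z) by move=> Hh; apply: TS_M => //; exact: TS_cst.
rewrite !pd21D //; [|exact: TSZ|exact: TSZ].
by rewrite IHf IHg; apply/funext => z; rewrite mulrDr.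
Qed.

Lemma pd21_sum_le i j (s : seq nat) (a : nat -> R) (h : nat -> R * R -> R) w :
  (forall k, TS (h k)) ->
  `|pd21 i j (fun w => \sum_(k <- s) a k * h k w) w| <= \sum_(k <- s) `|a k| * `|pd21 i j (h k) w|.
Proof.
move=> Hh; elim: s => [|k s IHs].
  by rewrite big_nil (_ : (fun _ => _) = (fun=> 0)) ?pd21_cst0 ?normr0 //;
    apply/funext => v; rewrite big_nil.
have -> : (fun w => \sum_(k <- k :: s) a k * h k w) =
    (fun w => a k * h k w + \sum_(k <- s) a k * h k w).
  by apply/funext => v; rewrite big_cons.
have TSZ l : TS (fun z => a l * h l z) by apply: TS_M => //; exact: TS_cst.
rewrite pd21D //; last by apply: TS_sum.
rewrite big_cons pd21Z //; apply: le_trans (ler_normD _ _) _.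
by rewrite normrM lerD2l.
Qed.

Definition outside U z r : set (R * R) := [set v | U v /\ r < `|v - z|].

(** The difference of the two terms is the far term times 1 - [cutoff z r]. This factor vanishes
    near the closed cube and hides the jump of the indicator at its frontier; the cut-off around [o]
    hides the jumps at the sphere. *)
Definition barrier U y n o rho z r w : R :=
  (far_term n o rho z w - near_term n o rho z r w) * (`[< joined (outside U z r) y w >])%:R.

Lemma near_cutoff1 c r w : 0 < r -> `|w - c| < 5 / 4 * r -> \forall v \near w, cutoff c r v = 1.
Proof.
move=> r0 wc; have : \forall v \near w, `|v - c| < 5 / 4 * r.
  have cn : {for w, continuous (fun v => `|v - c|)}.
    by apply: cvg_norm; apply: cvgB; [exact: cvg_id|exact: cvg_cst].
  exact: (cn _ (lt_nbhsl wc)).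
by apply: filterS => v /ltW; exact: cutoff1.
Qed.

Lemma near_cutoff0 c r w : 0 < r -> 7 / 4 * r < `|w - c| -> \forall v \near w, cutoff c r v = 0.
Proof.
move=> r0 wc; have : \forall v \near w, 7 / 4 * r < `|v - c|.
  have cn : {for w, continuous (fun v => `|v - c|)}.
    by apply: cvg_norm; apply: cvgB; [exact: cvg_id|exact: cvg_cst].
  exact: (cn _ (lt_nbhsr wc)).
by apply: filterS => v /ltW; exact: cutoff0.
Qed.

Lemma open_outside U z r : open U -> open (outside U z r).
Proof.
move=> oU.
have cn : continuous (fun v => `|v - z|).
  by move=> w; apply: cvg_norm; apply: cvgB; [exact: cvg_id|exact: cvg_cst].
have H : open ((fun v => `|v - z|) @^-1` [set t | r < t]).
  by apply: open_comp => [v _|]; [exact: cn|exact: open_gt].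
exact: openI oU H.
Qed.

Lemma near_joined V y w : open V -> V w ->
  \forall v \near w, `[< joined V y v >] = `[< joined V y w >].
Proof.
move=> oV Vw; have /nbhs_ballP[e /= e0 eV] := open_nbhs_nbhs (conj oV Vw).
have eV' u : `|w - u| < e -> V u by move=> wu; apply: eV; rewrite -ball_normE.
apply/nbhs_ballP; exists e => // v; rewrite -ball_normE /ball_ /= => wv.
have wjv : joined V w v by exact: joined_ball wv.
apply/asboolP/asboolP => H; apply: joined_trans H _ => //; exact: joined_sym.
Qed.

Lemma near_barrier U y n o rho z r w : open U -> U w -> 0 < r ->
  \forall v \near w, barrier U y n o rho z r v =
    ((r < `|w - z|) && `[< joined (outside U z r) y w >])%:R *
      (far_term n o rho z v - near_term n o rho z r v).
Proof.
move=> oU Uw r0; have [wz|wz] := ltrP r `|w - z|.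
  have := near_joined y (@open_outside U z r oU) (conj Uw wz : outside U z r w).
  by apply: filterS => v E; rewrite /barrier E mulrC.
have : \forall v \near w, cutoff z r v = 1.
  apply: near_cutoff1 => //; apply: le_lt_trans wz _; lra.
by apply: filterS => v E; rewrite /barrier /near_term E mulr1 subrr mul0r mulr0.
Qed.

Definition barrier_sum U y n o rho (s : seq nat) (z : nat -> R * R) (r c : nat -> R) w : R :=
  \sum_(i <- s) c i * barrier U y n o rho (z i) (r i) w.

Lemma near_sum (s : seq nat) (F G : nat -> R * R -> R) w :
  (forall i, i \in s -> \forall v \near w, F i v = G i v) ->
  \forall v \near w, \sum_(i <- s) F i v = \sum_(i <- s) G i v.
Proof.
elim: s => [|i s IHs] H; first by apply: filterS filterT => v _; rewrite !big_nil.
have H1 := H i (mem_head i s).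
have H2 : \forall v \near w, \sum_(i <- s) F i v = \sum_(i <- s) G i v.
  by apply: IHs => j js; apply: H; rewrite in_cons js orbT.
by apply: filterS2 H1 H2 => v; rewrite !big_cons => -> ->.
Qed.

Section BarrierSum.
Variables (Omega : set (R * R)) (y o : R * R) (n : nat) (rho : R).
Variables (s : seq nat) (z : nat -> R * R) (r c : nat -> R).
Hypotheses (oO : open Omega) (rho0 : 0 < rho).
Hypotheses (r0 : forall i, i \in s -> 0 < r i) (r3 : forall i, i \in s -> r i <= 3 * rho).
Hypotheses (zo : forall i, i \in s -> `|z i - o| <= rho) (c0 : forall i, i \in s -> 0 <= c i).

Let U := [set w | Omega w /\ `|w - o| < rho].
Let f := barrier_sum U y n o rho s z r c.

Lemma open_ball_inter : open U.
Proof.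
have cn : continuous (fun v => `|v - o|).
  by move=> w; apply: cvg_norm; apply: cvgB; [exact: cvg_id|exact: cvg_cst].
have H : open ((fun v => `|v - o|) @^-1` [set t | t < rho]).
  by apply: open_comp => [v _|]; [exact: cn|exact: open_lt].
exact: openI oO H.
Qed.

Lemma near_barrier_sum0 w : rho <= `|w - o| -> \forall v \near w, f v = 0.
Proof.
move=> wo; have : \forall v \near w, cutoff o (rho / 2) v = 0.
  by apply: near_cutoff0; rewrite ?divr_gt0 //; have := rho0; lra.
apply: filterS => v E; apply: big1 => i _.
by rewrite /barrier /near_term /far_term E !mul0r subr0 mul0r mulr0.
Qed.

Let b w i : R := ((r i < `|w - z i|) && `[< joined (outside U (z i) (r i)) y w >])%:R.

Lemma near_barrier_sum w : U w -> \forall v \near w,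
  f v = \sum_(i <- s) (c i * b w i) * (far_term n o rho (z i) v - near_term n o rho (z i) (r i) v).
Proof.
move=> Uw; apply: (@near_sum s (fun i v => c i * barrier U y n o rho (z i) (r i) v)) => i si.
have := near_barrier y n o rho (z i) open_ball_inter Uw (r0 si).
by apply: filterS => v ->; rewrite mulrA.
Qed.

Lemma TS_far_near i : TS (fun v => far_term n o rho (z i) v - near_term n o rho (z i) (r i) v).
Proof.
rewrite (_ : (fun v => _) = (fun v => far_term n o rho (z i) v + -1 * near_term n o rho (z i) (r i) v)).
  by apply: TS_add; [exact: TS_far_term|apply: TS_M; [exact: TS_cst|exact: TS_near_term]].
by apply/funext => v; rewrite mulN1r.
Qed.

Lemma locTS_barrier_sum : locTS Omega f.
Proof.
move=> w Ow; have [wo|wo] := ltrP `|w - o| rho; last first.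
  exists (fun=> 0); first exact: TS_cst.
  exact: near_barrier_sum0.
have Uw : U w by [].
exists (fun v => \sum_(i <- s) (c i * b w i) * (far_term n o rho (z i) v - near_term n o rho (z i) (r i) v)).
  by apply: TS_sum => i _; apply: TS_M; [exact: TS_cst|exact: TS_far_near].
exact: near_barrier_sum.
Qed.

Lemma pd21_barrier_sum_le (C : R) i j w : (i + j = n.+1)%N ->
  (forall (z w : R * R) (r : R), 0 < r -> r <= 3 * rho -> `|z - o| <= rho -> `|w - o| <= rho ->
   `|pd21 i j (far_term n o rho z) w| <= C / rho /\
   (`|w - z| <= 2 * r -> `|pd21 i j (near_term n o rho z r) w| <= C / r)) ->
  0 < C -> Omega w ->
  `|pd21 i j f w| <= C * ((\sum_(i <- s) c i) / rho * \1_(cube o rho) w +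
     \sum_(i <- s) c i / r i * \1_(cube (z i) (2 * r i)) w).
Proof.
move=> ij HC C0 Ow; have [wo|wo] := ltrP `|w - o| rho; last first.
  rewrite (pd21_near _ _ (near_barrier_sum0 wo)) pd21_cst0 normr0 mulr_ge0 ?(ltW C0) //.
  have sc : 0 <= \sum_(i <- s) c i by rewrite big_seq sumr_ge0.
  rewrite addr_ge0 //; first by rewrite mulr_ge0 ?divr_ge0 ?(ltW rho0).
  by rewrite big_seq sumr_ge0 // => k ks; rewrite mulr_ge0 ?divr_ge0 ?c0 // ltW // r0.
have Uw : U w by [].
rewrite (pd21_near _ _ (near_barrier_sum Uw)).
apply: le_trans (pd21_sum_le _ _ _ _ _ TS_far_near) _.
rewrite indicE mem_set ?mulr1 /cube /=; last exact: ltW.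
rewrite mulr_suml -big_split /= mulr_sumr big_seq [leRHS]big_seq; apply: ler_sum => k ks.
have b1 : `|c k * b w k| <= c k.
  rewrite normrM (ger0_norm (c0 ks)) ler_piMr ?c0 // /b; case: (_ && _); by rewrite ?normr1 ?normr0.
have [H1 H2] := HC (z k) w (r k) (r0 ks) (r3 ks) (zo ks) (ltW wo).
rewrite [leRHS](_ : _ = c k * (C / rho + C / r k * \1_(cube (z k) (2 * r k)) w)); last first.
  by ring.
apply: ler_pM => //.
rewrite (_ : (fun v => _) = (fun v => far_term n o rho (z k) v + -1 * near_term n o rho (z k) (r k) v)); last first.
  by apply/funext => v; rewrite mulN1r.
rewrite pd21D; [|exact: TS_far_term|by apply: TS_M; [exact: TS_cst|exact: TS_near_term]].
apply: le_trans (ler_normD _ _) _; apply: lerD => //.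
rewrite pd21Z; last exact: TS_near_term.
rewrite mulN1r normrN indicE; case: (boolP (w \in _)) => [/set_mem wz|/negP nz].
  by rewrite mulr1 H2.
rewrite mulr0 (@pd21_near i j _ (fun=> 0)) ?pd21_cst0 ?normr0 //.
have wz : 2 * r k < `|w - z k| by rewrite ltNge; apply/negP => wz; apply: nz; exact: mem_set.
have : \forall v \near w, cutoff (z k) (r k) v = 0.
  by apply: near_cutoff0; rewrite ?r0 //; apply: lt_trans wz; rewrite ltr_pM2r ?r0 //; lra.
by apply: filterS => v E; rewrite /near_term E mulr0.
Qed.

Lemma barrier_sum_near_x x : U x -> (forall i, i \in s -> ~ joined (outside U (z i) (r i)) x y) ->
  \forall v \near x, f v = 0.
Proof.
move=> Ux nj; have := near_barrier_sum Ux; apply: filterS => v ->.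
rewrite big_seq big1 // => i si; rewrite /b.
have -> : `[< joined (outside U (z i) (r i)) y x >] = false.
  by apply/asboolPn => H; apply: (nj _ si); exact: joined_sym.
by rewrite andbF mulr0 mul0r.
Qed.

Lemma barrier_sum_near_y : U y -> `|y - o| <= rho / 2 -> (forall i, i \in s -> 3 * r i <= `|y - z i|) ->
  \forall v \near y, f v = \sum_(i <- s) c i * (v.1 - (z i).1) ^+ n.
Proof.
move=> Uy yo yz.
apply: (@near_sum s (fun i v => c i * barrier U y n o rho (z i) (r i) v)) => i si.
have ri := r0 si; have yzi := yz _ si.
have ryz : r i < `|y - z i| by lra.
have n1 := near_barrier y n o rho (z i) open_ball_inter Uy ri.
have n2 : \forall v \near y, cutoff o (rho / 2) v = 1.
  by apply: near_cutoff1; rewrite ?divr_gt0 //; have := rho0; lra.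
have n3 : \forall v \near y, cutoff (z i) (r i) v = 0.
  by apply: near_cutoff0 => //; lra.
apply: filterS3 n1 n2 n3 => v -> E2 E3.
rewrite /near_term /far_term E2 E3 mulr0 subr0 mul1r ryz.
have -> : `[< joined (outside U (z i) (r i)) y y >] = true.
  by apply/asboolP; apply: joined_refl.
by rewrite mul1r.
Qed.

End BarrierSum.
End Barriers.

(** * Sobolev energy of a sum of barriers *)

Section Energy.
Context {R : realType}.
Implicit Types (z o w x y v : R * R) (f g G F H : R * R -> R) (rho : R) (U V Omega : set (R * R)).
Local Notation mu2 := (@lebesgue2 R).

Lemma powR_add_le (a b p : R) : 0 <= a -> 0 <= b -> 0 <= p ->
  (a + b) `^ p <= 2 `^ p * (a `^ p + b `^ p).
Proof.
move=> a0 b0 p0; pose c := Num.max a b.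
have c0 : 0 <= c by rewrite le_max a0.
have abc : a + b <= 2 * c by rewrite mulr_natl mulr2n lerD // le_max lexx ?orbT.
apply: (@le_trans _ _ ((2 * c) `^ p)); first by apply: ge0_ler_powR; rewrite ?nnegrE ?addr_ge0 ?mulr_ge0.
rewrite powRM // ler_wpM2l ?powR_ge0 // /c /Num.max; case: ifP => _.
  by rewrite lerDr powR_ge0.
by rewrite lerDl powR_ge0.
Qed.

Lemma integral_cube c (k r : R) : 0 <= r -> (\int[mu2]_w (k * \1_(cube c r) w)%:E = (k * (2 * r) ^+ 2)%:E)%E.
Proof.
move=> r0; have mQ := measurable_cube c r.
transitivity (\int[mu2]_(z in cube c r) (cst k%:E z))%E.
  rewrite [RHS]integral_mkcond; apply: eq_integral => z _.
  by rewrite /patch indicE; case: ifPn => _; rewrite ?mulr1 ?mulr0.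
by rewrite integral_cst // [X in (_ * X)%E]mu2_cube.
Qed.

Lemma measurable_sum_cubes (s : seq nat) (k t : nat -> R) (z : nat -> R * R) :
  measurable_fun setT (fun w => \sum_(i <- s) k i * \1_(cube (z i) (t i)) w).
Proof.
elim: s => [|i s IHs].
  by under eq_fun do rewrite big_nil; exact: measurable_cst.
under eq_fun do rewrite big_cons.
by apply: measurable_funD => //; exact: measurable_indic_cube.
Qed.

Lemma integral_sum_cubes (s : seq nat) (k t : nat -> R) (z : nat -> R * R) :
  (forall i, i \in s -> 0 <= k i /\ 0 <= t i) ->
  (\int[mu2]_w (\sum_(i <- s) k i * \1_(cube (z i) (t i)) w)%:E =
   (\sum_(i <- s) k i * (2 * t i) ^+ 2)%:E)%E.
Proof.
elim: s => [|i s IHs] H.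
  by rewrite big_nil; apply: integral0_eq => w _; rewrite big_nil.
have [ki ti] := H i (mem_head i s).
have Hs j : j \in s -> 0 <= k j /\ 0 <= t j by move=> js; apply: H; rewrite in_cons js orbT.
rewrite big_cons EFinD -(integral_cube (z i) (k i) ti) -IHs //.
rewrite -ge0_integralD //.
- by apply: eq_integral => w _; rewrite big_cons EFinD.
- by move=> w _; rewrite lee_fin mulr_ge0.
- by apply/measurable_EFinP; exact: measurable_indic_cube.
- by move=> w _; rewrite lee_fin big_seq sumr_ge0 // => j /Hs[? ?]; rewrite mulr_ge0.
- by apply/measurable_EFinP; exact: measurable_sum_cubes.
Qed.

Lemma indic_powR (a p : R) (A : set (R * R)) w : p != 0 ->
  (a * \1_A w) `^ p = a `^ p * \1_A w :> R.
Proof.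
by move=> p0; rewrite indicE; case: (w \in A); rewrite ?mulr1 // !mulr0 powR0.
Qed.

Definition extension_property Omega m (p theta : R) := forall f, sobolev Omega m p f ->
  exists F, [/\ sobolev setT m p F, {ae lebesgue2, forall z, Omega z -> F z = f z} &
    (sobolev_seminorm setT m p F <= theta%:E * sobolev_seminorm Omega m p f)%E].

Lemma distr_derivP Omega i j f g : is_distr_deriv Omega i j f g ->
  is_distr_deriv Omega i j f (distr_deriv Omega i j f).
Proof. by move=> H; apply: (xgetPex (fun=> 0)); exists g. Qed.

Lemma sobolev_smooth Omega m (p M : R) f H : open Omega -> 0 < p -> locTS Omega f ->
  measurable_fun setT H -> (forall w, 0 <= H w) ->
  (forall i w, (i <= m)%N -> Omega w -> `|pd21 i (m - i) f w| <= H w) ->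
  (\int[mu2]_w (H w `^ p)%:E <= M%:E)%E ->
  sobolev Omega m p f /\ (sobolev_seminorm Omega m p f <= (m.+1%:R * M `^ p^-1)%:E)%E.
Proof.
move=> oO p0 Hf mH H0 fH HM.
have D i j := is_distr_deriv_locTS i j oO Hf.
split; first split.
- by apply: loc_integrable_continuous => // w Ow; exact: locTS_continuous Hf Ow.
- move=> i im; exists (pd21 i (m - i) f); split; first exact: D.
  apply: (@le_lt_trans _ _ (M `^ p^-1)%:E); last exact: ltry.
  apply: Lp_norm_le mH H0 _ HM => //; first by case: (D i (m - i)%N) => -[].
  by apply: aeW => w; exact: fH.
rewrite /sobolev_seminorm.
apply: (@le_trans _ _ (\sum_(i < m.+1) (M `^ p^-1)%:E)%E); last first.
  by rewrite sumEFin sumr_const card_ord mulr_natl lexx.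
apply: lee_sum => i _; have DD := distr_derivP (D i (m - i)%N).
apply: Lp_norm_le mH H0 _ HM => //; first by case: DD => -[].
have := distr_deriv_ae oO DD (D i (m - i)%N); case=> N [mN N0 sN]; exists N; split=> // w nw.
by apply: sN => /= E; apply: nw => Ow; rewrite E // fH // -ltnS.
Qed.

Lemma Lp_norm_le_seminorm Omega m (p : R) f i : (i <= m)%N ->
  (Lp_norm Omega p (distr_deriv Omega i (m - i) f) <= sobolev_seminorm Omega m p f)%E.
Proof.
move=> im; rewrite /sobolev_seminorm (bigD1 (Ordinal (im : (i < m.+1)%N))) //=.
by rewrite leeDl // sume_ge0 // => k _; exact: Lnorm_ge0.
Qed.

Lemma derive1_pow n (c : R) :
  derive1 (fun t : R => (t - c) ^+ n.+1) = (fun t : R => n.+1%:R * (t - c) ^+ n).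
Proof.
have Hs := @smooth1_sub_cst R c; elim: n => [|n IHn].
  rewrite (_ : (fun t => _) = (fun t : R => t - c)); last by apply/funext => t; rewrite expr1.
  by rewrite derive1_sub_cst; apply/funext => t; rewrite expr0 mulr1.
rewrite (_ : (fun t => _) = (fun t : R => (t - c) * (t - c) ^+ n.+1)); last first.
  by apply/funext => t; rewrite exprS.
rewrite derive1ME //; last exact: smooth1X.
rewrite IHn derive1_sub_cst; apply/funext => t; rewrite mulr1 -[n.+2%:R]natr1 exprS; ring.
Qed.

Lemma derive1nZ n (a : R) (h : R -> R) : smooth1 h ->
  derive1n n (fun t => a * h t) = (fun t => a * derive1n n h t).
Proof.
move=> Hh; elim: n => // n IHn; rewrite derive1nS IHn derive1ZE; last exact: smooth1_derive1n.
by apply/funext => t; rewrite derive1nS.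
Qed.

Lemma derive1n_pow n (c t : R) : derive1n n (fun t : R => (t - c) ^+ n) t = n`!%:R.
Proof.
elim: n t => [|n IHn] t; first by rewrite /= expr0 fact0.
rewrite derive1nSr derive1_pow derive1nZ; last exact/smooth1X/smooth1_sub_cst.
by rewrite IHn factS natrM.
Qed.

Lemma pd1_sum_pow n (s : seq nat) (z : nat -> R * R) (c : nat -> R) :
  TS (fun v => \sum_(i <- s) c i * (v.1 - (z i).1) ^+ n) /\
  iter n pd1 (fun v => \sum_(i <- s) c i * (v.1 - (z i).1) ^+ n) = cst (n`!%:R * \sum_(i <- s) c i).
Proof.
pose h (a b : R) (v : R * R) := (fun t : R => b * (t - a) ^+ n) v.1 * (fun _ : R => 1 : R) v.2.
have Hs (a b : R) : smooth1 (fun t : R => b * (t - a) ^+ n).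
  exact/smooth1Z/smooth1X/smooth1_sub_cst.
have Hh a b : TS (h a b) by exact: TS_mul (Hs a b) (smooth1_cst 1).
have E : (fun v : R * R => \sum_(i <- s) c i * (v.1 - (z i).1) ^+ n) =
    (fun v => \sum_(i <- s) h (z i).1 (c i) v).
  by apply/funext => v; apply: eq_bigr => i _; rewrite /h mulr1.
rewrite E; split; first by apply: TS_sum.
elim: s {E} => [|i s IHs].
  rewrite big_nil mulr0 (_ : (fun v => _) = (fun=> 0)); last first.
    by apply/funext => v; rewrite big_nil.
  by elim: (n) => //= k ->; apply/funext => v; exact: pd1_cst.
rewrite (_ : (fun v => _) = (fun v => h (z i).1 (c i) v + \sum_(i <- s) h (z i).1 (c i) v)); last first.
  by apply/funext => v; rewrite big_cons.
rewrite iter_pd1D // ?IHs; last by apply: TS_sum.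
rewrite (iter_pd1_tensor n (fun _ : R => 1 : R) (Hs _ _)).
rewrite derive1nZ; last exact/smooth1X/smooth1_sub_cst.
by apply/funext => v; rewrite derive1n_pow big_cons /= mulr1 mulrDr [c i * _]mulrC.
Qed.

(** In the last bracket the first term is the energy of the cut-off around [o], of size (sum c_i /
    rho)^p rho^2, and the second that of the cubes. The weights [e] dominate pointwise the p-th
    power of the overlapping bounds c_i / r_i, so the overlap is settled separately, by packing. *)
Definition energy_bound (p : R) (n : nat) (C : R) :=
  forall Omega theta x y o rho (s : seq nat) (z : nat -> R * R) (r c e : nat -> R),
  open Omega -> 0 <= theta -> extension_property Omega n.+1 p theta ->
  Omega x -> Omega y -> x != y -> `|x - o| <= rho / 2 -> `|y - o| <= rho / 2 -> 0 < rho ->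
  (forall i, i \in s -> [/\ 0 < r i, r i <= 3 * rho, `|z i - o| <= rho, 0 <= c i & 0 <= e i]) ->
  (forall i, i \in s -> 3 * r i <= `|y - z i|) ->
  (forall i, i \in s ->
     ~ joined (outside [set w | Omega w /\ `|w - o| < rho] (z i) (r i)) x y) ->
  (forall w, (\sum_(i <- s) c i / r i * \1_(cube (z i) (2 * r i)) w) `^ p <=
     \sum_(i <- s) e i * \1_(cube (z i) (2 * r i)) w) ->
  (\sum_(i <- s) c i) `^ p <= C * theta `^ p * `|x - y| `^ (p - 2) *
    ((\sum_(i <- s) c i) `^ p * rho `^ (2 - p) + \sum_(i <- s) e i * r i ^+ 2).

Lemma energy_estimate (p : R) (n : nat) : 2 < p -> exists2 C, 0 < C & energy_bound p n C.
Proof.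
move=> p2; have p0 : 0 < p by lra.
have [C1 C10 HC1] := @cutoff_terms_le R n.
have [C2 C20 HC2] := extension_lower_bound p2.
pose k := 2 `^ p * C1 `^ p; have k0 : 0 <= k by rewrite mulr_ge0 ?powR_ge0.
have kk : 0 < k by rewrite mulr_gt0 ?powR_gt0.
(* n + 2 is the number of multi-indices of order n + 1; 16 comes from the area (4 r)^2 of a double
   cube; [k] from the p-th power of a sum of two terms. *)
exists (C2 `^ p * n.+2%:R `^ p * (16 * k)).
  by rewrite !mulr_gt0 ?powR_gt0.
move=> Omega theta x y o rho s z r c e oO th0 ext Ox Oy xy xo yo rho0 Hs yz nj Se.
set U := [set w | _] in nj.
pose f := barrier_sum U y n o rho s z r c.
have Hr i : i \in s -> 0 < r i by case/Hs.
have Hr3 i : i \in s -> r i <= 3 * rho by case/Hs.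
have Hzo i : i \in s -> `|z i - o| <= rho by case/Hs.
have Hc i : i \in s -> 0 <= c i by case/Hs.
have He i : i \in s -> 0 <= e i by case/Hs.
have Hf : locTS Omega f by exact: locTS_barrier_sum.
pose a := \sum_(i <- s) c i; have a0 : 0 <= a by rewrite /a big_seq sumr_ge0.
pose S w := \sum_(i <- s) c i / r i * \1_(cube (z i) (2 * r i)) w : R.
have S0 w : 0 <= S w.
  by rewrite /S big_seq sumr_ge0 // => i si; rewrite mulr_ge0 ?divr_ge0 ?Hc // ltW // Hr.
pose A w := a / rho * \1_(cube o rho) w : R.
have A0 w : 0 <= A w by rewrite mulr_ge0 ?divr_ge0 // ltW.
pose H w := C1 * (A w + S w).
have mH : measurable_fun setT H.
  apply: measurable_funM; first exact: measurable_cst.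
  by apply: measurable_funD; [exact: measurable_indic_cube|exact: measurable_sum_cubes].
have H0 w : 0 <= H w by rewrite mulr_ge0 ?addr_ge0 // ltW.
have fH i w : (i <= n.+1)%N -> Omega w -> `|pd21 i (n.+1 - i) f w| <= H w.
  move=> ni Ow; apply: pd21_barrier_sum_le => //; first by rewrite subnKC.
  by move=> z' w' r' *; apply: HC1 => //; rewrite subnKC.
pose M := 16 * k * (a `^ p * rho `^ (2 - p) + \sum_(i <- s) e i * r i ^+ 2).
have rho2 : rho `^ (2 - p) = rho ^+ 2 / rho `^ p.
  by rewrite powRB ?powR_mulrn ?ltW //; apply/implyP => _; rewrite gt_eqF.
have HM : (\int[mu2]_w (H w `^ p)%:E <= M%:E)%E.
  apply: (@le_trans _ _ (\int[mu2]_w ((k * (a / rho) `^ p * \1_(cube o rho) w)%:E +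
      (\sum_(i <- s) (k * e i) * \1_(cube (z i) (2 * r i)) w)%:E)))%E.
    apply: le_integral_ge0 => w _; first by rewrite lee_fin powR_ge0.
    rewrite -EFinD lee_fin.
    have -> : H w `^ p = C1 `^ p * (A w + S w) `^ p by rewrite powRM ?addr_ge0 // ltW.
    apply: (@le_trans _ _ (C1 `^ p * (2 `^ p * (A w `^ p + S w `^ p)))).
      by rewrite ler_wpM2l ?powR_ge0 // powR_add_le // ltW.
    rewrite mulrA [_ * 2 `^ p]mulrC -/k mulrDr lerD //.
      by rewrite /A indic_powR ?gt_eqF // mulrA.
    apply: (@le_trans _ _ (k * (\sum_(i <- s) e i * \1_(cube (z i) (2 * r i)) w))).
      by rewrite ler_wpM2l //; exact: Se.
    by rewrite mulr_sumr; under eq_bigr do rewrite mulrA.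
  rewrite ge0_integralD //.
  - rewrite (integral_cube _ _ (ltW rho0)) integral_sum_cubes; last first.
      by move=> i si; split; rewrite mulr_ge0 ?He ?(ltW (Hr _ si)).
    rewrite -EFinD lee_fin /M mulrDr; apply: lerD.
      rewrite powRM ?invr_ge0 ?(ltW rho0) // -powR_inv1 ?(ltW rho0) // -powRrM mulN1r powRN rho2.
      rewrite [leRHS](_ : _ = 4 * (k * (a `^ p * (rho `^ p)^-1) * (2 * rho) ^+ 2)).
        apply: ler_peMl; last by rewrite ler1n.
        by rewrite mulr_ge0 ?sqr_ge0 // mulr_ge0 // mulr_ge0 ?invr_ge0 ?powR_ge0.
      by field; rewrite gt_eqF // powR_gt0.
    rewrite mulr_sumr le_eqVlt; apply/orP; left; apply/eqP; apply: eq_bigr => i _; ring.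
  - by move=> w _; rewrite lee_fin !mulr_ge0 ?powR_ge0.
  - by apply/measurable_EFinP; exact: measurable_indic_cube.
  - move=> w _; rewrite lee_fin big_seq sumr_ge0 // => i si.
    by apply: mulr_ge0 => //; apply: mulr_ge0 => //; exact: He.
  - by apply/measurable_EFinP; exact: measurable_sum_cubes.
have M0 : 0 <= M.
  rewrite -lee_fin; apply: le_trans HM; apply: integral_ge0 => w _.
  by rewrite lee_fin powR_ge0.
have [sf semi] := sobolev_smooth oO p0 Hf mH H0 fH HM.
have [F [[lF DF] Ff FN]] := ext f sf.
pose N := theta * (n.+2%:R * M `^ p^-1).
have N0 : 0 <= N by rewrite !mulr_ge0 ?powR_ge0.
have FN' : (sobolev_seminorm setT n.+1 p F <= N%:E)%E.
  by apply: le_trans FN _; rewrite /N EFinM lee_wpmul2l.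
have [g1 [Dg1 _]] := DF _ (leqnn n.+1); have [g2 [Dg2 _]] := DF _ (leqnSn n).
have D1 := distr_derivP Dg1; have D2 := distr_derivP Dg2.
have L1 := le_trans (Lp_norm_le_seminorm setT p F (leqnn n.+1)) FN'.
have L2 := le_trans (Lp_norm_le_seminorm setT p F (leqnSn n)) FN'.
rewrite subnn in D1 L1; rewrite subSnn in D2 L2.
have [TSP dP] := pd1_sum_pow n s z c.
have Ux : U x by split=> //; apply: le_lt_trans xo _; rewrite ltr_pdivrMr // ltr_pMr // ltr1n.
have Uy : U y by split=> //; apply: le_lt_trans yo _; rewrite ltr_pdivrMr // ltr_pMr // ltr1n.
have fx : \forall v \near x, f v = 0 by exact: barrier_sum_near_x.
have fy : \forall v \near y, f v = \sum_(i <- s) c i * (v.1 - (z i).1) ^+ n.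
  exact: barrier_sum_near_y.
have := HC2 n N _ Omega f F _ _ _ x y lF D1 D2 N0 L1 L2 oO Ox Oy xy Ff fx fy TSP dP.
rewrite -/a => Ha.
(* The factor n! produced by the n-th derivative of the polynomial is at least 1 and is dropped. *)
have {}Ha : a <= C2 * N * `|x - y| `^ (1 - 2 / p).
  apply: le_trans Ha; apply: le_trans (ler_norm _).
  by rewrite ler_peMl // ler1n fact_gt0.
have {}Ha : a `^ p <= (C2 * N * `|x - y| `^ (1 - 2 / p)) `^ p.
  by apply: ge0_ler_powR; rewrite ?nnegrE ?(ltW p0) // !mulr_ge0 ?powR_ge0 // ltW.
apply: le_trans Ha _.
rewrite powRM ?mulr_ge0 ?powR_ge0 ?(ltW C20) // powRM ?(ltW C20) // /N.
rewrite powRM ?mulr_ge0 ?powR_ge0 // powRM ?powR_ge0 // -!powRrM mulVf ?gt_eqF // powRr1 //.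
have -> : (1 - 2 / p) * p = p - 2 by field; rewrite gt_eqF.
rewrite /M le_eqVlt; apply/orP; left; apply/eqP; ring.
Qed.

End Energy.

(** * Packing *)

Section Packing.
Context {R : realType}.
Implicit Types (w : R * R) (s : seq nat) (z : nat -> R * R) (d q : nat -> R).

(** The constant 5 makes the condition symmetric: a gap above d_i / 4 for the earlier point gives
    d_j <= d_i + |z_i - z_j| < 5 |z_i - z_j| for the later one. *)
Definition packed s z d := forall i j, i \in s -> j \in s -> i != j -> d i < 5 * `|z i - z j|.

Lemma packed_filter s z d (P : pred nat) : packed s z d -> packed [seq i <- s | P i] z d.
Proof. by move=> H i j; rewrite !mem_filter => /andP[_ si] /andP[_ sj]; exact: H. Qed.

Lemma truncn_eq_dist (a b : R) : 0 <= a -> 0 <= b -> Num.truncn a = Num.truncn b -> `|a - b| < 1.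
Proof.
move=> a0 b0 ab; have /andP[h1 h2] := truncn_itv a0; have /andP[h3 h4] := truncn_itv b0.
move: h1 h2; rewrite ab -natr1 => h1 h2; move: h4; rewrite -natr1 => h4.
by rewrite ltr_norml; lra.
Qed.

Lemma truncn_lt_nat (a : R) (M : nat) : 0 <= a -> a < M%:R -> (Num.truncn a < M)%N.
Proof.
by move=> a0 aM; have /andP[h1 h2] := truncn_itv a0; rewrite -(ltr_nat R); exact: le_lt_trans h1 aM.
Qed.

(** A cube of radius 18 T is covered by 181^2 cells of side T / 5, and two points in one cell would
    violate [packed]. The radius 18 T is what [large_sum_le] asks for: 9 d with d at most 2 T. *)
Lemma packing_count s z d w (T : R) : uniq s -> 0 < T -> packed s z d ->
  (forall i, i \in s -> T <= d i /\ `|z i - w| <= 18 * T) -> (size s <= 181 ^ 2)%N.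
Proof.
move=> us T0 ps Hs.
have T50 : 0 < T / 5 by rewrite divr_gt0.
pose g (t : R) := t / (T / 5) + 90.
have g01 (t : R) : `|t| <= 18 * T -> 0 <= g t < 181%:R.
  have -> : 18 * T = 90 * (T / 5) by field.
  move=> tT; have : `|t / (T / 5)| <= 90.
    by rewrite normrM normfV (gtr0_norm T50) ler_pdivrMr.
  by rewrite /g ler_norml => /andP[h1 h2]; apply/andP; split; lra.
pose code i := (Num.truncn (g ((z i).1 - w.1)), Num.truncn (g ((z i).2 - w.2))).
have zT i : i \in s -> `|(z i).1 - w.1| <= 18 * T /\ `|(z i).2 - w.2| <= 18 * T.
  by move=> /Hs[_]; rewrite norm2_le => /andP[].
have inj : {in s &, injective code}.
  move=> i j si sj [E1 E2]; apply/eqP; apply: contraT => ij.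
  have [zi1 zi2] := zT _ si; have [zj1 zj2] := zT _ sj.
  have /andP[a1 _] := g01 _ zi1; have /andP[a2 _] := g01 _ zi2.
  have /andP[b1 _] := g01 _ zj1; have /andP[b2 _] := g01 _ zj2.
  have := truncn_eq_dist a1 b1 E1; have := truncn_eq_dist a2 b2 E2.
  have D (t u : R) : g t - g u = (t - u) / (T / 5) by rewrite /g mulrBl opprD addrACA subrr addr0.
  rewrite !D !normrM normfV (gtr0_norm T50) !ltr_pdivrMr // !mul1r.
  have e1 : (z i).1 - w.1 - ((z j).1 - w.1) = (z i - z j).1 by rewrite /=; ring.
  have e2 : (z i).2 - w.2 - ((z j).2 - w.2) = (z i - z j).2 by rewrite /=; ring.
  rewrite e1 e2 => h2 h1; have : `|z i - z j| < T / 5 by rewrite norm2_lt h1.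
  have := ps _ _ si sj ij; have [] := Hs _ si; lra.
have -> : size s = size (map code s) by rewrite size_map.
have -> : (181 ^ 2 = size (allpairs pair (iota 0 181) (iota 0 181)))%N by rewrite size_allpairs !size_iota.
apply: uniq_leq_size; first by rewrite map_inj_in_uniq.
move=> _ /mapP[i si ->]; have [z1 z2] := zT _ si.
have /andP[a1 a2] := g01 _ z1; have /andP[b1 b2] := g01 _ z2.
by apply: allpairs_f; rewrite mem_iota /= add0n; exact: truncn_lt_nat.
Qed.

Lemma seq_upper_bound s q (t : R) : 0 < t -> exists k : nat, forall i, i \in s -> q i < t * 2 ^+ k.
Proof.
move=> t0; elim: s => [|i s [k Hk]]; first by exists 0%N.
have e0 : 0 < t / 2 by rewrite divr_gt0.
have [l Hl] := exists_half_pow (q i) e0.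
have {}Hl : q i < t * 2 ^+ l.
  move: Hl; rewrite ler_pdivrMr ?exprn_gt0 // => /le_lt_trans; apply.
  by rewrite ltr_pM2r ?exprn_gt0 //; lra.
exists (maxn k l) => j; rewrite in_cons => /orP[/eqP ->|js].
  apply: lt_le_trans Hl _; rewrite ler_pM2l // ler_weXn2l ?leq_maxr // ler1n //.
apply: lt_le_trans (Hk _ js) _; rewrite ler_pM2l // ler_weXn2l ?leq_maxl // ler1n //.
Qed.

(** At most N terms have t <= q_i < 2 t. Induction on the number of doublings needed to exceed all
    q_i sums a geometric series. *)
Lemma dyadic_sum_le s q (N b t : R) : 0 < b -> 0 < t ->
  (forall u, t <= u -> (size [seq i <- s | (u <= q i) && (q i < 2 * u)])%:R <= N) ->
  (forall i, i \in s -> t <= q i) ->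
  \sum_(i <- s) q i `^ (- b) <= N * t `^ (- b) / (1 - 2^-1 `^ b).
Proof.
move=> b0 t0 HN Hq; have [k Hk] := seq_upper_bound s q t0.
have h1 := half_powR_lt1 b0; set h := 2^-1 `^ b in h1 *.
have h0 : 0 <= h by exact: powR_ge0.
have h10 : 0 < (1 - h)^-1 by rewrite invr_gt0 subr_gt0.
have N0 : 0 <= N by apply: le_trans (HN t (lexx t)).
elim: k s t t0 HN Hq Hk => [|k IHk] s t t0 HN Hq Hk.
  case: s Hk Hq {HN} => [|i s] Hk Hq.
    by rewrite big_nil !mulr_ge0 ?powR_ge0 // ltW.
  have := Hk i (mem_head i s); have := Hq i (mem_head i s).
  by rewrite expr0 mulr1 => /le_lt_trans H /H; rewrite ltxx.
have t20 : 0 < 2 * t by rewrite mulr_gt0.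
rewrite (bigID (fun i => q i < 2 * t)) /=.
have H1 : \sum_(i <- s | q i < 2 * t) q i `^ (- b) <= N * t `^ (- b).
  apply: (@le_trans _ _ (\sum_(i <- [seq i <- s | (t <= q i) && (q i < 2 * t)]) t `^ (- b))).
    rewrite big_filter big_seq_cond [leRHS]big_seq_cond.
    rewrite [leRHS](eq_bigl (fun i => (i \in s) && (q i < 2 * t))); last first.
      by move=> i; case: (boolP (i \in s)) => // si; rewrite Hq.
    apply: ler_sum => i /andP[si _]; have tq := Hq _ si.
    have q0 : 0 < q i by apply: lt_le_trans tq.
    rewrite !powRN lef_pV2 ?posrE ?powR_gt0 //.
    by apply: ge0_ler_powR; rewrite ?nnegrE ?(ltW b0) ?(ltW t0) ?(ltW q0).
  rewrite big_const_seq count_predT iter_addr_0 -[leLHS]mulr_natl.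
  by apply: ler_wpM2r; [exact: powR_ge0|exact: HN].
have H2 : \sum_(i <- s | ~~ (q i < 2 * t)) q i `^ (- b) <= N * (2 * t) `^ (- b) / (1 - h).
  rewrite -big_filter; apply: IHk => //.
  - move=> u tu; rewrite -filter_predI; apply: le_trans (HN u _); last by lra.
    rewrite ler_nat [leqRHS](_ : _ = count (fun i => (u <= q i) && (q i < 2 * u)) s) ?size_filter //.
    by apply: sub_count => i /= /andP[].
  - by move=> i; rewrite mem_filter -leNgt => /andP[].
  - move=> i; rewrite mem_filter => /andP[_ si]; apply: lt_le_trans (Hk _ si) _.
    by rewrite exprS mulrA [t * 2]mulrC.
apply: le_trans (lerD H1 H2) _.
have -> : (2 * t) `^ (- b) = h * t `^ (- b).
  by rewrite powRM ?(ltW t0) // /h -powR_inv1 // -powRrM mulN1r.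
rewrite le_eqVlt; apply/orP; left; apply/eqP; field.
by rewrite gt_eqF // subr_gt0.
Qed.

(** Boundedly many cubes of each dyadic size reach [w], so a sum of negative powers is governed by
    the smallest size. *)
Lemma near_sum_le (b : R) : 0 < b -> exists2 C, 0 < C & forall s z d w (t : R),
  uniq s -> packed s z d -> 0 < t -> (forall i, i \in s -> t <= d i /\ `|z i - w| <= 6 * d i) ->
  \sum_(i <- s) d i `^ (- b) <= C * t `^ (- b).
Proof.
move=> b0; have h1 := half_powR_lt1 b0.
exists ((181 ^ 2)%N%:R / (1 - 2^-1 `^ b)); first by rewrite divr_gt0 ?subr_gt0 // ltr0n.
move=> s z d w t us ps t0 Hs; rewrite mulrAC; apply: dyadic_sum_le => //; last by move=> i /Hs[].
move=> u tu; rewrite ler_nat; have u0 : 0 < u by apply: lt_le_trans tu.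
apply: (packing_count (z := z) (d := d) (w := w) (T := u)) => //; first exact: filter_uniq.
  exact: packed_filter.
move=> i; rewrite mem_filter => /andP[/andP[ui iu] si]; split=> //.
have [_ /le_trans] := Hs _ si; apply; lra.
Qed.

(** For positive powers the largest size governs: the dyadic bound is applied to the inverses of the
    d_i. *)
Lemma large_sum_le (b : R) : 0 < b -> exists2 C, 0 < C & forall s z d w (rho : R),
  uniq s -> packed s z d -> (forall i, i \in s -> [/\ 0 < d i, d i <= rho & `|z i - w| <= 9 * d i]) ->
  0 < rho -> \sum_(i <- s) d i `^ b <= C * rho `^ b.
Proof.
move=> b0; have h1 := half_powR_lt1 b0.
exists ((181 ^ 2)%N%:R / (1 - 2^-1 `^ b)); first by rewrite divr_gt0 ?subr_gt0 // ltr0n.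
move=> s z d w rho us ps Hs rho0; rewrite mulrAC.
have E (a : R) : 0 < a -> a^-1 `^ (- b) = a `^ b.
  by move=> a0; rewrite -powR_inv1 ?(ltW a0) // -powRrM mulN1r opprK.
rewrite -(E rho rho0) (eq_big_seq (fun i => (d i)^-1 `^ (- b))); last first.
  by move=> i /Hs[di _ _]; rewrite E.
apply: dyadic_sum_le => //; first by rewrite invr_gt0.
  move=> u tu; rewrite ler_nat; have u0 : 0 < u by apply: lt_le_trans tu; rewrite invr_gt0.
  have T0 : 0 < (2 * u)^-1 by rewrite invr_gt0 mulr_gt0.
  apply: (packing_count (z := z) (d := d) (w := w) (T := (2 * u)^-1)) => //; first exact: filter_uniq.
    exact: packed_filter.
  move=> i; rewrite mem_filter => /andP[/andP[ui iu] si]; have [di _ zw] := Hs _ si.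
  split; first by rewrite -[d i]invrK lef_pV2 ?posrE ?invr_gt0 ?mulr_gt0 // ltW.
  apply: le_trans zw _.
  have -> : 18 * (2 * u)^-1 = 9 * u^-1 by field; rewrite gt_eqF.
  by rewrite ler_pM2l // -[d i]invrK lef_pV2 ?posrE ?invr_gt0.
by move=> i /Hs[di dr _]; rewrite lef_pV2 ?posrE.
Qed.

Lemma exists_min_seq s d : s != [::] -> exists2 i, i \in s & forall j, j \in s -> d i <= d j.
Proof.
elim: s => // i s IHs _; have [->|s0] := eqVneq s [::].
  by exists i; rewrite ?mem_head // => j; rewrite inE => /eqP ->.
have [k ks Hk] := IHs s0; have [ik|ki] := lerP (d i) (d k).
  exists i; rewrite ?mem_head // => j; rewrite in_cons => /orP[/eqP -> //|js].
  exact: le_trans ik (Hk _ js).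
exists k; rewrite ?in_cons ?ks ?orbT // => j /orP[/eqP ->|js]; [exact: ltW|exact: Hk].
Qed.

(** By [near_sum_le] the sum at [w] is at most a constant times the term of the smallest cube
    containing [w] (the dilated ones being meant), and the p-th power of that single term already
    occurs on the right. *)
Lemma overlap_powR_le (b p : R) : 0 < b -> 0 < p -> exists2 C, 0 < C & forall s z d w,
  uniq s -> packed s z d -> (forall i, i \in s -> 0 < d i) ->
  (\sum_(i <- s) d i `^ (- b) * \1_(cube (z i) (6 * d i)) w) `^ p <=
  \sum_(i <- s) C * d i `^ (- b * p) * \1_(cube (z i) (6 * d i)) w.
Proof.
move=> b0 p0; have [C C0 HC] := near_sum_le b0; exists (C `^ p); first exact: powR_gt0.
move=> s z d w us ps d0.
pose P i := `|z i - w| <= 6 * d i.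
have PE i : \1_(cube (z i) (6 * d i)) w = (P i)%:R :> R.
  rewrite indicE /P distrC; congr (_%:R); congr nat_of_bool.
  by apply/idP/idP => [/set_mem//|H]; exact: mem_set.
have sumE (h : nat -> R) : \sum_(i <- s) h i * \1_(cube (z i) (6 * d i)) w = \sum_(i <- [seq i <- s | P i]) h i.
  rewrite big_filter [RHS]big_mkcond; apply: eq_bigr => i _; rewrite PE.
  by case: (P i); rewrite ?mulr1 ?mulr0.
rewrite !sumE; set s' := [seq i <- s | P i].
have us' : uniq s' by exact: filter_uniq.
have ps' : packed s' z d by exact: packed_filter.
have Ps' i : i \in s' -> 0 < d i /\ P i by rewrite mem_filter => /andP[? /d0].
have [->|s0] := eqVneq s' [::]; first by rewrite !big_nil powR0 // gt_eqF.
have [i0 i0s Hmin] := exists_min_seq d s0; have [di0 _] := Ps' _ i0s.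
have S0 : 0 <= \sum_(i <- s') d i `^ (- b) by apply: sumr_ge0 => i _; exact: powR_ge0.
apply: (@le_trans _ _ ((C * d i0 `^ (- b)) `^ p)).
  apply: ge0_ler_powR; rewrite ?nnegrE ?(ltW p0) ?mulr_ge0 ?powR_ge0 ?(ltW C0) //.
  by apply: (HC s' z d w) => // i si; split; [exact: Hmin|case: (Ps' _ si)].
rewrite powRM ?powR_ge0 ?(ltW C0) // -powRrM (big_rem i0) //= lerDl.
by apply: sumr_ge0 => i _; rewrite mulr_ge0 ?powR_ge0.
Qed.

End Packing.

(** * Absorption and the sum over the chain *)

Section Conclusion.
Context {R : realType}.
Implicit Types (x y o w : R * R) (s : seq nat) (z : nat -> R * R) (d : nat -> R).
Implicit Types (U Omega : set (R * R)).

(** The term with [eps] is at most half of D^p and moves to the left. One power of D cancels, and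
    the root of order p - 1 turns delta^(p - 2) into delta^a. *)
Lemma absorb_le (p D A B a : R) : 2 < p -> a = (p - 2) / (p - 1) -> 0 <= D -> 0 <= A -> 0 <= B ->
  forall theta delta eps : R, 0 <= theta -> 0 <= delta -> A * theta `^ p * delta `^ (p - 2) * eps <= 2^-1 ->
  D `^ p <= A * theta `^ p * delta `^ (p - 2) * (D `^ p * eps + B * D) ->
  D <= (2 * A * B) `^ (p - 1)^-1 * (theta `^ (p / (p - 1)) * delta `^ a).
Proof.
move=> p2 aE D0 A0 B0 theta delta eps th0 de0.
set Q := A * theta `^ p * delta `^ (p - 2); move=> Qe HD.
have Q0 : 0 <= Q by rewrite !mulr_ge0 ?powR_ge0.
have p10 : 0 < p - 1 by lra.
have [Dz|Dnz] := eqVneq D 0; first by rewrite Dz !mulr_ge0 ?powR_ge0.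
have {Dnz} Dp : 0 < D by rewrite lt_neqAle eq_sym Dnz.
have DD : D `^ p = D `^ (p - 1) * D.
  by rewrite -[X in _ * X](powRr1 D0) -powRD ?subrK // (gt_eqF Dp) implybT.
have H1 : D `^ (p - 1) <= 2 * Q * B.
  have Dp0 : 0 <= D `^ p by exact: powR_ge0.
  have H2 : D `^ p * (Q * eps) <= D `^ p * 2^-1 by exact: ler_wpM2l.
  have : D `^ p <= 2 * Q * B * D by move: HD; rewrite mulrDr; lra.
  by rewrite DD ler_pM2r.
have -> : D = (D `^ (p - 1)) `^ (p - 1)^-1 by rewrite -powRrM divff ?powRr1 ?gt_eqF.
apply: (@le_trans _ _ ((2 * Q * B) `^ (p - 1)^-1)).
  apply: ge0_ler_powR; rewrite ?nnegrE ?invr_ge0 ?(ltW p10) ?powR_ge0 //.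
  exact: le_trans (powR_ge0 _ _) H1.
have -> : 2 * Q * B = 2 * A * B * (theta `^ p * delta `^ (p - 2)) by rewrite /Q; ring.
rewrite powRM ?mulr_ge0 ?powR_ge0 // [X in _ * X <= _]powRM ?powR_ge0 // -!powRrM.
by rewrite aE.
Qed.

(** [energy_bound] with r_i = 3 d_i and c_i = d_i^a. The exponents satisfy 2 - (1 - a) p = a, so the
    energy of the cubes is again a multiple of the sum of the d_i^a; the 9 is the square of 3. *)
Lemma good_sum_le (p a C1 C2 : R) (n : nat) : 2 < p -> a = (p - 2) / (p - 1) -> 0 < C2 ->
  energy_bound p n C1 ->
  (forall s z d w, uniq s -> packed s z d -> (forall i, i \in s -> 0 < d i) ->
    (\sum_(i <- s) d i `^ (- (1 - a)) * \1_(cube (z i) (6 * d i)) w) `^ p <=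
    \sum_(i <- s) C2 * d i `^ (- (1 - a) * p) * \1_(cube (z i) (6 * d i)) w) ->
  forall Omega (theta : R) x y o (rho : R) s z d,
  open Omega -> 0 <= theta -> extension_property Omega n.+1 p theta ->
  Omega x -> Omega y -> x != y -> `|x - o| <= rho / 2 -> `|y - o| <= rho / 2 -> 0 < rho ->
  uniq s -> packed s z d ->
  (forall i, i \in s -> [/\ 0 < d i, `|z i - o| <= rho, 9 * d i <= `|y - z i| &
     ~ joined (outside [set w | Omega w /\ `|w - o| < rho] (z i) (3 * d i)) x y]) ->
  (\sum_(i <- s) d i `^ a) `^ p <= C1 * theta `^ p * `|x - y| `^ (p - 2) *
    ((\sum_(i <- s) d i `^ a) `^ p * rho `^ (2 - p) + 9 * C2 * \sum_(i <- s) d i `^ a).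
Proof.
move=> p2 aE C20 HC1 HC2 Omega theta x y o rho s z d oO th0 ext Ox Oy xy xo yo rho0 us ps Hs.
have p10 : 0 < p - 1 by lra.
have d0 i : i \in s -> 0 < d i by case/Hs.
have dE i : i \in s -> d i `^ (- (1 - a) * p) * d i ^+ 2 = d i `^ a.
  move=> /d0 di; rewrite -powR_mulrn ?(ltW di) // -powRD ?(gt_eqF di) ?implybT //.
  by congr (_ `^ _); rewrite aE; field; rewrite gt_eqF.
have dE' i : i \in s -> d i `^ a / (3 * d i) <= d i `^ (- (1 - a)).
  move=> /d0 di; have -> : - (1 - a) = a + - 1 by ring.
  rewrite powRD ?(gt_eqF di) ?implybT // powR_inv1 ?(ltW di) // invfM mulrCA.
  by apply: ler_piMl; [rewrite mulr_ge0 ?powR_ge0 // invr_ge0 ltW|rewrite invf_le1 // ler1n].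
have zE i : 2 * (3 * d i) = 6 * d i by ring.
have zi_y i : i \in s -> `|y - z i| <= 2 * rho.
  case/Hs=> _ zo _ _; have -> : y - z i = (y - o) - (z i - o) by rewrite opprB addrA subrK.
  by apply: le_trans (ler_normB _ _) _; lra.
have := HC1 Omega theta x y o rho s z (fun i => 3 * d i) (fun i => d i `^ a)
  (fun i => C2 * d i `^ (- (1 - a) * p)) oO th0 ext Ox Oy xy xo yo rho0.
have -> : \sum_(i <- s) C2 * d i `^ (- (1 - a) * p) * (3 * d i) ^+ 2 = 9 * C2 * \sum_(i <- s) d i `^ a.
  rewrite mulr_sumr; apply: eq_big_seq => i si; rewrite -(dE _ si); ring.
apply.
- move=> i si; have [di zo ydi _] := Hs _ si; have yzi := zi_y _ si; split=> //.
  + by rewrite mulr_gt0.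
  + lra.
  + exact: powR_ge0.
  + by rewrite mulr_ge0 ?powR_ge0 // ltW.
- move=> i si; have [di _ ydi _] := Hs _ si.
  by apply: le_trans ydi; rewrite mulrA -natrM.
- by move=> i /Hs[].
move=> w; have := HC2 s z d w us ps d0.
have -> : \sum_(i <- s) C2 * d i `^ (- (1 - a) * p) * \1_(cube (z i) (6 * d i)) w =
    \sum_(i <- s) C2 * d i `^ (- (1 - a) * p) * \1_(cube (z i) (2 * (3 * d i))) w.
  by apply: eq_bigr => i _; rewrite zE.
apply: le_trans; apply: ge0_ler_powR; rewrite ?nnegrE; first lra.
- rewrite big_seq sumr_ge0 // => i si; rewrite mulr_ge0 // mulr_ge0 ?powR_ge0 //.
  by rewrite invr_ge0 mulr_ge0 // ltW // d0.
- by rewrite sumr_ge0 // => i _; rewrite mulr_ge0 ?powR_ge0.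
rewrite big_seq [leRHS]big_seq; apply: ler_sum => i si; rewrite zE ler_wpM2r //.
exact: dE'.
Qed.

(** A chain of one step that stays at x, with a radius whose power of exponent a is at most the
    given t. *)
Lemma intrinsic_dist_refl (a : R) Omega x : 0 < a < 1 -> open Omega -> Omega x ->
  (intrinsic_dist a Omega x x <= 0)%E.
Proof.
move=> a01 oO Ox; have /nbhs_ballP[e /= e0 eO] := open_nbhs_nbhs (conj oO Ox).
have a0 : 0 < a by case/andP: a01.
apply/lee_addgt0Pr => t t0; rewrite add0e.
pose r := Num.min e (t `^ a^-1); have r0 : 0 < r by rewrite lt_min e0 powR_gt0.
have := @intrinsic_dist_chain R a Omega (fun=> x) (fun=> r) 1 a01.
rewrite big_ord1 => /(_ (fun _ _ => r0)) H; apply: le_trans (H _ _ _) _ => //.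
- move=> i w _ wx; apply: eO; rewrite -ball_normE /ball_ /= distrC.
  by apply: lt_le_trans wx _; rewrite ge_min lexx.
- by move=> i _; rewrite subrr normr0 divr_ge0 // ltW.
rewrite lee_fin; apply: (@le_trans _ _ ((t `^ a^-1) `^ a)).
  by apply: ge0_ler_powR; rewrite ?nnegrE ?powR_ge0 ?(ltW a0) ?(ltW r0) // ge_min lexx orbT.
by rewrite -powRrM mulVf ?gt_eqF // powRr1 // ltW.
Qed.

Lemma class_sum_le (p a C1 C2 C3 : R) (n : nat) : 2 < p -> a = (p - 2) / (p - 1) ->
  0 < C1 -> 0 < C2 -> energy_bound p n C1 ->
  (forall s z d w, uniq s -> packed s z d -> (forall i, i \in s -> 0 < d i) ->
    (\sum_(i <- s) d i `^ (- (1 - a)) * \1_(cube (z i) (6 * d i)) w) `^ p <=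
    \sum_(i <- s) C2 * d i `^ (- (1 - a) * p) * \1_(cube (z i) (6 * d i)) w) ->
  (forall s z d w (rho : R), uniq s -> packed s z d ->
    (forall i, i \in s -> [/\ 0 < d i, d i <= rho & `|z i - w| <= 9 * d i]) ->
    0 < rho -> \sum_(i <- s) d i `^ a <= C3 * rho `^ a) ->
  forall Omega (theta : R) x y (rho : R) s z d,
  open Omega -> 0 <= theta -> extension_property Omega n.+1 p theta ->
  Omega x -> Omega y -> x != y -> `|x - y| <= rho / 2 -> 0 < rho ->
  C1 * theta `^ p * `|x - y| `^ (p - 2) * rho `^ (2 - p) <= 2^-1 ->
  uniq s -> packed s z d ->
  (forall i, i \in s -> [/\ 0 < d i, d i <= 2 * rho, `|z i - x| <= rho &
     ~ joined (outside [set w | Omega w /\ `|w - x| < rho] (z i) (3 * d i)) x y]) ->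
  \sum_(i <- s) d i `^ a <=
    2 * ((2 * C1 * (9 * C2)) `^ (p - 1)^-1 * (theta `^ (p / (p - 1)) * `|x - y| `^ a)) +
    C3 * (2 * rho) `^ a.
Proof.
move=> p2 aE C10 C20 HC1 HC2 HC3 Omega theta x y rho s z d oO th0 ext Ox Oy xy xyr rho0 eps us ps Hs.
set T := (2 * C1 * (9 * C2)) `^ _ * _.
have xo : `|x - x| <= rho / 2 by rewrite subrr normr0 divr_ge0 // ltW.
have yo : `|y - x| <= rho / 2 by rewrite distrC.
have absorb s' : (\sum_(i <- s') d i `^ a) `^ p <= C1 * theta `^ p * `|x - y| `^ (p - 2) *
    ((\sum_(i <- s') d i `^ a) `^ p * rho `^ (2 - p) + 9 * C2 * \sum_(i <- s') d i `^ a) ->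
    \sum_(i <- s') d i `^ a <= T.
  move=> H; apply: (absorb_le p2 aE _ _ _ th0 _ eps H) => //; last by rewrite mulr_ge0 // ltW.
    by apply: sumr_ge0 => i _; exact: powR_ge0.
  exact: ltW.
pose P1 i := 9 * d i <= `|y - z i|; pose P2 i := 9 * d i <= `|x - z i|.
have H1 : \sum_(i <- [seq i <- s | P1 i]) d i `^ a <= T.
  apply: absorb; apply: (good_sum_le (z := z) p2 aE C20 HC1 HC2 oO th0 ext Ox Oy xy xo yo rho0) => //.
  - exact: filter_uniq.
  - exact: packed_filter.
  by move=> i; rewrite mem_filter => /andP[P1i /Hs[di _ zx nj]]; split.
(* The roles of x and y are exchanged: the function now vanishes near y and is a polynomial near
   x. *)
have H2 : \sum_(i <- [seq i <- s | ~~ P1 i & P2 i]) d i `^ a <= T.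
  apply: absorb; rewrite distrC; rewrite eq_sym in xy.
  apply: (good_sum_le (z := z) p2 aE C20 HC1 HC2 oO th0 ext Oy Ox xy yo xo rho0) => //.
  - exact: filter_uniq.
  - exact: packed_filter.
  move=> i; rewrite mem_filter => /andP[/andP[_ P2i] /Hs[di _ zx nj]]; split=> //.
  by move=> /joined_sym.
have H3 : \sum_(i <- [seq i <- s | ~~ P1 i & ~~ P2 i]) d i `^ a <= C3 * (2 * rho) `^ a.
  apply: (HC3 _ z d x) => //; last by rewrite mulr_gt0.
  - exact: filter_uniq.
  - exact: packed_filter.
  move=> i; rewrite mem_filter => /andP[/andP[_ nP2] /Hs[di dr zx _]]; split=> //.
  by rewrite distrC ltW // ltNge.
have -> : \sum_(i <- s) d i `^ a = \sum_(i <- [seq i <- s | P1 i]) d i `^ a +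
    (\sum_(i <- [seq i <- s | ~~ P1 i & P2 i]) d i `^ a +
     \sum_(i <- [seq i <- s | ~~ P1 i & ~~ P2 i]) d i `^ a).
  by rewrite !big_filter (bigID P1) /= [X in _ + X = _](bigID P2).
rewrite [2 * T]mulr_natl mulr2n -addrA.
by apply: lerD => //; exact: lerD.
Qed.

(** Were x and y not joined, every cube would separate them. One cube of radius rho / 10 centred at
    distance rho / 2 from x is far enough from y, and with c = 1 the energy estimate reads 1 <=
    1/2. *)
Lemma ball_joined (p C1 : R) (n : nat) : 2 < p -> 0 < C1 -> energy_bound p n C1 ->
  forall Omega (theta : R) x y (rho : R),
  open Omega -> 0 <= theta -> extension_property Omega n.+1 p theta ->
  Omega x -> Omega y -> x != y -> `|x - y| <= rho / 10 -> 0 < rho ->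
  C1 * theta `^ p * `|x - y| `^ (p - 2) * rho `^ (2 - p) * (1 + 10 `^ p) <= 2^-1 ->
  joined [set w | Omega w /\ `|w - x| < rho] x y.
Proof.
move=> p2 C10 HC1 Omega theta x y rho oO th0 ext Ox Oy xy xyr rho0 eps.
apply: contrapT => nj; pose z0 : R * R := (x.1 + rho / 2, x.2).
have zx : `|z0 - x| = rho / 2.
  have -> : z0 - x = (rho / 2, 0) by rewrite /z0 /=; congr pair; rewrite /= ?subrr // addrAC subrr add0r.
  apply/eqP; rewrite eq_le norm2_le /= normr0 gtr0_norm ?divr_gt0 // lexx divr_ge0 ?(ltW rho0) //=.
  rewrite leNgt norm2_lt /= gtr0_norm ?divr_gt0 // ltxx //.
have r0 : 0 < rho / 10 by rewrite divr_gt0.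
have xo : `|x - x| <= rho / 2 by rewrite subrr normr0 divr_ge0 // ltW.
have yo : `|y - x| <= rho / 2 by rewrite distrC; lra.
have := HC1 Omega theta x y x rho [:: 0%N] (fun=> z0) (fun=> rho / 10) (fun=> 1)
  (fun=> (1 / (rho / 10)) `^ p) oO th0 ext Ox Oy xy xo yo rho0.
rewrite !big_seq1 powR1.
have -> : 1 * rho `^ (2 - p) + (1 / (rho / 10)) `^ p * (rho / 10) ^+ 2 =
    rho `^ (2 - p) * (1 + 10 `^ p * 10^-1 ^+ 2).
  rewrite mul1r mulrDr mulr1; congr (_ + _).
  have -> : 1 / (rho / 10) = 10 * rho^-1 by field; rewrite gt_eqF.
  rewrite powRM ?invr_ge0 ?(ltW rho0) // -powR_inv1 ?(ltW rho0) // -powRrM mulN1r powRN.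
  rewrite powRB ?(gt_eqF rho0) ?implybT // powR_mulrn ?(ltW rho0) // exprMn; ring.
move=> H; suff : (1 : R) <= 2^-1 by lra.
apply: le_trans (H _ _ _ _) _.
- move=> i _; split=> //; [lra|by rewrite zx; lra|exact: powR_ge0].
- move=> i _; have := ler_normB (z0 - y) (x - y).
  have -> : z0 - y - (x - y) = z0 - x by rewrite opprB addrA subrK.
  by rewrite zx [`|z0 - y|]distrC; lra.
- move=> i _ J; apply: nj; apply: joinedS J; by move=> w [].
- by move=> w; rewrite !big_seq1 indic_powR // gt_eqF //; lra.
apply: le_trans eps; rewrite mulrA; apply: ler_wpM2l.
  by rewrite !mulr_ge0 ?powR_ge0 // ltW.
rewrite lerD2l ler_piMr ?powR_ge0 // expr2; lra.
Qed.

End Conclusion.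

Section Scale.
Context {R : realType}.

(** Consecutive points of the chain may be arbitrarily close; indices of the same parity are never
    consecutive. *)
Lemma parity_packed (n : nat) (z : nat -> R * R) (d : nat -> R) (b : bool) :
  (forall i j, (i.+1 < j <= n)%N -> d i / 4 < `|z j - z i|) ->
  (forall i j, d j <= d i + `|z j - z i|) ->
  packed [seq i <- iota 0 n | odd i == b] z d.
Proof.
move=> far lip i j; rewrite !mem_filter !mem_iota /= !add0n => /andP[/eqP oi iN] /andP[/eqP oj jN] ij.
have gap k l : odd k = odd l -> (k < l)%N -> (l < n)%N -> d k / 4 < `|z l - z k|.
  move=> okl kl ln; apply: far; rewrite (ltnW ln) andbT ltn_neqAle kl andbT.
  by apply/eqP => E; move: okl; rewrite -E /=; case: (odd k).
case: (ltngtP i j) ij => // ij _.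
  by have := gap i j (etrans oi (esym oj)) ij jN; have := normr_ge0 (z j - z i); rewrite [`|z i - z j|]distrC; lra.
have := gap j i (etrans oj (esym oi)) ij iN; have := lip j i; lra.
Qed.

(** The exponent p / (p - 2) is such that the power 2 - p of the scale cancels theta^p delta^(p -
    2), leaving C / K^(p - 2). *)
Lemma scale_exists (p C : R) : 2 < p -> 0 < C -> exists2 K, 10 <= K &
  forall theta delta : R, 1 <= theta -> 0 < delta ->
  C * theta `^ p * delta `^ (p - 2) * (K * theta `^ (p / (p - 2)) * delta) `^ (2 - p) <= 2^-1.
Proof.
move=> p2 C0; have p20 : 0 < p - 2 by lra.
exists (Num.max 10 ((2 * C) `^ (p - 2)^-1)); first by rewrite le_max lexx.
move=> theta delta th1 de0; set K := Num.max _ _.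
have K0 : 0 < K by rewrite lt_max ltr0n.
have th0 : 0 < theta by apply: lt_le_trans th1.
have KC : 2 * C <= K `^ (p - 2).
  have -> : 2 * C = ((2 * C) `^ (p - 2)^-1) `^ (p - 2).
    by rewrite -powRrM mulVf ?gt_eqF // powRr1 // mulr_ge0 // ltW.
  by apply: ge0_ler_powR; rewrite ?nnegrE ?powR_ge0 ?(ltW p20) ?(ltW K0) // le_max lexx orbT.
have -> : 2 - p = - (p - 2) by rewrite opprB.
rewrite powRN powRM ?mulr_ge0 ?powR_ge0 ?(ltW K0) ?(ltW de0) // powRM ?powR_ge0 ?(ltW K0) //.
rewrite -powRrM -[p / _ * _]mulrA mulVf ?gt_eqF // mulr1.
set T := theta `^ p; set D := delta `^ _; set Q := K `^ _ in KC *.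
have T0 : 0 < T by exact: powR_gt0.
have D0 : 0 < D by exact: powR_gt0.
have Q0 : 0 < Q by exact: powR_gt0.
have -> : C * T * D * (Q * T * D)^-1 = C / Q by field; rewrite !gt_eqF.
by rewrite ler_pdivrMr //; lra.
Qed.

Lemma theta_powR_le (p theta : R) : 2 < p -> 1 <= theta -> theta `^ (p / (p - 1)) <= theta `^ (3 * p / (p - 1)).
Proof.
move=> p2 th1; apply: ler_powR => //; rewrite ler_pM2r ?invr_gt0; lra.
Qed.

End Scale.

Theorem theorem1p8 (R : realType) (p alpha : R) (m : nat)
    (p_gt2 : 2 < p) (m_ge1 : (1 <= m)%N)
    (alphaE : alpha = (p - 2) / (p - 1)) :
  exists2 Ct : R, 0 < Ct &
  forall (Omega : set (R * R)) (theta : R),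
    domain Omega -> bounded_set Omega -> simply_connected Omega ->
    1 <= theta ->
    (forall f : R * R -> R, sobolev Omega m p f ->
      exists F : R * R -> R,
        [/\ sobolev setT m p F,
            {ae lebesgue2, forall z, Omega z -> F z = f z} &
            (sobolev_seminorm setT m p F <=
               theta%:E * sobolev_seminorm Omega m p f)%E]) ->
    forall x y : R * R, Omega x -> Omega y ->
      (intrinsic_dist alpha Omega x y <=
         (Ct * theta `^ (3 * p / (p - 1)) * `|x - y| `^ alpha)%:E)%E.
Proof.
case: m m_ge1 => // n _.
have p10 : 0 < p - 1 by lra.
have a0 : 0 < alpha by rewrite alphaE divr_gt0 //; lra.
have a1 : alpha < 1 by rewrite alphaE ltr_pdivrMr // mul1r; lra.
have a01 : 0 < alpha < 1 by rewrite a0.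
have p0 : 0 < p by lra.
have b0 : 0 < 1 - alpha by rewrite subr_gt0.
have [C1 C10 HC1] := energy_estimate n p_gt2.
have [C2 C20 HC2] := overlap_powR_le b0 p0.
have [C3 C30 HC3] := large_sum_le a0.
(* One scale serves both [ball_joined], which carries the factor 1 + 10^p, and [class_sum_le]. *)
have C1' : 0 < C1 * (1 + 10 `^ p) by rewrite mulr_gt0 // addr_gt0 ?powR_gt0.
have [K K10 HK] := scale_exists p_gt2 C1'.
have K0 : 0 < K by apply: lt_le_trans K10.
pose A := (2 * C1 * (9 * C2)) `^ (p - 1)^-1.
have A0 : 0 < A by rewrite powR_gt0 // !mulr_gt0.
pose B := C3 * (2 * K) `^ alpha.
have B0 : 0 < B by rewrite mulr_gt0 ?powR_gt0 // mulr_gt0.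
have Ct0 : 0 < 2 * (2 * A + B) by rewrite mulr_gt0 // addr_gt0 // mulr_gt0.
exists (2 * (2 * A + B)) => //.
move=> Omega theta [oO _] _ sc th1 ext x y Ox Oy.
have th0 : 0 <= theta by apply: le_trans th1.
have [<-|xy] := eqVneq x y.
  apply: le_trans (intrinsic_dist_refl a01 oO Ox) _.
  by rewrite lee_fin mulr_ge0 ?powR_ge0 // mulr_ge0 ?powR_ge0 // ltW.
set delta := `|x - y|; have de0 : 0 < delta by rewrite normr_gt0 subr_eq0.
pose t := theta `^ (p / (p - 2)).
have t1 : 1 <= t by rewrite -(powRr0 theta); apply: ler_powR => //; rewrite divr_ge0 //; lra.
pose rho := K * t * delta.
have rho10 : 10 * delta <= rho.
  by rewrite /rho ler_pM2r // -[leLHS]mulr1; apply: ler_pM.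
have rho0 : 0 < rho by apply: lt_le_trans rho10; rewrite mulr_gt0.
have eps := HK theta delta th1 de0; rewrite -/t -/rho in eps.
have eps1 : C1 * theta `^ p * delta `^ (p - 2) * rho `^ (2 - p) * (1 + 10 `^ p) <= 2^-1.
  by apply: le_trans eps; rewrite le_eqVlt; apply/orP; left; apply/eqP; ring.
have eps2 : C1 * theta `^ p * delta `^ (p - 2) * rho `^ (2 - p) <= 2^-1.
  apply: le_trans eps1; apply: ler_peMr; last by rewrite lerDl powR_ge0.
  by rewrite !mulr_ge0 ?powR_ge0 // ltW.
set U := [set w | Omega w /\ `|w - x| < rho].
have J : joined U x y by apply: (ball_joined p_gt2 C10 HC1 oO th0 ext) => //; rewrite -/delta; lra.
have oU : open U by exact: open_ball_inter.
(* A point off U at distance rho from x: it bounds every d_i by 2 rho and shows that the complement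
   of U is not empty. *)
pose u : R * R := (x.1 + rho, x.2).
have ux : `|u - x| = rho.
  have -> : u - x = (rho, 0) by rewrite /u /=; congr pair; rewrite /= ?subrr // addrAC subrr add0r.
  apply/eqP; rewrite eq_le norm2_le /= normr0 gtr0_norm // lexx (ltW rho0) /=.
  by rewrite leNgt norm2_lt /= gtr0_norm // ltxx.
have nU : (~` U) u by move=> [_]; rewrite ux ltxx.
have U0 : ~` U !=set0 by exists u.
have [k [z [z0 zk Hz zstep zfar]]] := separating_packed_chain sc oO J.
pose d i := dist (z i) (~` U).
have Hd i : (i <= k)%N -> [/\ 0 < d i, d i <= 2 * rho, `|z i - x| <= rho &
    ~ joined (outside U (z i) (3 * d i)) x y].
  move=> ik; have [[Oz zx] nj] := Hz i ik; split=> //; last exact: ltW.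
    exact: open_dist_gt0.
  apply: le_trans (dist_le (z i) nU) _; have := ler_normB (z i - x) (u - x).
  by rewrite opprB addrA subrK ux; lra.
have k0 : (0 < k)%N.
  by rewrite lt0n; apply: contra_neq xy => k0; rewrite -z0 -zk k0.
have chain : (intrinsic_dist alpha Omega x y <= (\sum_(i < k) d i `^ alpha)%:E)%E.
  rewrite -z0 -zk; apply: intrinsic_dist_chain => //.
  - by move=> i ik; have [] := Hd i (ltnW ik).
  - by move=> i w ik wz; have [] : U w by apply: (@dist_ball _ (z i)); rewrite distrC.
apply: le_trans chain _; rewrite lee_fin.
have lip i j : d j <= d i + `|z j - z i| by exact: dist_lip.
pose S b := \sum_(i <- [seq i <- iota 0 k | odd i == b]) d i `^ alpha.
have SE : \sum_(i < k) d i `^ alpha = S true + S false.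
  rewrite -(big_mkord xpredT (fun i => d i `^ alpha)) /index_iota subn0 /S !big_filter.
  rewrite (bigID odd) /=; congr (_ + _); apply: eq_bigl => i; by case: (odd i).
have Sle b : S b <= 2 * (A * (theta `^ (p / (p - 1)) * delta `^ alpha)) + C3 * (2 * rho) `^ alpha.
  apply: (class_sum_le (z := z) p_gt2 alphaE C10 C20 HC1 HC2 HC3 oO th0 ext Ox Oy xy _ rho0 eps2) => //.
  - by rewrite -/delta; lra.
  - exact/filter_uniq/iota_uniq.
  - exact: parity_packed.
  by move=> i; rewrite mem_filter mem_iota add0n => /andP[_ /andP[_ ik]]; exact: Hd (ltnW ik).
(* Since alpha p / (p - 2) = p / (p - 1), the large cubes bring the same power of theta as the
   others. *)
have rhoE : C3 * (2 * rho) `^ alpha = B * (theta `^ (p / (p - 1)) * delta `^ alpha).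
  have -> : 2 * rho = 2 * K * (t * delta) by rewrite /rho; ring.
  rewrite /B powRM ?mulr_ge0 ?(ltW K0) ?(ltW de0) ?powR_ge0 // powRM ?powR_ge0 ?(ltW de0) //.
  rewrite /t -powRrM !mulrA; congr (_ * _ `^ _ * _).
  by rewrite alphaE; field; apply/andP; split; rewrite gt_eqF //; lra.
set T := theta `^ (p / (p - 1)) * delta `^ alpha in Sle rhoE.
(* The power p / (p - 1) of theta obtained so far is below the claimed one, as theta is at least
   1. *)
have TT : T <= theta `^ (3 * p / (p - 1)) * delta `^ alpha.
  by rewrite ler_wpM2r ?powR_ge0 // theta_powR_le.
rewrite SE -mulrA; apply: (@le_trans _ _ (2 * (2 * A + B) * T)).
  by have := Sle true; have := Sle false; rewrite rhoE; lra.
by rewrite ler_wpM2l // ltW.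
Qed.
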